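(* Let $\varphi_1,\varphi_2$ be two (locally defined) non-degenerate $\mathrm{SG}$-classical phase functions on $\mathbb R^d\times\mathbb R^s$ of order $(1,1)$, with associated functions $\tilde\varphi_i=(\iota^{-1}\times\iota^{-1})^*\varphi_i\in\tilde y^{-1}\tilde\gamma^{-1}\mathscr C^\infty$ on open subsets of $\mathbb B^d\times\mathbb B^s$, that parametrize the same $\mathrm{SG}$-Lagrangian $\widetilde\Lambda\subset\widetilde{\mathcal W}_{\mathrm{SG}}$ in a neighbourhood of $(y_0,\eta_0)\in\widetilde\Lambda$, such that (1) there exist $(y_0,\gamma_{0,1})\in\widetilde{\mathcal C}_{\varphi_1}$ and $(y_0,\gamma_{0,2})\in\widetilde{\mathcal C}_{\varphi_2}$ with $(y_0,\eta_0)=\tilde\lambda_{\varphi_i}(y_0,\gamma_{0,i})$, $i=1,2$, and $\tilde\varphi_1(y_0,\gamma_{0,1})=\tilde\varphi_2(y_0,\gamma_{0,2})$; (2) for each boundary or corner face $X$ of $\mathbb B^d\times\mathbb B^s$ containing the points, the symmetric matrices $\big(\tilde\gamma^{-1}\tilde y\,\widetilde{\partial^2_{\theta_j\theta_k}\varphi_1}|_X\big)_{j,k=1,\dots,s}$ at $(y_0,\gamma_{0,1})$ and $\big(\tilde\gamma^{-1}\tilde y\,\widetilde{\partial^2_{\theta_j\theta_k}\varphi_2}|_X\big)_{j,k=1,\dots,s}$ at $(y_0,\gamma_{0,2})$ have the same signature. Then there exists a local homeomorphism $\tilde\kappa$ of the boundary $\widetilde{\mathcal S}\to\widetilde{\mathcal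 S}$, from a neighbourhood of $(y_0,\gamma_{0,1})$ to a neighbourhood of $(y_0,\gamma_{0,2})$ in the corresponding faces, which is smooth on each face and such that $\tilde\varphi_2\circ\tilde\kappa=\tilde\varphi_1|_{\widetilde{\mathcal S}}$ near $(y_0,\gamma_{0,1})$.
   Context: **Balls and compactification.** $\mathbb B^d=\{y\in\mathbb R^d:|y|\le1\}$, $(\mathbb B^d)^o$ is its interior, $\mathbb S^{d-1}=\partial\mathbb B^d$. For each dimension fix a diffeomorphism $\iota:\mathbb R^d\to(\mathbb B^d)^o$ with $\iota(x)=\frac{x}{|x|}\big(1-\frac1{|x|}\big)$ for $|x|>3$, so $\iota^{-1}(y)=\frac{y}{|y|}(1-|y|)^{-1}$ for $2/3<|y|<1$, and a smooth $h:\mathbb B^d\to[0,\infty)$ with $h(y)=|y|$ for $2/3<|y|\le1$ and $1-h(y)\ne0$ for $|y|<2/3$. Put $\tilde y=1-h(y)$ for $y\in\mathbb B^d$ and $\tilde\gamma=1-h(\gamma)$ for $\gamma\in\mathbb B^s$. ''Smooth'' on manifolds with corners means smooth up to boundary and corner. **Faces.** $\widetilde{\mathcal S}=\widetilde{\mathcal B}=\partial(\mathbb B^d\times\mathbb B^s)$ is the disjoint union of $\widetilde{\mathcal S}^e=\widetilde{\mathcal B}^e=\mathbb S^{d-1}\times(\mathbb B^s)^o$, $\widetilde{\mathcal S}^\psi=\widetilde{\mathcal B}^\psi=(\mathbb B^d)^o\times\mathbb S^{s-1}$, and the corner $\widetilde{\mathcal S}^{\psi e}=\widetilde{\mathcal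 B}^{\psi e}=\mathbb S^{d-1}\times\mathbb S^{s-1}$. ''Smooth on each face'' means smooth, up to the corner, on the closed faces $\mathbb S^{d-1}\times\mathbb B^s$ and $\mathbb B^d\times\mathbb S^{s-1}$. $\widetilde{\mathcal W}_{\mathrm{SG}}=\partial(\mathbb B^d\times\mathbb B^d)=\widetilde{\mathcal W}^e_{\mathrm{SG}}\sqcup\widetilde{\mathcal W}^\psi_{\mathrm{SG}}\sqcup\widetilde{\mathcal W}^{\psi e}_{\mathrm{SG}}$ is decomposed the same way with $s$ replaced by $d$. **Local phase functions.** For $\tilde V\subset\mathbb B^d\times\mathbb B^s$ open, $\tilde y^{-1}\tilde\gamma^{-1}\mathscr C^\infty(\tilde V)$ is the set of (here real-valued) functions $\tilde\varphi$ on $\tilde V\cap((\mathbb B^d)^o\times(\mathbb B^s)^o)$ such that $\tilde y\tilde\gamma\tilde\varphi$ extends to a smooth function on $\tilde V$; $\varphi(x,\theta)=\tilde\varphi(\iota(x),\iota(\theta))$. For a derivative $D\varphi$ write $\widetilde{D\varphi}(y,\gamma)=(D\varphi)(\iota^{-1}(y),\iota^{-1}(\gamma))$. The functions $\tilde\gamma\widetilde{\nabla_x\varphi}$, $\tilde y\widetilde{\nabla_\theta\varphi}$ and $\tilde\gamma^{-1}\tilde y\,\widetilde{\partial^2_{\theta_j\theta_k}\varphi}$ extend smoothly to $\tilde V$. $\varphi$ is a phase function (on $\tilde V$) if $(\tilde\gamma\widetilde{\nabla_x\varphi},\tilde y\widetilde{\nabla_\theta\varphi})$ vanishes nowhere on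 $\tilde V\cap\widetilde{\mathcal B}$; then $\widetilde{\mathcal C}_\varphi=\{(y,\gamma)\in\widetilde{\mathcal B}\cap\tilde V:\tilde y\widetilde{\nabla_\theta\varphi}(y,\gamma)=0\}$. $\varphi$ is non-degenerate if, for each $X\in\{\widetilde{\mathcal B}^e,\widetilde{\mathcal B}^\psi,\widetilde{\mathcal B}^{\psi e}\}$ and each point of $\widetilde{\mathcal C}_\varphi\cap X$, the differentials $d(\tilde y\widetilde{\partial_{\theta_j}\varphi}|_X)$, $j=1,\dots,s$, are linearly independent in the cotangent space of $X$ at that point. **Values on the boundary.** The value of $\tilde\varphi$ at a point of $\widetilde{\mathcal S}$, and the restriction $\tilde\varphi|_{\widetilde{\mathcal S}}$, are understood as those of the principal symbol of $\varphi$: on $\widetilde{\mathcal S}^e$ it is the restriction of $\tilde y\tilde\varphi$, on $\widetilde{\mathcal S}^\psi$ the restriction of $\tilde\gamma\tilde\varphi$, on $\widetilde{\mathcal S}^{\psi e}$ the restriction of $\tilde y\tilde\gamma\tilde\varphi$ (in each case after smooth extension to that face). The identity $\tilde\varphi_2\circ\tilde\kappa=\tilde\varphi_1|_{\widetilde{\mathcal S}}$ is meant on each of the three faces. **The map $\tilde\lambda_\varphi$.** In the interior, $\tilde\lambda_\varphi(y,\gamma)=\big(y,\iota(\widetilde{\nabla_x\varphi}(y,\gamma))\big)\in\mathbb B^d\times\mathbb B^d$; it extends smoothly to a neighbourhood of $\widetilde{\mathcal C}_\varphi$ and $\tilde\lambda_\varphi$ denotes this extension. **Parametrization.** $\varphi_i$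 parametrizes $\widetilde\Lambda$ near $(y_0,\eta_0)=\tilde\lambda_{\varphi_i}(y_0,\gamma_{0,i})$ if there are an open neighbourhood $\tilde U$ of $(y_0,\eta_0)$ in $\mathbb B^d\times\mathbb B^d$ and an open neighbourhood $\tilde V_i$ of $(y_0,\gamma_{0,i})$ in $\mathbb B^d\times\mathbb B^s$ with $\widetilde\Lambda\cap\tilde U=\tilde\lambda_{\varphi_i}(\widetilde{\mathcal C}_{\varphi_i}\cap\tilde V_i)$. **$\mathrm{SG}$-Lagrangian.** On $\mathbb R^d_x\times\mathbb R^d_\xi$ let $\alpha^\psi=\sum_j\xi_jdx_j$, $\alpha^e=\sum_jx_jd\xi_j$. An $\mathrm{SG}$-Lagrangian submanifold of $\widetilde{\mathcal W}_{\mathrm{SG}}$ is a pair $\widetilde\Lambda=(\widetilde\Lambda^e,\widetilde\Lambda^\psi)$ (identified with the union) of closed embedded submanifolds (with boundary) of $\mathbb B^d\times\mathbb B^d$ of dimension $d-1$ such that: $(\widetilde\Lambda^e)^o\subset\widetilde{\mathcal W}^e_{\mathrm{SG}}\setminus(\mathbb S^{d-1}\times\{\iota(0)\})$, $(\widetilde\Lambda^\psi)^o\subset\widetilde{\mathcal W}^\psi_{\mathrm{SG}}$; $\widetilde\Lambda^e\cap\widetilde\Lambda^\psi=\partial\widetilde\Lambda^e=\partial\widetilde\Lambda^\psi=:\widetilde\Lambda^{\psi e}\subset\widetilde{\mathcal W}^{\psi e}_{\mathrm{SG}}$ has dimension $d-2$ and the intersection is clean ($T\widetilde\Lambda^e\cap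 T\widetilde\Lambda^\psi=T\widetilde\Lambda^{\psi e}$ there); on the conifications $\Lambda^e=\{(\mu y,\iota^{-1}(\eta)):(y,\eta)\in(\widetilde\Lambda^e)^o,\mu>0\}$, $\Lambda^\psi=\{(\iota^{-1}(y),\mu\eta):(y,\eta)\in(\widetilde\Lambda^\psi)^o,\mu>0\}$, $\Lambda^{\psi e}=\{(\mu y,\nu\eta):(y,\eta)\in\widetilde\Lambda^{\psi e},\mu,\nu>0\}$ one has $\alpha^e|_{\Lambda^e}=0$, $\alpha^\psi|_{\Lambda^\psi}=0$, $\alpha^e|_{\Lambda^{\psi e}}=\alpha^\psi|_{\Lambda^{\psi e}}=0$, and $\langle x,\xi\rangle=0$ on $\Lambda^{\psi e}$. Degenerate cases with $\widetilde\Lambda^{\psi e}=\emptyset$ (one component empty, or two disjoint components without boundary) are allowed. *)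

(* Defs.v *)
From HB Require Import structures.
From mathcomp Require Import all_boot all_order all_algebra.
From mathcomp Require Import all_classical all_reals all_analysis.
From mathcomp Require Import polyrcf.

Set Implicit Arguments.
Unset Strict Implicit.
Unset Printing Implicit Defensive.

Import Order.TTheory GRing.Theory Num.Theory.
Import numFieldNormedType.Exports.

Local Open Scope classical_set_scope.
Local Open Scope ring_scope.

Definition relopen (T : topologicalType) (A V : set T) : Prop :=
  exists2 O : set T, open O & V = O `&` A.

Section Smooth.
Context {R : realType}.

(* Directional derivatives are again functions U -> V, so the recursion stays
   in the same type; in finite dimension this is the usual class C^k. *)
Fixpoint Ck (U V : normedModType R) (k : nat) (O : set U) (f : U -> V) : Prop :=
  match k with
  | 0 => forall x, O x -> {for x, continuous f}
  | k'.+1 => (forall x, O x -> differentiable f x) /\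
             (forall v : U, Ck k' O (fun x => 'D_v f x))
  end.

(* Smoothness on an arbitrary subset (e.g. up to boundary and corner): every
   point has a neighbourhood on which f agrees with an ambient C^oo function. *)
Definition smooth_on (U V : normedModType R) (A : set U) (f : U -> V) : Prop :=
  forall p, A p -> exists (O : set U) (g : U -> V),
    [/\ open O, O p, (forall k, Ck k O g) &
        forall q, A q -> O q -> g q = f q].

Definition inverse_on (U V : Type) (A : set U) (B : set V)
    (f : U -> V) (g : V -> U) : Prop :=
  [/\ (forall x, A x -> B (f x)), (forall y, B y -> A (g y)),
      (forall x, A x -> g (f x) = x) & (forall y, B y -> f (g y) = y)].

Definition diffeo_on (U V : normedModType R) (A : set U) (B : set V)
    (f : U -> V) (g : V -> U) : Prop :=
  [/\ inverse_on A B f g, smooth_on A f & smooth_on B g].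

Definition homeo_on (U V : topologicalType) (A : set U) (B : set V)
    (f : U -> V) (g : V -> U) : Prop :=
  [/\ inverse_on A B f g, {within A, continuous f} & {within B, continuous g}].

(* The model R_{>=0} x R^(k-1); for k = 0 it is a point without boundary. *)
Definition halfspace (k : nat) : set 'rV[R]_k :=
  [set u | forall i : 'I_k, val i = 0%N -> 0 <= u 0 i].

Definition hyperplane (k : nat) : set 'rV[R]_k :=
  [set u | exists2 i : 'I_k, val i = 0%N & u 0 i = 0].

(* u is the coordinate of p in some chart of M at p. *)
Definition chart_at (E : normedModType R) (k : nat) (M : set E) (p : E)
    (u : 'rV[R]_k) : Prop :=
  exists (O : set E) (W : set 'rV[R]_k) (f : 'rV[R]_k -> E) (g : E -> 'rV[R]_k),
    [/\ open O /\ O p, relopen (@halfspace k) W /\ W u, f u = p &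
        diffeo_on W (M `&` O) f g].

Definition submanifold (E : normedModType R) (k : nat) (M : set E) : Prop :=
  forall p, M p -> exists u : 'rV[R]_k, chart_at M p u.

Definition mboundary (E : normedModType R) (k : nat) (M : set E) : set E :=
  [set p | M p /\ exists2 u : 'rV[R]_k, chart_at M p u & hyperplane u].

(* One-sided velocities up to sign: at a boundary point of a manifold with
   boundary these fill the whole tangent space, not only a half-space. *)
Definition tangent (E : normedModType R) (M : set E) (p : E) : set E :=
  [set v | exists (e : R) (c : R -> E),
    [/\ 0 < e, smooth_on [set t | - e < t < e] c, c 0 = p,
        (forall t, 0 <= t < e -> M (c t)) &
        'D_1 c 0 = v \/ 'D_1 c 0 = - v]].

(* For X without boundary: no nontrivial combination of the differentials
   d(f_j|_X) at p vanishes, d(f|_X) being evaluated on velocities of curves. *)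
Definition indep_differentials (E : normedModType R) (n : nat) (X : set E)
    (f : E -> 'rV[R]_n) (p : E) : Prop :=
  forall a : 'rV[R]_n,
    (forall (e : R) (c : R -> E), 0 < e ->
       smooth_on [set t | - e < t < e] c -> c 0 = p ->
       (forall t, - e < t < e -> X (c t)) ->
       \sum_(j < n) a 0 j * 'D_1 (fun t => f (c t) 0 j) 0 = 0) ->
    a = 0.

(* Number of positive minus number of negative eigenvalues, with multiplicity. *)
Definition signature (n : nat) (A : 'M[R]_n) : int :=
  \sum_(a <- rootsR (char_poly A)) sgz a * (mup a (char_poly A))%:Z.

Definition dot (n : nat) (u v : 'rV[R]_n) : R := \sum_(i < n) u 0 i * v 0 i.

(* `|x| on 'rV[R]_n is the sup norm, whence this Euclidean one. *)
Definition enorm (n : nat) (x : 'rV[R]_n) : R := Num.sqrt (dot x x).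

Definition cball (n : nat) : set 'rV[R]_n := [set y | enorm y <= 1].
Definition oball (n : nat) : set 'rV[R]_n := [set y | enorm y < 1].
Definition sphere (n : nat) : set 'rV[R]_n := [set y | enorm y = 1].

End Smooth.

Arguments cball {R} n.
Arguments oball {R} n.
Arguments sphere {R} n.

Record compactification (R : realType) (n : nat) := Compactification {
  iota : 'rV[R]_n -> 'rV[R]_n;
  iota_inv : 'rV[R]_n -> 'rV[R]_n;
  hfun : 'rV[R]_n -> R;
  iota_diffeo : diffeo_on setT (oball n) iota iota_inv;
  iota_far : forall x, 3%:R < enorm x ->
    iota x = (1 - (enorm x)^-1) *: ((enorm x)^-1 *: x);
  hfun_smooth : smooth_on (cball n) hfun;
  hfun_ge0 : forall y, cball n y -> 0 <= hfun y;
  hfun_far : forall y, 2%:R / 3%:R < enorm y <= 1 -> hfun y = enorm y;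
  hfun_near : forall y, enorm y < 2%:R / 3%:R -> 1 - hfun y != 0
}.

(* The boundary defining function \tilde y (resp. \tilde\gamma). *)
Definition bdf (R : realType) (n : nat) (K : compactification R n)
  (y : 'rV[R]_n) : R := 1 - hfun K y.

Inductive face := Fe | Fpsi | Fpsie.

Section Faces.
Context {R : realType} (d m : nat).

Definition BB : set ('rV[R]_d * 'rV[R]_m) := cball d `*` cball m.
Definition BBo : set ('rV[R]_d * 'rV[R]_m) := oball d `*` oball m.

Definition face_set (X : face) : set ('rV[R]_d * 'rV[R]_m) :=
  match X with
  | Fe => sphere d `*` oball m
  | Fpsi => oball d `*` sphere m
  | Fpsie => sphere d `*` sphere m
  end.

Definition closed_face_e : set ('rV[R]_d * 'rV[R]_m) := sphere d `*` cball m.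
Definition closed_face_psi : set ('rV[R]_d * 'rV[R]_m) := cball d `*` sphere m.

Definition BBboundary : set ('rV[R]_d * 'rV[R]_m) :=
  [set p | exists X, face_set X p].

End Faces.

Arguments BB {R} d m.
Arguments BBo {R} d m.
Arguments face_set {R} d m X.
Arguments closed_face_e {R} d m.
Arguments closed_face_psi {R} d m.
Arguments BBboundary {R} d m.

Section Phase.
Context {R : realType} (d s : nat).
Variable K : forall n, compactification R n.
Implicit Types (V : set ('rV[R]_d * 'rV[R]_s)) (phi : 'rV[R]_d * 'rV[R]_s -> R).

(* The extension by continuity, from the interior, of a function given there;
   it is the value of the smooth extension whenever one exists. *)
Definition ext (W : ptopologicalType) (g : 'rV[R]_d * 'rV[R]_s -> W)
    (p : 'rV[R]_d * 'rV[R]_s) : W :=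
  lim (g q @[q --> within (BBo d s) (nbhs p)]).

Definition tl (T : Type) (f : 'rV[R]_d * 'rV[R]_s -> T)
    (p : 'rV[R]_d * 'rV[R]_s) : T :=
  f (iota_inv (K d) p.1, iota_inv (K s) p.2).

Definition ty (p : 'rV[R]_d * 'rV[R]_s) : R := bdf (K d) p.1.
Definition tg (p : 'rV[R]_d * 'rV[R]_s) : R := bdf (K s) p.2.

Definition grad_x phi (q : 'rV[R]_d * 'rV[R]_s) : 'rV[R]_d :=
  \row_(j < d) 'D_(delta_mx 0 j, 0) phi q.

Definition dtheta (j : 'I_s) phi (q : 'rV[R]_d * 'rV[R]_s) : R :=
  'D_(0, delta_mx 0 j) phi q.

Definition grad_theta phi (q : 'rV[R]_d * 'rV[R]_s) : 'rV[R]_s :=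
  \row_(j < s) dtheta j phi q.

Definition hess_theta phi (q : 'rV[R]_d * 'rV[R]_s) : 'M[R]_s :=
  \matrix_(j < s, k < s) dtheta j (dtheta k phi) q.

(* For phi as in classical11 these functions do extend smoothly to V, so that
   the limits below exist there. *)
Definition gx phi : 'rV[R]_d * 'rV[R]_s -> 'rV[R]_d :=
  ext (fun p => tg p *: tl (grad_x phi) p).
Definition gth phi : 'rV[R]_d * 'rV[R]_s -> 'rV[R]_s :=
  ext (fun p => ty p *: tl (grad_theta phi) p).
Definition hth phi : 'rV[R]_d * 'rV[R]_s -> 'M[R]_s :=
  ext (fun p => ((tg p)^-1 * ty p) *: tl (hess_theta phi) p).

(* Only the values of phi at points q with (iota q.1, iota q.2) in V matter. *)
Definition classical11 V phi : Prop :=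
  relopen (BB d s) V /\
  exists2 f : 'rV[R]_d * 'rV[R]_s -> R, smooth_on V f &
    forall p, V p -> BBo d s p -> f p = ty p * tg p * tl phi p.

Definition phase_function V phi : Prop :=
  classical11 V phi /\
  forall p, V p -> BBboundary d s p -> (gx phi p, gth phi p) <> (0, 0).

Definition critical V phi : set ('rV[R]_d * 'rV[R]_s) :=
  [set p | [/\ BBboundary d s p, V p & gth phi p = 0]].

Definition nondegenerate_phase V phi : Prop :=
  forall X p, critical V phi p -> face_set d s X p ->
    indep_differentials (face_set d s X) (gth phi) p.

(* Used on BBboundary only, where the last branch is the corner. *)
Definition bvalue phi (p : 'rV[R]_d * 'rV[R]_s) : R :=
  if `[< face_set d s Fe p >] then ext (fun q => ty q * tl phi q) p
  else if `[< face_set d s Fpsi p >] then ext (fun q => tg q * tl phi q) p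
  else ext (fun q => ty q * tg q * tl phi q) p.

Definition lambda phi (p : 'rV[R]_d * 'rV[R]_s) : 'rV[R]_d * 'rV[R]_d :=
  (p.1, ext (fun q => iota (K d) (tl (grad_x phi) q)) p).

Definition parametrizes V phi (L : set ('rV[R]_d * 'rV[R]_d))
    (q : 'rV[R]_d * 'rV[R]_d) (p : 'rV[R]_d * 'rV[R]_s) : Prop :=
  q = lambda phi p /\
  exists (U : set ('rV[R]_d * 'rV[R]_d)) (W : set ('rV[R]_d * 'rV[R]_s)),
    [/\ relopen (BB d d) U /\ U q, relopen (BB d s) W /\ W p &
        L `&` U = lambda phi @` (critical V phi `&` W)].

End Phase.

Section Lagrangian.
Context {R : realType} (d : nat).
Variable K : forall n, compactification R n.
Local Notation T := ('rV[R]_d * 'rV[R]_d)%type.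

Definition cone_e (A : set T) : set T :=
  [set z | exists (y eta : 'rV[R]_d) (mu : R),
    [/\ A (y, eta), 0 < mu & z = (mu *: y, iota_inv (K d) eta)]].
Definition cone_psi (A : set T) : set T :=
  [set z | exists (y eta : 'rV[R]_d) (mu : R),
    [/\ A (y, eta), 0 < mu & z = (iota_inv (K d) y, mu *: eta)]].
Definition cone_psie (A : set T) : set T :=
  [set z | exists (y eta : 'rV[R]_d) (mu nu : R),
    [/\ A (y, eta), 0 < mu, 0 < nu & z = (mu *: y, nu *: eta)]].

Definition alpha_e_vanishes (M : set T) : Prop :=
  forall z v, M z -> tangent M z v -> dot z.1 v.2 = 0.
Definition alpha_psi_vanishes (M : set T) : Prop :=
  forall z v, M z -> tangent M z v -> dot z.2 v.1 = 0.

Record SG_Lagrangian (Le Lpsi : set T) : Prop := {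
  Le_closed : closed Le;
  Lpsi_closed : closed Lpsi;
  Le_sub : Le `<=` BB d d;
  Lpsi_sub : Lpsi `<=` BB d d;
  Le_submanifold : submanifold d.-1 Le;
  Lpsi_submanifold : submanifold d.-1 Lpsi;
  Le_interior : Le `\` mboundary d.-1 Le `<=`
    face_set d d Fe `\` (sphere d `*` [set iota (K d) 0]);
  Lpsi_interior : Lpsi `\` mboundary d.-1 Lpsi `<=` face_set d d Fpsi;
  corner_e : Le `&` Lpsi = mboundary d.-1 Le;
  corner_psi : Le `&` Lpsi = mboundary d.-1 Lpsi;
  corner_sub : Le `&` Lpsi `<=` face_set d d Fpsie;
  (* for d = 1 the corner is empty, so truncation of d - 2 is harmless *)
  corner_submanifold : submanifold d.-2 (Le `&` Lpsi);
  corner_closed : mboundary d.-2 (Le `&` Lpsi) = set0;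
  corner_clean : forall p, (Le `&` Lpsi) p ->
    tangent Le p `&` tangent Lpsi p = tangent (Le `&` Lpsi) p;
  lagr_e : alpha_e_vanishes (cone_e (Le `\` mboundary d.-1 Le));
  lagr_psi : alpha_psi_vanishes (cone_psi (Lpsi `\` mboundary d.-1 Lpsi));
  lagr_psie_e : alpha_e_vanishes (cone_psie (Le `&` Lpsi));
  lagr_psie_psi : alpha_psi_vanishes (cone_psie (Le `&` Lpsi));
  lagr_dot : forall z, cone_psie (Le `&` Lpsi) z -> dot z.1 z.2 = 0
}.

End Lagrangian.

(* Main.v *)
(* On the face (B^d)^o x S^(s-1) the x-gradient [xi] of the boundary value does not vanish. At
   the corner, Euler's relation in theta makes the phase vanish, so [<xi, y>] = 0 and [xi] is
   tangential to the sphere. In both cases the boundary value is a submersion along directions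
   preserving the faces, and adding a multiple of a fixed direction straightens both phases to
   the same linear form.

   On S^(d-1) x (B^s)^o, an affine chart of the sphere turns the phases into functions f_i(x, theta)
   whose critical 1-jets (x, f_i, d_x f_i) parametrize the same Legendrian submanifold. If
   d_x f_i <> 0 at the base point, the submersion argument applies again. Otherwise adjoin to theta
   the x-directions b spanning the image of the kernel of the theta-Hessian under the mixed
   Hessian: this image is read off the tangent space of the Legendrian, hence is the same for
   both phases. The Hessians in (b, theta) are nondegenerate, and equality of the signatures of
   the theta-Hessians makes them congruent. By the Morse lemma with parameters, f_1 and f_2 are
   equivalent up to their critical values, which depend on the remaining x-directions w only.
   At these critical points d_x f_i vanishes along b, and (w, the b-components of d_x f_i)
   are immersive coordinates on the Legendrian; so both critical points have the same 1-jet and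
   the critical values agree. *)
Require Import Defs.
From HB Require Import structures.
From mathcomp Require Import all_boot all_order all_algebra all_fingroup.
From mathcomp Require Import polyrcf spectral complex.
From mathcomp Require Import all_classical all_reals all_analysis.
From mathcomp Require Import ring lra zify.
Set Implicit Arguments.
Unset Strict Implicit.
Unset Printing Implicit Defensive.
Import Order.TTheory GRing.Theory Num.Theory.
Import numFieldNormedType.Exports.
Local Open Scope classical_set_scope.
Local Open Scope ring_scope.

(** * Germs of smooth maps *)

(** All cases exploit this freedom: where the boundary value is a submersion in [x], points are
    moved along one x-direction, and where it is not, some x-directions are treated as fibre
    variables. The obstacle on S^(d-1) x (B^s)^o is a degenerate theta-Hessian. Only its signature
    is prescribed, so even equality of the ranks has to be extracted from the common tangent space.
    The enlarged Hessians are invertible, but their lower right blocks are still the degenerate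
    theta-Hessians; a congruence of these blocks must be extended to the whole matrix. In each case
    [kappa] is the restriction to the boundary of a single smooth germ on the ambient vector space
    that respects the faces near the base point, so smoothness up to the corner and continuity
    across it come at once. At the corner this is arranged by keeping both |y| and |gamma| fixed,
    which also leaves the two boundary defining functions unchanged: one identity then gives the
    equality of symbols on the three adjacent faces. *)

Section DiffEps.
Context {R : realType} {V W : normedModType R}.
Implicit Types f g : V -> W.

Lemma near_addr (x : V) (P : set V) : (\forall y \near x, P y) ->
  \forall h \near (0 : V), P (h + x).
Proof.
have H : h + x @[h --> (0 : V)] --> 0 + x by apply: cvgD; [exact: cvg_id|exact: cvg_cst].
by rewrite add0r in H; apply: H.
Qed.

Lemma diff_epsP f (x : V) (L : {linear V -> W}) : continuous L ->
  (forall e, 0 < e -> \forall h \near (0 : V), `|f (h + x) - f x - L h| <= e * `|h|) ->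
  differentiable f x /\ 'd f x = L :> (V -> W).
Proof.
move=> Lc H.
have H2 : f \o shift x = cst (f x) + L +o_ 0 id.
  apply/eqaddoP => e e0; have := H e e0; apply: filterS => h /=.
  by rewrite !fctE opprD addrA.
have dE : 'd f x = L :> (V -> W) by exact: diff_unique.
split=> //; apply/diff_locallyP; split; first by rewrite dE.
by rewrite dE.
Qed.

Lemma diff_eps f (x : V) : differentiable f x ->
  forall e, 0 < e -> \forall h \near (0 : V), `|f (h + x) - f x - 'd f x h| <= e * `|h|.
Proof.
move=> /diff_locallyP[_ /eqaddoP H] e e0.
by have := H _ e0; apply: filterS => h /=; rewrite !fctE opprD addrA.
Qed.

Lemma near_eq_differentiable f g (x : V) : (\forall y \near x, f y = g y) ->
  differentiable f x -> differentiable g x.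
Proof.
move=> fg df.
have fgx : f x = g x := nbhs_singleton fg.
apply: (proj1 (@diff_epsP g x ('d f x) _ _)); first exact: diff_continuous.
move=> e e0; have := diff_eps df e0; have := near_addr fg.
by apply: filterS2 => h; rewrite fgx => ->.
Qed.
End DiffEps.

Section CkTheory.
Context {R : realType}.
Implicit Types U V W : normedModType R.

Lemma Ck_differentiable U V k (O : set U) (f : U -> V) x :
  Ck k.+1 O f -> O x -> differentiable f x.
Proof. by move=> [+ _]; exact. Qed.

Lemma Ck_derive U V k (O : set U) (f : U -> V) v : Ck k.+1 O f -> Ck k O ('D_v f).
Proof. by move=> [_]; apply. Qed.

Lemma eq_Ck U V k (O : set U) (f g : U -> V) : open O ->
  (forall x, O x -> f x = g x) -> Ck k O f -> Ck k O g.
Proof.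
move=> oO; elim: k f g => [|k IH] f g fg /=.
  move=> fc x Ox; rewrite /prop_for /continuous_at -(fg _ Ox).
  apply: cvg_trans (fc x Ox); apply: near_eq_cvg.
  by move/open_nbhs_nbhs: (conj oO Ox); apply: filterS => y /fg.
move=> [fd fk]; split.
  move=> x Ox; apply: near_eq_differentiable (fd x Ox).
  by move/open_nbhs_nbhs: (conj oO Ox); apply: filterS => y /fg.
move=> v; apply: IH (fk v) => x Ox; apply: near_eq_derive.
by move/open_nbhs_nbhs: (conj oO Ox); apply: filterS => y /fg.
Qed.

Lemma CkW U V k (O : set U) (f : U -> V) : Ck k.+1 O f -> Ck k O f.
Proof.
elim: k f => [|k IH] f /= [fd fk].
  by move=> x Ox; apply: differentiable_continuous; exact: fd.
by split=> // v; exact: IH (fk v).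
Qed.

Lemma Ck_sub U V k (O O' : set U) (f : U -> V) : O' `<=` O -> Ck k O f -> Ck k O' f.
Proof.
move=> OO; elim: k f => [|k IH] f /=; first by move=> h x /OO; exact: h.
by move=> [h1 h2]; split=> [x /OO|v]; [exact: h1|exact: IH].
Qed.

Lemma Ck_cst U V k (O : set U) (c : V) : Ck k O (fun=> c).
Proof.
elim: k c => [|k IH] c /=; first by move=> x _; exact: cvg_cst.
split=> [x _|v]; first exact: differentiable_cst.
have -> : 'D_v (fun=> c) = (fun=> 0) :> (U -> V) by apply/funext => x; rewrite derive_cst.
exact: IH.
Qed.

Lemma Ck_linear U V k (O : set U) (f : {linear U -> V}) : continuous f -> Ck k O f.
Proof.
move=> fc; case: k => [|k] /=; first by move=> x _; exact: fc.
split=> [x _|v]; first exact: linear_differentiable.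
have -> : 'D_v f = (fun=> f v) :> (U -> V).
  by apply/funext => x; rewrite deriveE ?diff_lin//; exact: linear_differentiable.
exact: Ck_cst.
Qed.

Lemma CkD U V k (O : set U) (f g : U -> V) : open O ->
  Ck k O f -> Ck k O g -> Ck k O (fun x => f x + g x).
Proof.
move=> oO; elim: k f g => [|k IH] f g /=.
  by move=> fc gc x Ox; apply: cvgD; [exact: fc|exact: gc].
move=> [fd fk] [gd gk]; split.
  by move=> x Ox; apply: differentiableD; [exact: fd|exact: gd].
move=> v; apply: eq_Ck (IH _ _ (fk v) (gk v)) => // x Ox.
by rewrite -deriveD//; apply: diff_derivable; [exact: fd|exact: gd].
Qed.

Lemma Ck_sum U V k (O : set U) I (r : seq I) (P : pred I) (f : I -> U -> V) : open O ->
  (forall i, Ck k O (f i)) -> Ck k O (fun x => \sum_(i <- r | P i) f i x).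
Proof.
move=> oO fk; elim: r => [|i r IH].
  by apply: eq_Ck (Ck_cst _ _ 0) => // x _; rewrite big_nil.
case: (boolP (P i)) => Pi.
  by apply: eq_Ck (CkD oO (fk i) IH) => // x _; rewrite big_cons Pi.
by apply: eq_Ck IH => // x _; rewrite big_cons (negbTE Pi).
Qed.


Lemma is_diff_scalef U V (a : U -> R) (f : U -> V) x :
  differentiable a x -> differentiable f x ->
  differentiable (fun y => a y *: f y) x /\
  forall v, 'D_v (fun y => a y *: f y) x = 'D_v a x *: f x + a x *: 'D_v f x.
Proof.
move=> da df.
have Bl : bilinear_for
    (GRing.Scale.Law.clone _ _ *:%R _) (GRing.Scale.Law.clone _ _ *:%R _)
    (fun (r : R) (w : V) => r *: w).
  by split=> [u'|u] b y z /=; rewrite ?scalerDl ?scalerDr ?scalerA// mulrC.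
pose BM := bilinear_isBilinear.Build R R V V _ _ (fun (r : R) (w : V) => r *: w) Bl.
pose B : {bilinear R -> V -> V} := HB.pack (fun (r : R) (w : V) => r *: w) BM.
have Bc : continuous (fun p : R * V => B p.1 p.2) by move=> p; exact: scale_continuous.
have db : differentiable (fun y => (a y, f y)) x by exact: differentiable_pair.
have E : (fun y => a y *: f y) = (fun p : R * V => B p.1 p.2) \o (fun y => (a y, f y)) by [].
have dc : differentiable (fun y => a y *: f y) x.
  by rewrite E; apply: differentiable_comp => //; exact: differentiable_bilin.
split=> // v; rewrite deriveE// E diff_comp//; last exact: differentiable_bilin.
have E2 := diff_bilin (a x, f x) Bc.
have E3 := diff_pair da df.
by rewrite /= E2 E3 /= !deriveE// addrC.
Qed.

Lemma Ck_scalef U V k (O : set U) (a : U -> R) (f : U -> V) : open O ->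
  Ck k O a -> Ck k O f -> Ck k O (fun x => a x *: f x).
Proof.
move=> oO; elim: k a f => [|k IH] a f.
  by move=> /= ac fc x Ox; apply: cvgZ; [exact: ac|exact: fc].
move=> Ha Hf; have [ad ak] := Ha; have [fd fk] := Hf; split.
  by move=> x Ox; apply: (is_diff_scalef (ad x Ox) (fd x Ox)).1.
move=> v; apply: eq_Ck (CkD oO (IH _ _ (ak v) (CkW Hf)) (IH _ _ (CkW Ha) (fk v))) => //.
by move=> x Ox; rewrite (is_diff_scalef (ad x Ox) (fd x Ox)).2.
Qed.

Lemma CkM U k (O : set U) (a b : U -> R) : open O ->
  Ck k O a -> Ck k O b -> Ck k O (fun x => a x * b x).
Proof. exact: (@Ck_scalef U R^o). Qed.

Lemma Ck_linear_comp U V W k (O : set U) (f : U -> V) (L : {linear V -> W}) :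
  open O -> continuous L -> Ck k O f -> Ck k O (fun x => L (f x)).
Proof.
move=> oO Lc; elim: k f => [|k IH] f /=.
  by move=> fc x Ox; apply: (@continuous_comp _ _ _ f L x); [exact: fc|exact: Lc].
move=> [fd fk]; split.
  move=> x Ox; apply: (@differentiable_comp _ _ _ _ f L); first exact: fd.
  exact: linear_differentiable.
move=> v; apply: eq_Ck (IH _ (fk v)) => // x Ox.
have dL : differentiable L (f x) by exact: linear_differentiable.
have dLf : differentiable (fun x => L (f x)) x.
  by apply: (@differentiable_comp _ _ _ _ f L); [exact: fd|].
have E := @diff_comp _ _ _ _ f L x (fd _ Ox) dL.
have E2 := @deriveE _ _ _ _ x v dLf; have E3 := deriveE v (fd _ Ox).
by rewrite E2 E3 (_ : 'd (fun x => L (f x)) x = 'd (L \o f) x)// E /= diff_lin.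
Qed.

End CkTheory.

(* Chain rules are proved by expanding directions on such a finite frame. *)
Class findim {R : realType} (V : normedModType R) : Prop := FinDim {
  _ : exists n (e : 'I_n -> V) (c : 'I_n -> {linear V -> R}),
    (forall i, continuous (c i)) /\ (forall v, v = \sum_i c i v *: e i) }.

Section FinDim.
Context {R : realType}.
Implicit Types U V W : normedModType R.

Lemma findim_frame V : findim V ->
  exists n (e : 'I_n -> V) (c : 'I_n -> {linear V -> R}),
    (forall i, continuous (c i)) /\ (forall v, v = \sum_i c i v *: e i).
Proof. by case. Qed.

Lemma linear_coordmx m n (i : 'I_m) (j : 'I_n) : linear (fun M : 'M[R]_(m, n) => M i j : R^o).
Proof. by move=> a u v; rewrite !mxE. Qed.

Definition coordmx m n (i : 'I_m) (j : 'I_n) : {linear 'M[R]_(m, n) -> R} :=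
  HB.pack (fun M : 'M[R]_(m, n) => M i j : R^o)
    (GRing.isLinear.Build _ _ _ _ _ (linear_coordmx i j)).

Global Instance findim_R : findim (R : normedModType R).
Proof.
constructor; exists 1%N, (fun=> 1), (fun=> idfun); split; first by move=> i x; apply: cvg_id.
by move=> v; rewrite big_ord1 /= /GRing.scale /= mulr1.
Qed.

Global Instance findim_mx m n : findim ('M[R]_(m, n)).
Proof.
constructor.
exists #|{: 'I_m * 'I_n}|, (fun k => delta_mx (enum_val k).1 (enum_val k).2),
  (fun k => coordmx (enum_val k).1 (enum_val k).2).
split; first by move=> k; exact: coord_continuous.
move=> v; rewrite [LHS]matrix_sum_delta pair_bigA /=.
rewrite (reindex (@enum_val _ {: 'I_m * 'I_n}))//=.
by apply: onW_bij; exact: enum_val_bij.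
Qed.

Lemma fst_continuous V W : continuous (@fst V W).
Proof. by move=> p; apply: cvg_fst. Qed.

Lemma snd_continuous V W : continuous (@snd V W).
Proof. by move=> p; apply: cvg_snd. Qed.

Global Instance findim_prod V W : findim V -> findim W -> findim (V * W)%type.
Proof.
move=> /findim_frame[n [e [c [cc ce]]]] /findim_frame[m [f [d [dc de]]]].
constructor.
exists (n + m)%N, (fun k : 'I_(n + m) => match fintype.split k with inl i => (e i, 0) | inr j => (0, f j) end),
  (fun k : 'I_(n + m) => match fintype.split k with inl i => (c i \o fst : {linear (V * W)%type -> R})
       | inr j => (d j \o snd : {linear (V * W)%type -> R}) end).
split.
  move=> k; case: (fintype.split k) => i x /=.
    by apply: (@continuous_comp _ _ _ fst (c i)); [exact: fst_continuous|exact: cc].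
  by apply: (@continuous_comp _ _ _ snd (d i)); [exact: snd_continuous|exact: dc].
move=> [v w]; rewrite big_split_ord /=.
under eq_bigr => i _.
  have -> : fintype.split (lshift m i) = inl i := unsplitK (inl i).
  over.
under [X in _ + X]eq_bigr => i _.
  have -> : fintype.split (rshift n i) = inr i := unsplitK (inr i).
  over.
rewrite /= [in LHS](ce v) [in LHS](de w).
have fs I (s : seq I) (F : I -> V * W) :
    \sum_(i <- s) F i = (\sum_(i <- s) (F i).1, \sum_(i <- s) (F i).2).
  elim: s => [|a s IH]; first by rewrite !big_nil.
  by rewrite !big_cons IH.
rewrite !fs /=; congr (_, _).
  by rewrite [X in _ + X]big1 ?addr0// => i _; rewrite scaler0.
by rewrite [X in X + _]big1 ?add0r// => i _; rewrite scaler0.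
Qed.

(** The direction ['D_v f x] in which [g] is differentiated varies with [x], whereas [Ck] iterates
    derivatives in fixed directions. Expanding it on a frame gives a sum of products to which the
    induction hypothesis applies. *)
Lemma Ck_comp U V W k (O : set U) (O' : set V) (f : U -> V) (g : V -> W) :
  findim V -> open O -> open O' -> (forall x, O x -> O' (f x)) ->
  Ck k O f -> Ck k O' g -> Ck k O (fun x => g (f x)).
Proof.
move=> /findim_frame[n [e [c [cc ce]]]] oO oO' fO.
elim: k g f fO => [|k IH] g f fO.
  move=> /= fc gc x Ox; apply: (@continuous_comp _ _ _ f g x); first exact: fc.
  exact/gc/fO.
move=> Hf Hg; have [fd fk] := Hf; have [gd gk] := Hg; split.
  move=> x Ox; apply: (@differentiable_comp _ _ _ _ f g); first exact: fd.
  exact/gd/fO.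
move=> v.
apply: (@eq_Ck _ _ _ _ _ (fun x => \sum_i c i ('D_v f x) *: 'D_(e i) g (f x))) => //.
  move=> x Ox; rewrite [in RHS]deriveE; last first.
    by apply: (@differentiable_comp _ _ _ _ f g); [exact: fd|exact/gd/fO].
  have := @diff_comp _ _ _ _ f g x (fd _ Ox) (gd _ (fO _ Ox)).
  rewrite (_ : 'd (fun x => g (f x)) x = 'd (g \o f) x)// => ->.
  rewrite /= -(deriveE _ (fd _ Ox)) [in RHS](ce ('D_v f x)) linear_sum.
  by apply: eq_bigr => i _; rewrite [in RHS]linearZ (deriveE _ (gd _ (fO _ Ox))).
apply: Ck_sum => // i; apply: Ck_scalef => //.
  exact: (Ck_linear_comp oO (cc i) (fk v)).
exact: (IH _ f fO (CkW Hf) (gk (e i))).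
Qed.

End FinDim.

Section CkMore.
Context {R : realType}.
Implicit Types U V W : normedModType R.

Lemma Ck_inv k : Ck k [set x : R | x != 0] (fun x : R => x^-1).
Proof.
have oO : open [set x : R | x != 0].
  rewrite (_ : [set _ | _] = ~` [set (0 : R)]); first exact/closed_openC/closed_eq.
  by apply/seteqP; split=> x /=; move/eqP.
elim: k => [|k IH]; first by move=> x /= x0; exact: inv_continuous.
split=> [x x0|v]; first exact: differentiable_Rinv.
apply: (@eq_Ck _ R R k [set x : R | x != 0] (fun x : R => - v * (x^-1 * x^-1))) => //.
  move=> x /= x0; rewrite deriveE; last exact: differentiable_Rinv.
  have E := diff_Rinv x0.
  by rewrite E -[RHS]/(- x^-2 * v) -invfM -expr2 !mulNr mulrC.
by apply: CkM => //; [exact: Ck_cst|exact: CkM].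
Qed.

Lemma Ck_sqrt k : Ck k [set x : R | 0 < x] (@Num.sqrt R).
Proof.
have oO : open [set x : R | 0 < x] by exact: open_gt.
have sd (x : R) : 0 < x -> differentiable Num.sqrt x /\ 'd Num.sqrt x 1 = (2 * Num.sqrt x)^-1.
  move=> x0; have [d e] := is_derive1_sqrt x0.
  have d' : differentiable Num.sqrt x by exact/derivable1_diffP.
  by split=> //; rewrite -deriveE.
elim: k => [|k IH]; first by move=> x /= x0; exact: sqrt_continuous.
split=> [x x0|v]; first by case: (sd _ x0).
(* The derivative 1 / (2 sqrt x) is written as sqrt x / (2 x), so that the induction closes on the
   square root itself. *)
apply: (@eq_Ck _ R R k [set x : R | 0 < x] (fun x : R => v * (2^-1 * (Num.sqrt x * x^-1)))) => //.
  move=> x /= x0; have [d e] := sd _ x0; rewrite deriveE//.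
  have -> : 'd Num.sqrt x v = v * 'd Num.sqrt x 1.
    by rewrite -[v in LHS]mulr1 -[v * 1]/(v *: (1 : R)) linearZ.
  rewrite e invfM; congr (_ * (_ * _)).
  rewrite -{2}(@sqr_sqrtr _ x) ?ltW// expr2 invfM mulrA mulfV ?mul1r//.
  by rewrite gt_eqF// sqrtr_gt0.
apply: CkM => //; first exact: Ck_cst.
apply: CkM => //; first exact: Ck_cst.
apply: CkM => //; apply: Ck_sub (Ck_inv k) => x /= x0.
by rewrite gt_eqF.
Qed.

End CkMore.

(* Smoothness near a point, the germ version of the class [Ck k O] for all k. *)
Definition smooth_at {R : realType} {U V : normedModType R} (p : U) (f : U -> V) :=
  exists O : set U, [/\ open O, O p & forall k, Ck k O f].

Section SmoothAt.
Context {R : realType}.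
Implicit Types U V W : normedModType R.

Lemma smooth_at_near U V (p : U) (f : U -> V) : smooth_at p f -> \forall q \near p, smooth_at q f.
Proof.
move=> [D [oD Dp Df]]; move/open_nbhs_nbhs: (conj oD Dp).
by apply: filterS => q Dq; exists D.
Qed.

Lemma eq_smooth_at U V (p : U) (f g : U -> V) : (\forall q \near p, f q = g q) ->
  smooth_at p f -> smooth_at p g.
Proof.
rewrite -nbhs_nearE nbhsE => -[D' [oD' D'p] fg] [D [oD Dp Df]].
exists (D `&` D'); split=> [||k]; [exact: openI|by []|].
apply: (@eq_Ck _ _ _ _ _ f); [exact: openI|by move=> x [_ /fg]|].
by apply: Ck_sub (Df k) => x [].
Qed.

Lemma smooth_at_differentiable U V (p : U) (f : U -> V) : smooth_at p f -> differentiable f p.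
Proof. by move=> [D [oD Dp Df]]; exact: (Ck_differentiable (Df 1%N)). Qed.

Lemma smooth_at_continuous U V (p : U) (f : U -> V) : smooth_at p f -> {for p, continuous f}.
Proof. by move/smooth_at_differentiable/differentiable_continuous. Qed.

Lemma smooth_at_derive U V (p : U) (f : U -> V) v : smooth_at p f -> smooth_at p ('D_v f).
Proof. by move=> [D [oD Dp Df]]; exists D; split=> // k; exact: Ck_derive (Df k.+1). Qed.

Lemma smooth_at_cst U V (p : U) (c : V) : smooth_at p (fun=> c).
Proof. by exists setT; split=> [||k]; [exact: openT|by []|exact: Ck_cst]. Qed.

Lemma smooth_at_linear U V (p : U) (f : {linear U -> V}) : continuous f -> smooth_at p f.
Proof. by move=> fc; exists setT; split=> [||k]; [exact: openT|by []|exact: Ck_linear]. Qed.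

Lemma smooth_at_id U (p : U) : smooth_at p id.
Proof. by apply: (@smooth_at_linear _ _ p idfun) => x; exact: cvg_id. Qed.

Let smooth_at2 U V1 V2 (p : U) (f : U -> V1) (g : U -> V2) : smooth_at p f -> smooth_at p g ->
  exists O : set U, [/\ open O, O p, (forall k, Ck k O f) & forall k, Ck k O g].
Proof.
move=> [D [oD Dp Df]] [D' [oD' D'p D'g]]; exists (D `&` D'); split=> [||k|k].
- exact: openI.
- by [].
- by apply: Ck_sub (Df k) => x [].
- by apply: Ck_sub (D'g k) => x [].
Qed.

Lemma smooth_atD U V (p : U) (f g : U -> V) : smooth_at p f -> smooth_at p g ->
  smooth_at p (fun x => f x + g x).
Proof.
by move=> /smooth_at2 h /h[D [oD Dp Df Dg]]; exists D; split=> // k; exact: CkD.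
Qed.

Lemma smooth_at_scale U V (p : U) (a : U -> R) (g : U -> V) : smooth_at p a -> smooth_at p g ->
  smooth_at p (fun x => a x *: g x).
Proof.
by move=> /smooth_at2 h /h[D [oD Dp Df Dg]]; exists D; split=> // k; exact: Ck_scalef.
Qed.

Lemma smooth_atM U (p : U) (a b : U -> R) : smooth_at p a -> smooth_at p b ->
  smooth_at p (fun x => a x * b x).
Proof. exact: (@smooth_at_scale U R^o). Qed.

Lemma smooth_at_sum U V (p : U) I (r : seq I) (P : pred I) (f : I -> U -> V) :
  (forall i, smooth_at p (f i)) -> smooth_at p (fun x => \sum_(i <- r | P i) f i x).
Proof.
move=> fk; elim: r => [|i r IH].
  by apply: eq_smooth_at (smooth_at_cst _ 0); near=> x; rewrite big_nil.
case: (boolP (P i)) => Pi.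
  by apply: eq_smooth_at (smooth_atD (fk i) IH); near=> x; rewrite big_cons Pi.
by apply: eq_smooth_at IH; near=> x; rewrite big_cons (negbTE Pi).
Unshelve. all: by end_near. Qed.

Lemma smooth_at_prod U (p : U) I (r : seq I) (P : pred I) (f : I -> U -> R) :
  (forall i, smooth_at p (f i)) -> smooth_at p (fun x => \prod_(i <- r | P i) f i x).
Proof.
move=> fk; elim: r => [|i r IH].
  by apply: (@eq_smooth_at U R _ _ _ _ (smooth_at_cst p (1 : R))); near=> x; rewrite big_nil.
case: (boolP (P i)) => Pi.
  by apply: (@eq_smooth_at U R _ _ _ _ (smooth_atM (fk i) IH)); near=> x; rewrite big_cons Pi.
by apply: eq_smooth_at IH; near=> x; rewrite big_cons (negbTE Pi).
Unshelve. all: by end_near. Qed.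

Lemma smooth_at_comp U V W (p : U) (f : U -> V) (g : V -> W) : findim V ->
  smooth_at p f -> smooth_at (f p) g -> smooth_at p (fun x => g (f x)).
Proof.
move=> fV Hf [D' [oD' D'fp D'g]].
have fc := smooth_at_continuous Hf.
have : \forall x \near p, D' (f x) by apply: fc; exact/open_nbhs_nbhs.
rewrite -nbhs_nearE nbhsE => -[D2 [oD2 D2p] D2f].
move: Hf => [D [oD Dp Df]].
exists (D `&` D2); split=> [||k]; [exact: openI|by []|].
apply: (Ck_comp (O' := D')) => //; [exact: openI|by move=> x [_ /D2f]|].
by apply: Ck_sub (Df k) => x [].
Qed.

Lemma smooth_at_lin U V W (p : U) (f : U -> V) (L : {linear V -> W}) :
  continuous L -> smooth_at p f -> smooth_at p (fun x => L (f x)).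
Proof.
by move=> Lc [D [oD Dp Df]]; exists D; split=> // k; exact: Ck_linear_comp.
Qed.

Lemma smooth_atN U V (p : U) (f : U -> V) : smooth_at p f -> smooth_at p (fun x => - f x).
Proof.
move=> sf; apply: (@eq_smooth_at U V p (fun x => (-1) *: f x)).
  by near=> x; rewrite scaleN1r.
by apply: smooth_at_scale => //; exact: smooth_at_cst.
Unshelve. all: by end_near. Qed.

Lemma smooth_atB U V (p : U) (f g : U -> V) : smooth_at p f -> smooth_at p g ->
  smooth_at p (fun x => f x - g x).
Proof. by move=> sf /smooth_atN; exact: smooth_atD. Qed.

Lemma smooth_atV U (p : U) (a : U -> R) : smooth_at p a -> a p != 0 ->
  smooth_at p (fun x => (a x)^-1).
Proof.
move=> sa ap; apply: (@smooth_at_comp _ R R p a) => //.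
by exists [set x : R | x != 0]; split=> // k; exact: Ck_inv.
Qed.

Lemma smooth_at_sqrt U (p : U) (a : U -> R) : smooth_at p a -> 0 < a p ->
  smooth_at p (fun x => Num.sqrt (a x)).
Proof.
move=> sa ap; apply: (@smooth_at_comp _ R R p a) => //.
by exists [set x : R | 0 < x]; split=> // k; exact: Ck_sqrt.
Qed.

Lemma smooth_at_pair U V W (p : U) (f : U -> V) (g : U -> W) : smooth_at p f -> smooth_at p g ->
  smooth_at p (fun x => (f x, g x)).
Proof.
move=> sf sg.
have l1 : linear (fun v : V => (v, 0) : V * W).
  by move=> a u v; congr (_, _); rewrite /= scaler0 addr0.
have l2 : linear (fun v : W => (0, v) : V * W).
  by move=> a u v; congr (_, _); rewrite /= scaler0 addr0.
pose L1 : {linear V -> (V * W)%type} := HB.pack (fun v : V => (v, 0) : V * W)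
  (GRing.isLinear.Build _ _ _ _ _ l1).
pose L2 : {linear W -> (V * W)%type} := HB.pack (fun v : W => (0, v) : V * W)
  (GRing.isLinear.Build _ _ _ _ _ l2).
have c1 : continuous L1 by move=> v; apply: cvg_pair; [exact: cvg_id|exact: cvg_cst].
have c2 : continuous L2 by move=> v; apply: cvg_pair; [exact: cvg_cst|exact: cvg_id].
apply: eq_smooth_at (smooth_atD (smooth_at_lin c1 sf) (smooth_at_lin c2 sg)).
by near=> x; congr (_, _); rewrite /= ?addr0 ?add0r.
Unshelve. all: by end_near. Qed.

Lemma smooth_at_fst U V W (p : U) (f : U -> V * W) : smooth_at p f -> smooth_at p (fun x => (f x).1).
Proof. exact/smooth_at_lin/fst_continuous. Qed.

Lemma smooth_at_snd U V W (p : U) (f : U -> V * W) : smooth_at p f -> smooth_at p (fun x => (f x).2).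
Proof. exact/smooth_at_lin/snd_continuous. Qed.

Lemma smooth_at_coord U m n (p : U) (f : U -> 'M[R]_(m, n)) i j :
  smooth_at p f -> smooth_at p (fun x => f x i j).
Proof. exact: (@smooth_at_lin _ _ R p f (coordmx i j) (@coord_continuous _ _ _ i j)). Qed.

Lemma smooth_at_mx U m n (p : U) (f : U -> 'M[R]_(m, n)) :
  (forall i j, smooth_at p (fun x => f x i j)) -> smooth_at p f.
Proof.
move=> sf; apply: (@eq_smooth_at _ _ _
    (fun x => \sum_i \sum_j f x i j *: (delta_mx i j : 'M[R]_(m, n)))).
  by near=> x; rewrite -matrix_sum_delta.
apply: smooth_at_sum => i; apply: smooth_at_sum => j.
by apply: smooth_at_scale => //; exact: smooth_at_cst.
Unshelve. all: by end_near. Qed.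

Lemma smooth_at_mulmx U m n q (p : U) (f : U -> 'M[R]_(m, n)) (g : U -> 'M[R]_(n, q)) :
  smooth_at p f -> smooth_at p g -> smooth_at p (fun x => f x *m g x).
Proof.
move=> sf sg; apply: smooth_at_mx => i j.
apply: (@eq_smooth_at _ _ _ (fun x => \sum_k f x i k * g x k j)).
  by near=> x; rewrite mxE.
by apply: smooth_at_sum => k; apply: smooth_atM; exact: smooth_at_coord.
Unshelve. all: by end_near. Qed.

Lemma smooth_at_det U n (p : U) (f : U -> 'M[R]_n) :
  smooth_at p f -> smooth_at p (fun x => \det (f x)).
Proof.
move=> sf; apply: smooth_at_sum => s; apply: smooth_atM; first exact: smooth_at_cst.
by apply: smooth_at_prod => i; exact: smooth_at_coord.
Qed.

(** By Cramer's rule the inverse is rational in the entries, with a denominator that stays nonzero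
    near [p]. *)
Lemma smooth_at_invmx U n (p : U) (f : U -> 'M[R]_n) :
  smooth_at p f -> f p \in unitmx -> smooth_at p (fun x => invmx (f x)).
Proof.
move=> sf; rewrite unitmxE unitfE => fp.
have dc : {for p, continuous (fun x => \det (f x))} by exact/smooth_at_continuous/smooth_at_det.
have : \forall x \near p, \det (f x) != 0.
  by apply: (dc (fun y => y != 0)); apply: open_nbhs_nbhs; split=> //; exact: open_neq.
move=> dn.
apply: (@eq_smooth_at _ _ _ (fun x => (\det (f x))^-1 *: \adj (f x))).
  by apply: filterS dn => x fx; rewrite /invmx unitmxE unitfE fx.
apply: smooth_at_scale; first by apply: smooth_atV => //; exact: smooth_at_det.
apply: smooth_at_mx => i j.
apply: (@eq_smooth_at _ _ _ (fun x => (-1) ^+ (j + i) * \det (row' j (col' i (f x))))).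
  by near=> x; rewrite mxE.
apply: smooth_atM; first exact: smooth_at_cst.
apply: smooth_at_det; apply: smooth_at_mx => k l.
apply: (@eq_smooth_at _ _ _ (fun x => f x (lift j k) (lift i l))).
  by near=> x; rewrite !mxE.
exact: smooth_at_coord.
Unshelve. all: by end_near. Qed.

End SmoothAt.

(** * Mean value inequality and inverse function theorem *)

(** Makes matrices a complete normed module, the setting of the Banach fixed point theorem behind
    the inverse function theorem. *)
HB.instance Definition _ (K : realType) m n := Complete.on 'M[K]_(m, n).
Lemma findim_linear_continuous (R : realType) (U V : normedModType R) (L : {linear U -> V}) :
  findim U -> continuous L.
Proof.
move=> /findim_frame[n [e [c [cc ce]]]] x; apply: smooth_at_continuous.
apply: (@eq_smooth_at _ _ _ _ (fun u => \sum_i c i u *: L (e i))).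
  near=> u; rewrite [in RHS](ce u) linear_sum.
  by apply: eq_bigr => i _; rewrite linearZ.
apply: smooth_at_sum => i; apply: smooth_at_scale; last exact: smooth_at_cst.
exact: smooth_at_linear.
Unshelve. all: by end_near. Qed.

Lemma findim_linear_differentiable (R : realType) (U V : normedModType R) (L : {linear U -> V}) x :
  findim U -> differentiable L x.
Proof. by move=> fU; exact/linear_differentiable/findim_linear_continuous. Qed.

Lemma derive_linear (R : realType) (U V : normedModType R) (L : {linear U -> V}) x v :
  findim U -> 'D_v L x = L v.
Proof.
move=> fU; rewrite deriveE; last exact: findim_linear_differentiable.
by rewrite diff_lin//; exact: findim_linear_continuous.
Qed.

Section Mvt.
Context {R : realType}.
Implicit Types U V W : normedModType R.

Lemma is_derive_line U V (f : U -> V) (x h : U) (t : R) :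
  differentiable f (x + t *: h) ->
  is_derive t 1 (fun s : R => f (x + s *: h)) ('D_h f (x + t *: h)).
Proof.
move=> df.
have dl : differentiable (fun s : R => x + s *: h) t.
  by apply: differentiableD; [exact: differentiable_cst|exact: differentiableZl].
have ll : 'd (fun s : R => x + s *: h) t 1 = h.
  have E1 : 'd (fun s : R => x + s *: h) t = 'd (cst x) t \+ 'd (fun s : R => s *: h) t :> (R -> U).
    by apply: diffD; [exact: differentiable_cst|exact: differentiableZl].
  have E3 : 'd ( *:%R^~ h) t = *:%R^~ h :> (R -> U) by exact: diff_val.
  have E2 := @diff_cst R R U x t.
  by rewrite E1 /= E2 E3 /= add0r scale1r.
apply: DeriveDef.
  apply: diff_derivable; exact: (@differentiable_comp _ _ _ _ (fun s : R => x + s *: h) f).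
rewrite deriveE; last exact: (@differentiable_comp _ _ _ _ (fun s : R => x + s *: h) f).
by rewrite (diff_comp dl df) /= ll deriveE.
Qed.

Lemma MVT_line U (f : U -> R) (x h : U) :
  (forall t, 0 <= t <= 1 -> differentiable f (x + t *: h)) ->
  exists2 t, 0 < t < 1 & f (x + h) - f x = 'D_h f (x + t *: h).
Proof.
move=> df.
have := @MVT R (fun t => f (x + t *: h)) (fun t => 'D_h f (x + t *: h)) 0 1 ltr01.
case.
- move=> t; rewrite in_itv /= => /andP[t0 t1]; apply: is_derive_line.
  by apply: df; rewrite !ltW.
- apply: derivable_within_continuous => t; rewrite in_itv /= => t01.
  by have [] := is_derive_line (df t t01).
- move=> t; rewrite in_itv /= scale1r scale0r addr0 subr0 mulr1 => t01 E.
  by exists t.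
Qed.

Lemma mx_norm_entry m n (M : 'M[R]_(m, n)) i j : `|M i j| <= `|M|.
Proof. by rewrite [leRHS]/Num.Def.normr /= mx_normrE; exact: (le_bigmax _ _ (i, j)). Qed.

Lemma mx_norm_le m n (M : 'M[R]_(m, n)) c : 0 <= c -> (forall i j, `|M i j| <= c) -> `|M| <= c.
Proof.
by move=> c0 H; rewrite [leLHS]/Num.Def.normr /= mx_normrE bigmax_le// => -[i j] _; exact: H.
Qed.

Lemma derive_entry U m n (f : U -> 'M[R]_(m, n)) x v i j : differentiable f x ->
  'D_v (fun y => f y i j) x = ('D_v f x) i j.
Proof. by move=> df; rewrite derive_mx ?mxE//; exact: diff_derivable. Qed.

Lemma differentiable_entry U m n (f : U -> 'M[R]_(m, n)) x i j : differentiable f x ->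
  differentiable (fun y => f y i j) x.
Proof.
move=> df; apply: (@differentiable_comp _ _ _ _ f (fun M : 'M[R]_(m, n) => M i j)) => //.
exact: differentiable_coord.
Qed.

(** In the sup norm the scalar mean value theorem can be applied entry by entry, each entry having
    its own intermediate point, without loss in the constant. *)
Lemma lipschitz_derive U m n (f : U -> 'M[R]_(m, n)) c (x h : U) : 0 <= c ->
  (forall t, 0 <= t <= 1 -> differentiable f (x + t *: h)) ->
  (forall t, 0 <= t <= 1 -> `|'D_h f (x + t *: h)| <= c * `|h|) ->
  `|f (x + h) - f x| <= c * `|h|.
Proof.
move=> c0 df bf; apply: mx_norm_le => [|i j]; first by rewrite mulr_ge0.
have [|t /andP[t0 t1]] := @MVT_line U (fun y => f y i j) x h.
  by move=> t t01; apply: differentiable_entry; exact: df.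
have t01 : 0 <= t <= 1 by rewrite !ltW.
rewrite !mxE => ->; rewrite derive_entry; last exact: df.
exact: le_trans (mx_norm_entry _ _ _) (bf _ t01).
Qed.

Lemma linear_bound U V (L : {linear U -> V}) : continuous L ->
  exists2 k, 0 < k & forall x, `|L x| <= k * `|x|.
Proof. move=> Lc; exact: linear_lipschitz. Qed.

(** Continuity of the finitely many derivatives along a frame yields a bound that is uniform in the
    direction [h]. *)
Lemma derive_small U V (f : U -> V) p : findim U -> smooth_at p f -> (forall v, 'D_v f p = 0) ->
  forall c, 0 < c -> \forall z \near p, forall h, `|'D_h f z| <= c * `|h|.
Proof.
move=> /findim_frame[n [e [l [lc le]]]] sf f0 c c0.
have [k k0 lk] : exists2 k, 0 < k & forall i x, `|l i x| <= k * `|x|.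
  have kP i : {k | 0 < k & forall x, `|l i x| <= k * `|x|}.
    by apply: cid2; apply: linear_bound.
  exists (1 + \sum_i s2val (kP i)); first by rewrite ltr_pwDl// sumr_ge0// => i _; case: (kP i) => /= ? /ltW.
  move=> i x; apply: le_trans (s2valP' (kP i) x) _; rewrite ler_wpM2r//.
  rewrite (bigD1 i)//= addrCA lerDl addr_ge0// sumr_ge0// => j _.
  by case: (kP j) => /= ? /ltW.
(* [k] bounds all coordinate forms and there are [n] of them; [n.+1] keeps the quotient meaningful
   for an empty frame. *)
have c'0 : 0 < c / (k * n.+1%:R) by rewrite divr_gt0// mulr_gt0.
have sm : \forall z \near p, forall i, `|'D_(e i) f z| <= c / (k * n.+1%:R).
  apply: filter_forall => i.
  have := smooth_at_continuous (smooth_at_derive (e i) sf).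
  move=> /cvgr_norm_lt; rewrite f0 normr0 => /(_ _ c'0).
  by apply: filterS => z /ltW.
have := smooth_at_near sf; apply: filterS2 sm => z zs zf h.
have dz := smooth_at_differentiable zf.
rewrite deriveE// [in leLHS](le h) linear_sum.
apply: le_trans (ler_norm_sum _ _ _) _.
apply: (@le_trans _ _ (\sum_(i < n) (k * `|h|) * (c / (k * n.+1%:R)))).
  apply: ler_sum => i _; rewrite linearZ normrZ ler_pM//.
  by rewrite -deriveE//; exact: zs.
rewrite sumr_const card_ord -[X in X <= _]mulr_natr.
have -> : k * `|h| * (c / (k * n.+1%:R)) * n%:R = c * `|h| * (n%:R / n.+1%:R).
  have N0 : n.+1%:R != 0 :> R by rewrite pnatr_eq0.
  have k1 : k != 0 by rewrite gt_eqF.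
  by move: (n.+1%:R) N0 => N N0; field; rewrite k1 N0.
rewrite -[leRHS]mulr1; apply: ler_wpM2l; first by apply: mulr_ge0 => //; exact: ltW.
by apply: ltW; rewrite ltr_pdivrMr ?mul1r ?ltr_nat ?ltr0n.
Qed.

(** Strict differentiability: balls are convex, so the mean value inequality applies to the segment
    between any two points of a ball on which the derivative is small. *)
Lemma strict_derive_small U m n (f : U -> 'M[R]_(m, n)) p : findim U ->
  smooth_at p f -> (forall v, 'D_v f p = 0) ->
  forall c, 0 < c -> exists2 r, 0 < r & forall x y, `|x - p| < r -> `|y - p| < r ->
    smooth_at x f /\ `|f x - f y| <= c * `|x - y|.
Proof.
move=> fU sf f0 c c0.

have H : \forall z \near p, smooth_at z f /\ forall h, `|'D_h f z| <= c * `|h|.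
  by near=> z; split; near: z; [exact: smooth_at_near|exact: derive_small].
move/nbhs_ballP : H => [r /= r0 H]; exists r => // x y xr yr.
have bxy t : 0 <= t <= 1 -> ball p r (y + t *: (x - y)).
  move=> /andP[t0 t1]; rewrite -ball_normE /ball_ /= distrC.
  have -> : y + t *: (x - y) - p = (1 - t) *: (y - p) + t *: (x - p).
    by rewrite scalerBl scale1r -[RHS]addrA [- _ + _]addrC -scalerBr opprB addrA subrK addrAC.
  apply: le_lt_trans (ler_normD _ _) _; rewrite !normrZ (ger0_norm t0) ger0_norm ?subr_ge0//.
  have [->|tn0] := eqVneq t 0; first by rewrite subr0 mul0r addr0 mul1r.
  apply: (@lt_le_trans _ _ ((1 - t) * r + t * r)); last by rewrite -mulrDl subrK mul1r.
  apply: ler_ltD; first by rewrite ler_wpM2l ?subr_ge0// ltW.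
  by rewrite ltr_pM2l// lt_def tn0.
split; first by apply: (H x _).1; rewrite -ball_normE /ball_ /= distrC.
have := @lipschitz_derive U m n f c y (x - y) (ltW c0).
rewrite (_ : y + (x - y) = x); last by rewrite addrC subrK.
apply=> t t01.
  by apply: smooth_at_differentiable; apply: (H _ _).1; exact: bxy.
by apply: (H _ _).2; exact: bxy.
Unshelve. all: by end_near. Qed.
End Mvt.

Section InverseFunction.
Context {R : realType}.

Lemma derive_comp (U V W : normedModType R) (f : U -> V) (g : V -> W) x v :
  differentiable f x -> differentiable g (f x) ->
  'D_v (fun y => g (f y)) x = 'D_('D_v f x) g (f x).
Proof.
move=> df dg; rewrite deriveE; last exact: (@differentiable_comp _ _ _ _ f g).
by rewrite (_ : 'd _ x = 'd (g \o f) x)// (diff_comp df dg) /= !deriveE.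
Qed.

Lemma Ck_local (U V : normedModType R) (D : set U) (f : U -> V) : open D ->
  (forall x, D x -> smooth_at x f) -> forall k, Ck k D f.
Proof.
move=> oD sf k; elim: k f sf => [|k IH] f sf /=.
  by move=> x Dx; exact/smooth_at_continuous/sf.
split; first by move=> x Dx; exact/smooth_at_differentiable/sf.
by move=> v; apply: IH => x Dx; exact/smooth_at_derive/sf.
Qed.

Lemma jacobian_entry m n (f : 'rV[R]_m -> 'rV[R]_n) x i j : differentiable f x ->
  jacobian f x i j = ('D_(delta_mx 0 i) f x) 0 j.
Proof. by move=> df; rewrite deriveE// mxE. Qed.

Lemma smooth_at_jacobian m n (f : 'rV[R]_m -> 'rV[R]_n) p : smooth_at p f ->
  smooth_at p (fun x => jacobian f x).
Proof.
move=> sf; apply: smooth_at_mx => i j.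
apply: (@eq_smooth_at _ _ _ _ (fun x => ('D_(delta_mx 0 i) f x) 0 j)).
  have := smooth_at_near sf; apply: filterS => x /smooth_at_differentiable dx.
  by rewrite jacobian_entry.
exact/smooth_at_coord/smooth_at_derive.
Qed.

(* Pairs of germs, at p and at q = f p, of mutually inverse smooth maps. *)
Definition local_diffeo (U V : normedModType R) (p : U) (q : V) (f : U -> V) (g : V -> U) :=
  [/\ f p = q, smooth_at p f, smooth_at q g, (\forall x \near p, g (f x) = x) &
      \forall y \near q, f (g y) = y].

(** Since the derivative at [p] is the identity, [phi x = x - G x] is a contraction near [p], and
    [G x = y] says that [x] is a fixed point of [y + phi x]. The formula for the derivative of the
    inverse then raises its regularity step by step. *)
Lemma inverse_function_id n (G : 'rV[R]_n -> 'rV[R]_n) p : smooth_at p G ->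
  (forall v, 'D_v G p = v) -> exists g, local_diffeo p (G p) G g.
Proof.
move=> sG G1.
pose phi x := x - G x.
have sphi : smooth_at p phi by apply: smooth_atB => //; exact: smooth_at_id.
have phi0 v : 'D_v phi p = 0.
  rewrite (_ : phi = id - G)// deriveB ?derive_id ?G1 ?subrr//.
  exact/diff_derivable/smooth_at_differentiable.
have [r0 r00 H0] := @strict_derive_small R _ _ _ phi p _ sphi phi0 2^-1 (ltac:(by rewrite invr_gt0)).
have [r1 r10 H1] : exists2 r1, 0 < r1 & forall x, `|x - p| < r1 ->
     smooth_at x G /\ forall v, `|'D_v phi x| <= 2^-1 * `|v|.
  have H : \forall z \near p, smooth_at z G /\ forall h, `|'D_h phi z| <= 2^-1 * `|h|.
    near=> z; split; near: z; [exact: (smooth_at_near sG)|].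
    by apply: derive_small => //; rewrite invr_gt0.
  move/nbhs_ballP : H => [r /= rr H]; exists r => // x xr.
  by apply: H; rewrite -ball_normE /ball_ /= distrC.
(* Halving makes the closed ball of radius [r], needed for the fixed point theorem, lie in both open
   balls. *)
pose r := Num.min r0 r1 / 2.
have r_gt0 : 0 < r by rewrite divr_gt0// lt_min r00 r10.
have r_lt x : `|x - p| <= r -> `|x - p| < r0 /\ `|x - p| < r1.
  move=> xr; have : r < Num.min r0 r1.
    by rewrite /r ltr_pdivrMr// ltr_pMr ?ltr1n// lt_min r00 r10.
  by rewrite lt_min => /andP[? ?]; split; exact: le_lt_trans xr _.
have phiL x y : `|x - p| <= r -> `|y - p| <= r -> `|phi x - phi y| <= 2^-1 * `|x - y|.
  by move=> /r_lt[xr _] /r_lt[yr _]; have [] := H0 x y xr yr.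
have pp : `|p - p| <= r by rewrite subrr normr0 ltW.
(* Injectivity in quantitative form: the local inverse is 2-Lipschitz, because [x - y] differs from
   [G x - G y] by at most half of its norm. *)
have inj x y : `|x - p| <= r -> `|y - p| <= r -> `|x - y| <= 2 * `|G x - G y|.
  move=> xr yr; have := phiL _ _ xr yr.
  have -> : x - y = (G x - G y) + (phi x - phi y).
    by rewrite /phi addrACA -opprD ![G _ + (_ - _)]addrC !subrK.
  move=> h; apply: le_trans (ler_normD _ _) _.
  have h2 : `|phi x - phi y| <= `|G x - G y| by
    move: h (ler_normD (G x - G y) (phi x - phi y)); lra.
  by rewrite mulr2n mulrDl mul1r lerD2l.
have surj y : `|y - G p| < r / 2 -> exists2 x, `|x - p| <= r & G x = y.
  move=> yr.
  pose B := closed_ball_ (@Num.Def.normr R 'rV[R]_n) p r.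
  pose T x := y + phi x.
  have TB : {homo T : x / B x >-> B x}.
    move=> x; rewrite /B /closed_ball_ /= distrC => xr; rewrite distrC /T.
    have -> : y + phi x - p = (y - G p) + (phi x - phi p).
      by rewrite [phi p]/phi; apply/rowP => j; rewrite !mxE; ring.
    apply: le_trans (ler_normD _ _) _.
    by have := phiL _ _ xr pp; move: yr; lra.
  have [] := @banach_fixed_point R 'rV[R]_n B (mkfun_fun TB).
  - exists 2^-1%:nng; split; first by rewrite /= invf_lt1 ?ltr1n.
    move=> [a b] /= [aB bB]; rewrite /T opprD addrACA subrr add0r.
    by apply: phiL; rewrite distrC.
  - exact: closed_closed_ball_.
  - by exists p; rewrite /B /closed_ball_ /= distrC.
  move=> x; rewrite /B /closed_ball_ /= distrC /T /phi => xr xE; exists x => //.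
  have e0 : y - G x = (y + (x - G x)) - x by rewrite addrCA addrAC subrr add0r.
  by apply/esym/eqP; rewrite -subr_eq0 e0 -[X in X - _]xE subrr.
pose g y := xget p [set x | `|x - p| <= r /\ G x = y].
have gP y : `|y - G p| < r / 2 -> `|g y - p| <= r /\ G (g y) = y.
  by move=> /surj[x xr xy]; rewrite /g; case: xgetP => [z -> //|/(_ x)[]].
have gG x : `|x - p| <= r -> `|G x - G p| < r / 2 -> g (G x) = x.
  move=> xr /gP[gr gE]; apply/eqP; rewrite -subr_eq0 -normr_le0.
  by have := inj _ _ gr xr; rewrite gE subrr normr0 mulr0.
have gL y z : `|y - G p| < r / 2 -> `|z - G p| < r / 2 -> `|g y - g z| <= 2 * `|y - z|.
  by move=> /gP[yr yE] /gP[zr zE]; have := inj _ _ yr zr; rewrite yE zE.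
(* A vector [v] killed by the Jacobian satisfies ['D_v phi x = v], while the norm of the left side
   is at most half that of [v]. *)
have Junit x : `|x - p| < r1 -> jacobian G x \in unitmx.
  move=> xr; have [sx bx] := H1 _ xr.
  have dG := smooth_at_differentiable sx.
  rewrite -row_free_unit; apply/row_freeP; exists (invmx (jacobian G x)).
  apply: mulmxV; rewrite -row_free_unit -kermx_eq0; apply/eqP/row_matrixP => i.
  rewrite row0; set v := row i _.
  have v0 : v *m jacobian G x = 0 by apply/eqP; rewrite /v -sub_kermx row_sub.
  have := bx v; rewrite (_ : phi = id - G)// deriveB//; last exact: diff_derivable.
  rewrite derive_id deriveEjacobian// v0 subr0 => h.
  by apply/eqP; rewrite -normr_le0; move: h; lra.
have Gcont : {for p, continuous G} by exact: smooth_at_continuous.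
pose D := [set y | `|y - G p| < r / 2].
have oD : open D.
  rewrite (_ : D = ball (G p) (r / 2)); first exact: ball_open.
  by apply/seteqP; split=> x; rewrite -ball_normE /D /= /ball_ distrC.
have r20 : 0 < r / 2 by rewrite divr_gt0.
have Dp : D (G p) by rewrite /D /= subrr normr0.
have gd y : D y -> differentiable g y /\ forall v, 'D_v g y = v *m invmx (jacobian G (g y)).
  move=> Dy; have [gr gE] := gP _ Dy.
  have sG' := (H1 _ (r_lt _ gr).2).1; have dG := smooth_at_differentiable sG'.
  set J := jacobian G (g y).
  have lc : continuous (mulmxr (invmx J) : 'rV[R]_n -> 'rV[R]_n).
    exact: findim_linear_continuous.
  have [d e] : differentiable g y /\ 'd g y = mulmxr (invmx J) :> ('rV[R]_n -> 'rV[R]_n).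
    apply: diff_epsP => // e e0.
    have [k k0 lk] := linear_bound lc.
    (* The inverse is 2-Lipschitz and multiplication by [invmx J] has bound [k], so this error turns
       into [e] times the norm of [h]. *)
    have ek : 0 < e / (2 * k) by rewrite divr_gt0// mulr_gt0.
    have := diff_eps dG ek => Hd.
    have Dn := near_addr (open_nbhs_nbhs (conj oD Dy)).
    have Hd' : \forall h \near (0 : 'rV[R]_n), `|G (g (h + y) - g y + g y) - G (g y) -
        'd G (g y) (g (h + y) - g y)| <= e / (2 * k) * `|g (h + y) - g y|.
      move: Hd => /nbhs_ballP[d /= d0 Hd].
      have d20 : 0 < d / 2 by rewrite divr_gt0.
      have Bn : \forall h \near (0 : 'rV[R]_n), `|h| < d / 2.
        apply/nbhs_ballP; exists (d / 2) => // h.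
        by rewrite -ball_normE /ball_ /= sub0r normrN.
      move: Dn Bn; apply: filterS2 => h Dh hd; apply: Hd.
      rewrite -ball_normE /ball_ /= sub0r normrN.
      have L := gL _ _ Dh Dy; rewrite addrK in L; apply: le_lt_trans L _.
      by rewrite mulrC -ltr_pdivlMr.
    move: Hd' Dn; apply: filterS2 => h /=.
    rewrite subrK => A Dh; have [gr' gE'] := gP _ Dh.
    rewrite gE' gE addrK in A.
    have E : 'd G (g y) (g (h + y) - g y) = (g (h + y) - g y) *m J.
      by rewrite -deriveE// deriveEjacobian.
    rewrite E in A.
    have -> : g (h + y) - g y - h *m invmx J = - mulmxr (invmx J) (h - (g (h + y) - g y) *m J).
      by rewrite /= mulmxBl -mulmxA mulmxV ?mulmx1 ?opprB// Junit//; case: (r_lt _ gr).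
    rewrite normrN; apply: le_trans (lk _) _.
    have L := gL _ _ Dh Dy; rewrite addrK in L.
    apply: (@le_trans _ _ (k * (e / (2 * k) * (2 * `|h|)))).
      apply: ler_wpM2l; first exact: ltW.
      by apply: le_trans A _; apply: ler_wpM2l => //; exact: ltW.
    rewrite le_eqVlt; apply/orP; left; apply/eqP; field; exact: lt0r_neq0.
  by split=> // v; rewrite deriveE// e.
(* Bootstrapping: the derivative of [g] is a smooth function of [g] itself, hence of class C^k as
   soon as [g] is. *)
have gCk k : Ck k D g.
  elim: k => [|k IH] /=.
    by move=> y Dy; apply: differentiable_continuous; case: (gd y Dy).
  split=> [y Dy|v]; first by case: (gd y Dy).
  apply: (@eq_Ck _ _ _ _ _ (fun y => v *m invmx (jacobian G (g y)))) => //.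
    by move=> y Dy; case: (gd y Dy).
  apply: (@Ck_comp R _ _ _ k D (ball p r1) g (fun x => v *m invmx (jacobian G x))) => //.
  - exact: ball_open.
  - move=> y Dy; have [gr _] := gP _ Dy; have [_ gr1] := r_lt _ gr.
    by rewrite -ball_normE /ball_ /= distrC.
  - apply: Ck_local; first exact: ball_open.
    move=> x; rewrite -ball_normE /ball_ /= distrC => xr.
    apply: smooth_at_mulmx; first exact: smooth_at_cst.
    apply: smooth_at_invmx; last exact: Junit.
    by apply: smooth_at_jacobian; case: (H1 _ xr).
exists g; split=> //.
- by exists D; split.
- near=> x; apply: gG.
    near: x; apply/nbhs_ballP; exists r => // x; rewrite -ball_normE /ball_ /= distrC.
    exact: ltW.
  near: x; have := Gcont; move/cvgrPdist_lt => /(_ _ r20).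
  by apply: filterS => x; rewrite distrC.
- by move/open_nbhs_nbhs: (conj oD Dp); apply: filterS => y /gP[].
Unshelve. all: by end_near. Qed.


Lemma local_diffeo_comp (U V W : normedModType R) (p : U) (q : V) (r : W) f g f' g' :
  findim U -> findim V -> findim W ->
  local_diffeo p q f g -> local_diffeo q r f' g' ->
  local_diffeo p r (fun x => f' (f x)) (fun z => g (g' z)).
Proof.
move=> fU fV fW [fp sf sg gf fg] [fq sf' sg' gf' fg'].
have gq : g q = p by rewrite -fp; exact: nbhs_singleton gf.
have gr : g' r = q by rewrite -fq; exact: nbhs_singleton gf'.
split; first by rewrite fp fq.
- by apply: smooth_at_comp => //; rewrite fp.
- by apply: smooth_at_comp => //; rewrite gr.
- have fc := smooth_at_continuous sf; rewrite /prop_for /continuous_at fp in fc.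
  have H := fc _ gf'; move: gf H; apply: filterS2 => x /= gfx ->//.
- have gc := smooth_at_continuous sg'; rewrite /prop_for /continuous_at gr in gc.
  by have H := gc _ fg; move: fg' H; apply: filterS2 => x /= gfx ->.
Qed.

Lemma local_diffeo_sym (U V : normedModType R) (p : U) (q : V) f g :
  local_diffeo p q f g -> local_diffeo q p g f.
Proof.
by move=> [fp sf sg gf fg]; split=> //; rewrite -fp; exact: nbhs_singleton gf.
Qed.

Lemma local_diffeo_linear (U V : normedModType R) (p : U) (f : {linear U -> V})
    (g : {linear V -> U}) : findim U -> findim V -> cancel f g -> cancel g f ->
  local_diffeo p (f p) f g.
Proof.
move=> fU fV fg gf; split=> //.
- exact/smooth_at_linear/findim_linear_continuous.
- exact/smooth_at_linear/findim_linear_continuous.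
- by near=> x; rewrite fg.
- by near=> x; rewrite gf.
Unshelve. all: by end_near. Qed.

(** Composing with the inverse of the Jacobian reduces to a derivative equal to the identity. *)
Lemma inverse_function n (G : 'rV[R]_n -> 'rV[R]_n) p : smooth_at p G ->
  jacobian G p \in unitmx -> exists g, local_diffeo p (G p) G g.
Proof.
move=> sG Ju; set J := jacobian G p in Ju.
have dG := smooth_at_differentiable sG.
pose L : {linear 'rV[R]_n -> 'rV[R]_n} := mulmxr (invmx J).
pose L' : {linear 'rV[R]_n -> 'rV[R]_n} := mulmxr J.
have Lc : continuous L by exact: findim_linear_continuous.
have [| |g Hg] := @inverse_function_id n (fun x => L (G x)) p.
- exact: smooth_at_lin.
- move=> v; rewrite (@derive_comp _ _ _ G L)//; last exact: findim_linear_differentiable.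
  by rewrite derive_linear deriveEjacobian//= -mulmxA mulmxV// mulmx1.
have HL : local_diffeo (L (G p)) (G p) L' L.
  have e : G p = L' (L (G p)) by rewrite /= -mulmxA mulVmx// mulmx1.
  rewrite {2}e; apply: local_diffeo_linear => x /=.
    by rewrite -mulmxA mulmxV// mulmx1.
  by rewrite -mulmxA mulVmx// mulmx1.
have [A B C D E] := local_diffeo_comp _ _ _ Hg HL.
exists (fun z => g (L z)); split=> //.
  near=> x; near: x; apply: filterS D => x; rewrite /= -[_ *m J]mulmxA mulVmx// mulmx1//.
by apply: filterS E => x; rewrite /= -[_ *m J]mulmxA mulVmx// mulmx1.
Unshelve. all: by end_near. Qed.

(* The inverse function theorem, transported from ['rV_n] along a linear isomorphism. *)
Lemma inverse_function_iso (U : normedModType R) n (c : {linear U -> 'rV[R]_n})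
    (c' : {linear 'rV[R]_n -> U}) (G : U -> U) p : findim U -> cancel c c' -> cancel c' c ->
  smooth_at p G -> (forall v, 'D_v G p = 0 -> v = 0) ->
  exists g, local_diffeo p (G p) G g.
Proof.
move=> fU cK c'K sG inj.
pose H z := c (G (c' z)).
have cc : continuous c by exact: findim_linear_continuous.
have cc' : continuous c' by exact: findim_linear_continuous.
have sH : smooth_at (c p) H.
  apply: smooth_at_lin => //; apply: smooth_at_comp; last by rewrite cK.
  exact: smooth_at_linear.
have dG := smooth_at_differentiable sG.
have dH := smooth_at_differentiable sH.
have DH v : 'D_v H (c p) = c ('D_(c' v) G p).
  rewrite /H (@derive_comp _ _ _ (fun z => G (c' z)) c).
  - rewrite derive_linear (@derive_comp _ _ _ c' G) ?cK ?derive_linear//.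
    exact: findim_linear_differentiable.
  - apply: (@differentiable_comp _ _ _ _ c' G); last by rewrite cK.
    exact: findim_linear_differentiable.
  - exact: findim_linear_differentiable.
have [||g Hg] := @inverse_function n H (c p) => //.
  rewrite -row_free_unit -kermx_eq0; apply/eqP/row_matrixP => i.
  rewrite row0; set v := row i _.
  have v0 : v *m jacobian H (c p) = 0 by apply/eqP; rewrite /v -sub_kermx row_sub.
  move: v0; rewrite -deriveEjacobian// DH -(linear0 c) => /(can_inj cK)/inj v0.
  by rewrite -(c'K v) v0 linear0.
have L1 : local_diffeo p (c p) c c' by exact: local_diffeo_linear.
have L2 : local_diffeo (H (c p)) (c' (H (c p))) c' c by exact: local_diffeo_linear.
have [A B C D E] := local_diffeo_comp _ _ _ (local_diffeo_comp _ _ _ L1 Hg) L2.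
exists (fun z => c' (g (c z))); split.
- by [].
- by [].
- by move: C; rewrite /H !cK.
- by apply: filterS D => x; rewrite /H !cK.
- by move: E; rewrite {1}/H !cK; apply: filterS => x; rewrite /H !cK.
Qed.

End InverseFunction.

(** * Symmetry of second derivatives and Taylor's formula *)

Section RealAux.
Context {R : realType}.
Implicit Types a b c d e x y z p q r : R.

Lemma dist_lt_half x y z e : `|x - z| < e / 2 -> `|y - z| < e / 2 -> `|x - y| < e.
Proof.
move=> h1 h2; rewrite (_ : x - y = (x - z) - (y - z)); last by ring.
by apply: le_lt_trans (ler_normB _ _) _; rewrite [e]splitr ltrD.
Qed.

Lemma subBBC a b c d : a - b - (c - d) = a - c - (b - d).
Proof. by ring. Qed.

Lemma sub_defect a b c d p q : p = q + d -> a - b - c = (a - p) - (b - d) - (c - q).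
Proof. by move=> ->; ring. Qed.

Lemma int_defect a b c d p q r : r = p + d *: (q : R^o) ->
  a * b + -1 * (a * c) + -1 * (a * p + a * d * q) = a * (b - c - r).
Proof. by move=> ->; rewrite -[d *: _]/(d * q); ring. Qed.

Lemma scaleD4 a p q r x : a * p + q + (a * r + x) = a *: (p + r : R^o) + (q + x).
Proof. by rewrite -[_ *: _]/(a * (p + r)); ring. Qed.

End RealAux.

Section Schwarz.
Context {R : realType}.

Lemma smooth_at_near_lt (U V : normedModType R) (f : U -> V) p e : smooth_at p f -> 0 < e ->
  \forall z \near p, `|f p - f z| < e.
Proof. by move=> /smooth_at_continuous/cvgrPdist_lt/(_ e) H /H; apply: filterS. Qed.

Lemma near_and (U : normedModType R) (p : U) (P Q : U -> Prop) :
  (\forall z \near p, P z) -> (\forall z \near p, Q z) -> \forall z \near p, P z /\ Q z.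
Proof. exact: filterI. Qed.

(** The mean value theorem is used twice: along [u] for the increment [f (x + v) - f x], then along
    [v] for ['D_u f]. *)
Lemma second_difference (U : normedModType R) (f : U -> R) p u v :
  (forall a b : R, 0 <= a <= 1 -> 0 <= b <= 1 -> smooth_at (p + a *: u + b *: v) f) ->
  exists a b : R, [/\ 0 <= a <= 1, 0 <= b <= 1 &
    f (p + u + v) - f (p + u) - (f (p + v) - f p) = 'D_v ('D_u f) (p + a *: u + b *: v)].
Proof.
move=> sf.
have o01 : 0 <= (0 : R) <= 1 by rewrite lexx ler01.
have l01 : 0 <= (1 : R) <= 1 by rewrite lexx ler01.
have ds x : differentiable (fun y : U => y + v) x.
  by apply: differentiableD => //; exact: differentiable_cst.
have s0 t : 0 <= t <= 1 -> differentiable f (p + t *: u).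
  by move=> t01; apply: smooth_at_differentiable; have := sf t 0 t01 o01; rewrite scale0r addr0.
have s1 t : 0 <= t <= 1 -> differentiable f (p + t *: u + v).
  by move=> t01; apply: smooth_at_differentiable; have := sf t 1 t01 l01; rewrite scale1r.
have sc t : 0 <= t <= 1 -> differentiable (fun x => f (x + v)) (p + t *: u).
  by move=> t01; apply: (@differentiable_comp _ _ _ _ (fun x => x + v) f) => //; exact: s1.
have [|t /andP[t0 t1] Et] := @MVT_line R U (fun x => f (x + v) - f x) p u.
  by move=> t t01; apply: differentiableB; [exact: sc|exact: s0].
have t01 : 0 <= t <= 1 by rewrite !ltW.
have [|r /andP[r0 r1] Er] := @MVT_line R U ('D_u f) (p + t *: u) v.
  by move=> r r01; apply/smooth_at_differentiable/smooth_at_derive; exact: sf.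
have r01 : 0 <= r <= 1 by rewrite !ltW.
exists t, r; split=> //; rewrite -Er.
rewrite Et deriveB; [|exact/diff_derivable/sc|exact/diff_derivable/s0].
congr (_ - _); rewrite (@derive_comp _ _ _ _ (fun x => x + v) f)//; last exact: s1.
by rewrite deriveD ?derive_id ?derive_cst ?addr0.
Qed.

(** The second difference is symmetric in [u] and [v], so the two mixed derivatives agree at two
    points as close to [p] as desired; continuity at [p] concludes. *)
Lemma derive_symmetric (U : normedModType R) (f : U -> R) p u v : smooth_at p f ->
  'D_u ('D_v f) p = 'D_v ('D_u f) p.
Proof.
move=> sf.
apply/eqP; rewrite -subr_eq0 -normr_le0; apply/ler_addgt0Pl => e e0; rewrite addr0.
have e20 : 0 < e / 2 by rewrite divr_gt0.
have c1 := smooth_at_near_lt (smooth_at_derive u (smooth_at_derive v sf)) e20.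
have c2 := smooth_at_near_lt (smooth_at_derive v (smooth_at_derive u sf)) e20.
have /nbhs_ballP[r /= r0 H] : \forall z \near p, smooth_at z f /\
    (`|'D_u ('D_v f) p - 'D_u ('D_v f) z| < e / 2 /\ `|'D_v ('D_u f) p - 'D_v ('D_u f) z| < e / 2).
  exact: (near_and (smooth_at_near sf) (near_and c1 c2)).
(* The added 1 makes [M] positive even for zero directions; [h] is then chosen so that the whole
   parallelogram spanned by [h *: u] and [h *: v] lies in the ball. *)
pose M := `|u| + `|v| + 1.
have M0 : 0 < M by rewrite /M ltr_wpDl// addr_ge0.
have [h h0 hM] : exists2 h : R, 0 < h & h * M < r.
  exists (r / 2 / M); first by rewrite !divr_gt0.
  by rewrite divfK ?gt_eqF// ltr_pdivrMr// ltr_pMr// ltr1n.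
have B a b : 0 <= a <= 1 -> 0 <= b <= 1 -> ball p r (p + a *: (h *: u) + b *: (h *: v)).
  move=> /andP[a0 a1] /andP[b0 b1]; rewrite -ball_normE /ball_ /= -addrA opprD addrA subrr sub0r normrN.
  apply: le_lt_trans (ler_normD _ _) _; rewrite !normrZ !(ger0_norm a0, ger0_norm b0) (gtr0_norm h0).
  apply: (@le_lt_trans _ _ (h * `|u| + h * `|v|)).
    by apply: lerD; apply: ler_piMl => //; apply: mulr_ge0 => //; exact: ltW.
  rewrite -mulrDr; apply: (@le_lt_trans _ _ (h * M)).
    by apply: ler_wpM2l; [exact: ltW|rewrite /M lerDl].
  exact: hM.
have DZ w g x : differentiable g x -> 'D_(h *: w) g x = h * 'D_w g x :> R.
  by move=> dg; rewrite !deriveE// linearZ.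
have DZ2 w1 w2 x : smooth_at x f -> 'D_(h *: w1) ('D_(h *: w2) f) x = h * h * 'D_w1 ('D_w2 f) x.
  move=> sx; rewrite DZ; last exact/smooth_at_differentiable/smooth_at_derive.
  rewrite -mulrA; congr (_ * _).
  rewrite -[RHS]/(h *: 'D_w1 ('D_w2 f) x) -deriveZ; last first.
    exact/diff_derivable/smooth_at_differentiable/smooth_at_derive.
  apply: near_eq_derive; have := smooth_at_near sx; apply: filterS => y sy.
  by rewrite DZ//; exact: smooth_at_differentiable.
have [|a1 [b1 [a1P b1P E1]]] := @second_difference U f p (h *: u) (h *: v).
  by move=> a b a01 b01; exact: (H _ (B a b a01 b01)).1.
have [|a2 [b2 [a2P b2P E2]]] := @second_difference U f p (h *: v) (h *: u).
  by move=> a b a01 b01; rewrite addrAC; exact: (H _ (B b a b01 a01)).1.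
have B2 := H _ (B b2 a2 b2P a2P); rewrite addrAC in B2.
have [s1 [_ C1]] := H _ (B a1 b1 a1P b1P); have [s2 [C2 _]] := B2.
rewrite DZ2// in E1; rewrite DZ2// in E2.
have E : 'D_v ('D_u f) (p + a1 *: (h *: u) + b1 *: (h *: v)) =
         'D_u ('D_v f) (p + a2 *: (h *: v) + b2 *: (h *: u)).
  apply: (@mulfI _ (h * h)); first by rewrite mulf_neq0// gt_eqF.
  apply: (etrans (esym E1) (etrans _ E2)).
  by rewrite [p + h *: v + _]addrAC; exact: subBBC.
rewrite E in C1; apply: ltW; exact: dist_lt_half C2 C1.
Qed.

End Schwarz.

(** * Integrals over [0, 1] depending on a parameter, and Taylor's formula *)

Section Integral01.
Context {R : realType}.
Implicit Types a b c : R -> R.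

Definition cont01 a := forall t, 0 <= t <= 1 -> {for t, continuous a}.
Definition int01 a : R := \int[lebesgue_measure]_(t in `[0, 1]) a t.

Lemma cont01_integrable a : cont01 a ->
  (@lebesgue_measure R).-integrable `[0, 1] (EFin \o a).
Proof.
move=> ca; apply: continuous_compact_integrable; first exact: segment_compact.
apply: continuous_in_subspaceT => t; rewrite inE /= in_itv /= => t01; exact: ca.
Qed.

Lemma eq_int01 a b : (forall t, 0 <= t <= 1 -> a t = b t) -> int01 a = int01 b.
Proof.
by move=> ab; apply: eq_Rintegral => t; rewrite inE /= in_itv /= => t01; exact: ab.
Qed.

Lemma int01D a b : cont01 a -> cont01 b -> int01 (fun t => a t + b t) = int01 a + int01 b.
Proof. by move=> /cont01_integrable ia /cont01_integrable ib; apply: RintegralD. Qed.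

Lemma int01Z (k : R) a : cont01 a -> int01 (fun t => k * a t) = k * int01 a.
Proof. by move=> /cont01_integrable ia; apply: RintegralZl. Qed.

Lemma cont01_cst (k : R) : cont01 (fun=> k). Proof. by move=> t _; exact: cvg_cst. Qed.
Lemma cont01_id : cont01 id. Proof. by move=> t _; exact: cvg_id. Qed.
Lemma cont01D a b : cont01 a -> cont01 b -> cont01 (fun t => a t + b t).
Proof. by move=> ca cb t t01; apply: cvgD; [exact: ca|exact: cb]. Qed.
Lemma cont01M a b : cont01 a -> cont01 b -> cont01 (fun t => a t * b t).
Proof. by move=> ca cb t t01; apply: cvgM; [exact: ca|exact: cb]. Qed.

Lemma int01_cst (k : R) : int01 (fun=> k) = k.
Proof.
by rewrite /int01 Rintegral_cst//= lebesgue_measure_itv/= lte_fin ltr01 -EFinB /= subr0 mulr1.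
Qed.

Lemma int01_le a (k : R) : cont01 a -> (forall t, 0 <= t <= 1 -> `|a t| <= k) -> `|int01 a| <= k.
Proof.
move=> ca ak; apply: le_trans (le_normr_Rintegral _ (cont01_integrable ca)) _ => //.
have cn : cont01 (fun t => `|a t|).
  by move=> t t01; apply: (@continuous_comp _ _ _ a Num.norm); [exact: ca|exact: norm_continuous].
rewrite -[leRHS]int01_cst; apply: le_Rintegral => //.
- exact: (cont01_integrable cn).
- by apply: (@cont01_integrable (fun=> k)); exact: cont01_cst.
Qed.

Lemma int01_FTC a (A : R -> R) : cont01 a -> (forall t : R, 0 <= t <= 1 -> is_derive t 1 A (a t)) ->
  int01 a = A 1 - A 0.
Proof.
move=> ca dA; rewrite /int01 /Rintegral (@continuous_FTC2 R a A 0 1)//.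
- apply: continuous_in_subspaceT => t; rewrite inE /= in_itv /= => t01; exact: ca.
- have cA t : 0 <= t <= 1 -> {for t, continuous A}.
    by move=> t01; apply/differentiable_continuous/derivable1_diffP; case: (dA t t01).
  split.
  + by move=> t; rewrite in_itv /= => /andP[? ?]; case: (dA t _) => //; rewrite !ltW.
  + by apply: cvg_at_right_filter; apply: cA; rewrite lexx ler01.
  + by apply: cvg_at_left_filter; apply: cA; rewrite lexx ler01.
- move=> t; rewrite in_itv /= => /andP[? ?]; rewrite derive1E.
  by case: (dA t _) => //; rewrite !ltW.
Qed.

End Integral01.

Section ParametricIntegral.
Context {R : realType} {W Z : normedModType R} {fW : findim W} {fZ : findim Z}.
Variable D : set (W * Z).
Hypothesis oD : open D.
Hypothesis starD : forall x (t : R), D x -> 0 <= t <= 1 -> D (x.1, t *: x.2).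

(** The weight [c] collects the powers of [t] created by differentiating in the second variable, so
    that this family of integrals is closed under differentiation. *)
Definition par_int (c : R -> R) (g : W * Z -> R) (x : W * Z) : R :=
  int01 (fun t => c t * g (x.1, t *: x.2)).

Lemma smooth_at_scale2 (x : W * Z) (t : R) : smooth_at t (fun t : R => (x.1, t *: x.2)).
Proof.
apply: smooth_at_pair; first exact: smooth_at_cst.
by apply: smooth_at_scale; [exact: smooth_at_id|exact: smooth_at_cst].
Qed.

Lemma cont01_line (g : W * Z -> R) x : (forall y, D y -> smooth_at y g) -> D x ->
  cont01 (fun t => g (x.1, t *: x.2)).
Proof.
move=> sg Dx t t01; apply: smooth_at_continuous.
by apply: (@smooth_at_comp R R (W * Z)%type R t (fun t : R => (x.1, t *: x.2)) g);
  [exact: smooth_at_scale2|exact/sg/starD].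
Qed.

Lemma norm_scale2 (h : W * Z) (t : R) : 0 <= t <= 1 -> `|(h.1, t *: h.2)| <= `|h|.
Proof.
move=> /andP[t0 t1]; rewrite !prod_normE /= ge_max !le_max lexx /= normrZ (ger0_norm t0).
by rewrite (ler_piMl _ t1)// orbT.
Qed.

(** Strict differentiability at the point with parameter [t0] controls all [t] near [t0], and
    compactness of [0, 1] makes the neighbourhood of [h = 0] independent of [t]. *)
Lemma uniform_diff (g : W * Z -> R) x e : (forall y, D y -> smooth_at y g) -> D x -> 0 < e ->
  \forall h \near (0 : W * Z), forall t : R, 0 <= t <= 1 ->
   `|g ((h + x).1, t *: (h + x).2) - g (x.1, t *: x.2) - 'd g (x.1, t *: x.2) (h.1, t *: h.2)| <= e * `|h|.
Proof.
move=> sg Dx e0.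
have /compact_near_coveringP/(_ _ (nbhs (0 : W * Z))) := @segment_compact R 0 1.
move=> /(_ (fun h t => 0 <= t <= 1 -> `|g ((h + x).1, t *: (h + x).2) - g (x.1, t *: x.2)
   - 'd g (x.1, t *: x.2) (h.1, t *: h.2)| <= e * `|h|) _) H.
apply: (filterS _ (H _)) => [h K t t01|t0 /=]; first by apply: K => //=; rewrite in_itv.
rewrite in_itv /= => t001.
pose y0 := (x.1, t0 *: x.2).
have Dy0 : D y0 by exact: starD.
have sy0 := sg _ Dy0.
have dL : continuous ('d g y0) by exact/diff_continuous/smooth_at_differentiable.
(* Subtracting the differential at [y0] makes the derivative vanish there, so [G] is Lipschitz near
   [y0] with a small constant. *)
pose G y := g y - 'd g y0 y.
have sG : smooth_at y0 G by apply: smooth_atB => //; exact: smooth_at_linear.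
have DG y v : smooth_at y g -> 'D_v G y = 'd g y v - 'd g y0 v.
  move=> sy; have dy := smooth_at_differentiable sy.
  rewrite deriveB; last 2 first.
    exact: diff_derivable.
    exact/diff_derivable/linear_differentiable.
  by rewrite derive_linear deriveE.
have e20 : 0 < e / 2 by rewrite divr_gt0.
have [r r0 Hr] : exists2 r, 0 < r & forall y y', `|y - y0| < r -> `|y' - y0| < r ->
    `|G y - G y'| <= e / 2 * `|y - y'|.
  pose G1 y : 'rV[R]_1 := const_mx (G y).
  have [||r r0 Hr] := @strict_derive_small R (W * Z)%type 1 1 G1 y0 _ _ _ _ e20.
  - apply: smooth_at_mx => i j; apply: eq_smooth_at sG; near=> y; by rewrite mxE.
  - move=> v; apply/matrixP => i j; rewrite derive_mx; last first.
      apply: diff_derivable; apply: smooth_at_differentiable.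
      by apply: smooth_at_mx => k l; apply: eq_smooth_at sG; near=> y; rewrite mxE.
    rewrite !mxE (_ : (fun _ => _) = G); last by apply/funext => y; rewrite mxE.
    by rewrite DG// subrr.
  exists r => // y y' yr yr'; have [_] := Hr y y' yr yr'.
  by apply: le_trans; have := mx_norm_entry (G1 y - G1 y') 0 0; rewrite !mxE.
have /nbhs_ballP[r' /= r'0 Hr'] : \forall y \near y0, smooth_at y g /\ forall v, `|'D_v G y| <= e / 2 * `|v|.
  have DG0 v : 'D_v G y0 = 0 by rewrite DG// subrr.
  exact: (near_and (smooth_at_near sy0) (derive_small _ sG DG0 e20)).
have r''0 : 0 < Num.min r r' by rewrite lt_min r0 r'0.
have ct : \forall t \near t0, `|(x.1, t *: x.2) - y0| < Num.min r r' / 2.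
  have := smooth_at_continuous (@smooth_at_scale2 x t0).
  move=> /cvgrPdist_lt/(_ _ (divr_gt0 r''0 (ltr0Sn R 1))).
  by apply: filterS => t; rewrite distrC.
have ch : \forall h \near (0 : W * Z), `|h| < Num.min r r' / 2.
  by apply: nbhs0_lt; rewrite divr_gt0.
exists ([set t | `|(x.1, t *: x.2) - y0| < Num.min r r' / 2], [set h | `|h| < Num.min r r' / 2]).
  by split.
move=> [t h] [/= y'r hr] t01 /=.
set y' := (x.1, t *: x.2); set k := (h.1, t *: h.2).
have -> : ((h + x).1, t *: (h + x).2) = k + y' by congr (_, _); rewrite /= scalerDr.
have kh : `|k| <= `|h| by exact: norm_scale2.
have [rr rr'] : Num.min r r' <= r /\ Num.min r r' <= r' by rewrite !ge_min !lexx orbT.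
have y'r1 : `|y' - y0| < r by lra.
have ky'r : `|k + y' - y0| < r.
  by rewrite -addrA; apply: le_lt_trans (ler_normD _ _) _; lra.
have [sy' Dy'] : smooth_at y' g /\ forall v, `|'D_v G y'| <= e / 2 * `|v|.
  by apply: Hr'; rewrite -ball_normE /ball_ /= distrC; lra.
have A := Hr _ _ ky'r y'r1; rewrite addrK in A.
have B := Dy' k; rewrite DG// in B.
have -> : g (k + y') - g y' - 'd g y' k = (G (k + y') - G y') - ('d g y' k - 'd g y0 k).
  exact: sub_defect (linearD _ _ _).
apply: le_trans (ler_normB _ _) _.
have : e / 2 * `|k| <= e / 2 * `|h| by rewrite ler_wpM2l// ltW.
lra.
Unshelve. all: by end_near. Qed.

Lemma cont01_derive (g : W * Z -> R) x v : (forall y, D y -> smooth_at y g) -> D x ->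
  cont01 (fun t => 'D_v g (x.1, t *: x.2)).
Proof. by move=> sg; apply: (@cont01_line ('D_v g)) => y Dy; exact/smooth_at_derive/sg. Qed.

Lemma par_intD c g1 g2 x : cont01 c -> (forall y, D y -> smooth_at y g1) ->
  (forall y, D y -> smooth_at y g2) -> D x ->
  par_int c (fun y => g1 y + g2 y) x = par_int c g1 x + par_int c g2 x.
Proof.
move=> cc s1 s2 Dx; rewrite -int01D; [|by apply: cont01M => //; exact: cont01_line..].
by apply: eq_int01 => t _; rewrite mulrDr.
Qed.

Lemma par_intZ c (a : R) (g : W * Z -> R) x : cont01 c -> (forall y, D y -> smooth_at y g) -> D x ->
  par_int c (fun y => a * g y) x = a * par_int c g x.
Proof.
move=> cc s1 Dx; rewrite -int01Z; last by apply: cont01M => //; exact: cont01_line.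
by apply: eq_int01 => t _; rewrite mulrCA.
Qed.

Lemma eq_par_int c g1 g2 x : (forall y, D y -> g1 y = g2 y) -> D x ->
  par_int c g1 x = par_int c g2 x.
Proof. by move=> g12 Dx; apply: eq_int01 => t t01; rewrite g12//; exact: starD. Qed.

Let dpar c g x (v : W * Z) : R :=
  par_int c ('D_(v.1, 0) g) x + par_int (fun t => c t * t) ('D_(0, v.2) g) x.

(** Differentiation under the integral sign. A weight bounded by 1 lets the estimate uniform in [t]
    integrate to the same bound, and the new weight [c t * t] obeys this bound again. *)
Lemma par_int_diff c g x : cont01 c -> (forall t, 0 <= t <= 1 -> `|c t| <= 1) ->
  (forall y, D y -> smooth_at y g) -> D x ->
  differentiable (par_int c g) x /\ forall v, 'D_v (par_int c g) x = dpar c g x v.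
Proof.
move=> cc c1 sg Dx.
have ct : cont01 (fun t => c t * t) by apply: cont01M => //; exact: cont01_id.
have lin : linear (dpar c g x : W * Z -> R^o).
  move=> a u v; have dD y : D y -> differentiable g y by move=> /sg/smooth_at_differentiable.
  have sd w y : D y -> smooth_at y ('D_w g) by move=> Dy; exact/smooth_at_derive/sg.
  have sda w y : D y -> smooth_at y (fun y => a * 'D_w g y).
    by move=> Dy; apply: smooth_atM; [exact: smooth_at_cst|exact: sd].
  rewrite /dpar (@eq_par_int c _ (fun y => a * 'D_(u.1, 0) g y + 'D_(v.1, 0) g y))//; last first.
    move=> y /dD dy; rewrite !deriveE// -[a * _]/(a *: _) -linearZ -linearD.
    by congr ('d g _ _); congr (_, _); rewrite /= scaler0 addr0.
  rewrite (@eq_par_int _ ('D_(0, _) _) (fun y => a * 'D_(0, u.2) g y + 'D_(0, v.2) g y))//; last first.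
    move=> y /dD dy; rewrite !deriveE// -[a * _]/(a *: _) -linearZ -linearD.
    by congr ('d g _ _); congr (_, _); rewrite /= scaler0 addr0.
  rewrite !par_intD//; [|exact: sda|exact: sd|exact: sda|exact: sd].
  rewrite !par_intZ//; [|exact: sd|exact: sd].
  exact: scaleD4.
pose L : {linear (W * Z)%type -> R} := HB.pack (dpar c g x : W * Z -> R^o)
  (GRing.isLinear.Build _ _ _ _ _ lin).
have Lc : continuous L by exact: findim_linear_continuous.
suff [d e] : differentiable (par_int c g) x /\ 'd (par_int c g) x = L :> (W * Z -> R).
  by split=> // v; rewrite deriveE// e.
apply: diff_epsP => // e e0.
have Hu := uniform_diff sg Dx e0.
have Dn := near_addr (open_nbhs_nbhs (conj oD Dx)).
move: Hu Dn; apply: filterS2 => h Hu Dhx.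
have cd1 : cont01 (fun t => c t * 'D_(h.1, 0) g (x.1, t *: x.2)).
  by apply: cont01M => //; exact: cont01_derive.
have cd2 : cont01 (fun t => c t * t * 'D_(0, h.2) g (x.1, t *: x.2)).
  by apply: cont01M => //; exact: cont01_derive.
have cg y : D y -> cont01 (fun t => c t * g (y.1, t *: y.2)).
  by move=> Dy; apply: cont01M => //; exact: cont01_line.
have cN (a : R -> R) : cont01 a -> cont01 (fun t => -1 * a t).
  by move=> ca; apply: cont01M => //; exact: cont01_cst.
have cs := cont01D (cg _ Dhx) (cN _ (cg _ Dx)); have cs' := cN _ (cont01D cd1 cd2).
have -> : par_int c g (h + x) - par_int c g x - L h =
  int01 (fun t => c t * g ((h + x).1, t *: (h + x).2) + (-1) * (c t * g (x.1, t *: x.2)) +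
   (-1) * (c t * 'D_(h.1, 0) g (x.1, t *: x.2) + c t * t * 'D_(0, h.2) g (x.1, t *: x.2))).
  rewrite int01D// int01D; [|exact: cg|exact/cN/cg].
  by rewrite !int01Z ?int01D ?mulN1r//; [exact: cont01D|exact: cg].
apply: int01_le; first exact: cont01D.
move=> t t01.
have dg : differentiable g (x.1, t *: x.2) by exact/smooth_at_differentiable/sg/starD.
have -> : c t * g ((h + x).1, t *: (h + x).2) + -1 * (c t * g (x.1, t *: x.2)) +
   (-1) * (c t * 'D_(h.1, 0) g (x.1, t *: x.2) + c t * t * 'D_(0, h.2) g (x.1, t *: x.2)) =
   c t * (g ((h + x).1, t *: (h + x).2) - g (x.1, t *: x.2) - 'd g (x.1, t *: x.2) (h.1, t *: h.2)).
  have -> : (h.1, t *: h.2) = (h.1, 0) + t *: (0, h.2) :> W * Z.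
    by congr (_, _); rewrite /= ?scaler0 ?addr0 ?add0r.
  have E := linearD ('d g (x.1, t *: x.2)) (h.1, 0) (t *: (0, h.2)).
  have E2 : 'd g (x.1, t *: x.2) (t *: (0, h.2)) = t *: 'd g (x.1, t *: x.2) (0, h.2).
    exact: linearZZ.
  by apply: int_defect; rewrite !deriveE// -E2; exact: E.
rewrite normrM; have := Hu t t01; have := c1 t t01 => ct1 Ht.
by rewrite -[leRHS]mul1r; apply: ler_pM.
Qed.

Lemma par_int_Ck k c g : cont01 c -> (forall t, 0 <= t <= 1 -> `|c t| <= 1) ->
  (forall y, D y -> smooth_at y g) -> Ck k D (par_int c g).
Proof.
elim: k c g => [|k IH] c g cc c1 sg.
  by move=> x Dx; apply: differentiable_continuous; case: (par_int_diff cc c1 sg Dx).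
split=> [x Dx|v]; first by case: (par_int_diff cc c1 sg Dx).
apply: (@eq_Ck _ _ _ _ _ (fun x => dpar c g x v)) => //.
  by move=> x Dx; case: (par_int_diff cc c1 sg Dx).
apply: CkD => //; apply: IH => //.
- by move=> y Dy; exact/smooth_at_derive/sg.
- by apply: cont01M => //; exact: cont01_id.
- move=> t /[dup] t01 /andP[t0 t1]; rewrite normrM (ger0_norm t0).
  by apply: mulr_ile1 => //; exact: c1.
- by move=> y Dy; exact/smooth_at_derive/sg.
Qed.

Lemma taylor_integral (f : W * Z -> R) x : (forall y, D y -> smooth_at y f) -> D x ->
  f x = f (x.1, 0) + 'D_(0, x.2) f (x.1, 0) +
    par_int (fun t => 1 - t) ('D_(0, x.2) ('D_(0, x.2) f)) x.
Proof.
move=> sf Dx; set v := (0, x.2).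
(* An antiderivative of the remainder integrand: when [A] is differentiated, the two first order
   terms cancel. *)
pose A t : R := (1 - t) * 'D_v f (x.1, t *: x.2) + f (x.1, t *: x.2).
have sdf y : D y -> smooth_at y ('D_v f) by move=> Dy; exact/smooth_at_derive/sf.
have xE t : (x.1, t *: x.2) = (x.1, 0) + t *: v.
  by congr (_, _); rewrite /= ?scaler0 ?addr0 ?add0r.
have FTC := @int01_FTC R (fun t => (1 - t) * 'D_v ('D_v f) (x.1, t *: x.2)) A.
have C1 : cont01 (fun t => (1 - t) * 'D_v ('D_v f) (x.1, t *: x.2)).
  apply: cont01M; last exact: cont01_derive.
  apply: cont01D; first exact: cont01_cst.
  by move=> t _; apply: cvgN; exact: cvg_id.
suff dA (t : R) : 0 <= t <= 1 -> is_derive t 1 A ((1 - t) * 'D_v ('D_v f) (x.1, t *: x.2)).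
  have E := FTC C1 dA; rewrite /par_int E.
  by rewrite /A scale1r scale0r !subrr mul0r add0r subr0 mul1r -surjective_pairing; ring.
move=> t01.
have Dt : D (x.1, t *: x.2) by exact: starD.
have d1 : is_derive t 1 (fun t : R => 'D_v f (x.1, t *: x.2)) ('D_v ('D_v f) (x.1, t *: x.2)).
  have := @is_derive_line R _ _ ('D_v f) (x.1, 0) v t; rewrite -xE => /(_ (smooth_at_differentiable (sdf _ Dt))).
  by rewrite (_ : (fun s : R => _) = (fun t : R => 'D_v f (x.1, t *: x.2)))//; apply/funext => s; rewrite xE.
have d2 : is_derive t 1 (fun t : R => f (x.1, t *: x.2)) ('D_v f (x.1, t *: x.2)).
  have := @is_derive_line R _ _ f (x.1, 0) v t; rewrite -xE => /(_ (smooth_at_differentiable (sf _ Dt))).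
  by rewrite (_ : (fun s : R => _) = (fun t : R => f (x.1, t *: x.2)))//; apply/funext => s; rewrite xE.
have d3 : is_derive t 1 (fun t : R => 1 - t) (-1).
  have d : is_derive t 1 (cst 1 - id : R -> R) (0 - 1) by exact: is_deriveB.
  by rewrite sub0r in d.
apply: is_derive_eq.
by rewrite /GRing.scale /=; ring.
Qed.

End ParametricIntegral.

Lemma smooth_at_near_comp (R : realType) (U V : normedModType R) (f : U -> V) p (P : V -> Prop) :
  smooth_at p f -> (\forall y \near f p, P y) -> \forall x \near p, P (f x).
Proof. by move=> /smooth_at_continuous fc; apply: fc. Qed.

Section Taylor.
Context {R : realType} {W : normedModType R} {fW : findim W} {n : nat}.
Local Notation Z := 'rV[R]_n.
Implicit Types f g : W * Z -> R.

Definition dz (j : 'I_n) f : W * Z -> R := 'D_(0, delta_mx 0 j) f.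
Definition hessz f x : 'M[R]_n := \matrix_(j, k) dz j (dz k f) x.

Lemma derive_z_sum f x (z : Z) : differentiable f x ->
  'D_(0, z) f x = \sum_j z 0 j * dz j f x.
Proof.
move=> df; rewrite deriveE//.
have -> : (0, z) = \sum_j z 0 j *: ((0, delta_mx 0 j) : W * Z).
  rewrite {1}(row_sum_delta z).
  elim/big_rec2 : _ => // j y1 y2 _ <-; congr (_, _) => /=.
  by rewrite scaler0 add0r.
rewrite linear_sum; apply: eq_bigr => j _.
by rewrite /dz deriveE//; exact: linearZZ.
Qed.

Variable D : set (W * Z).
Hypothesis oD : open D.
Hypothesis starD : forall x (t : R), D x -> 0 <= t <= 1 -> D (x.1, t *: x.2).

Lemma par_int_sum c I (r : seq I) (F : I -> W * Z -> R) x : cont01 c ->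
  (forall i y, D y -> smooth_at y (F i)) -> D x ->
  par_int c (fun y => \sum_(i <- r) F i y) x = \sum_(i <- r) par_int c (F i) x.
Proof.
move=> cc sF Dx; elim: r => [|i r IH].
  transitivity (int01 (fun=> 0 : R)); last by rewrite int01_cst big_nil.
  by apply: eq_int01 => t _; rewrite big_nil mulr0.
rewrite big_cons -IH -(par_intD starD)//; last first.
- by move=> y Dy; apply: smooth_at_sum => j; exact: sF.
- exact: sF.
by apply: (eq_par_int starD) => // y _; rewrite big_cons.
Qed.

Lemma cont01_onem : cont01 (fun t : R => 1 - t).
Proof. by move=> t _; apply: cvgB; [exact: cvg_cst|exact: cvg_id]. Qed.

Lemma int01_onem : int01 (fun t : R => 1 - t) = 2^-1.
Proof.
pose A (t : R) := t - 2^-1 * (t * t).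
suff dA (t : R) : 0 <= t <= 1 -> is_derive t 1 A (1 - t).
  by rewrite (_ : int01 _ = A 1 - A 0); [rewrite /A; field|exact: (int01_FTC cont01_onem dA)].
move=> _.
have d : is_derive t 1 (id - 2^-1 \*: (id * id) : R -> R) (1 - 2^-1 *: (t *: 1 + t *: 1)).
  by apply: is_deriveB.
by apply: is_derive_eq; rewrite /GRing.scale /=; field.
Qed.

Definition taylor_hess f x : 'M[R]_n :=
  \matrix_(j, k) par_int (fun t => 1 - t) (dz j (dz k f)) x.

Lemma taylor_hessE f x j k : taylor_hess f x j k = par_int (fun t => 1 - t) (dz j (dz k f)) x.
Proof. by rewrite mxE. Qed.

(** The integral remainder is expanded into a quadratic form whose matrix is smooth in the point, as
    the Morse lemma requires. The factor 1/2 on the zero section is the integral of [1 - t]. *)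
Lemma taylor2 f x : (forall y, D y -> smooth_at y f) -> D x ->
  [/\ smooth_at x (taylor_hess f), (taylor_hess f x)^T = taylor_hess f x,
   taylor_hess f (x.1, 0) = 2^-1 *: hessz f (x.1, 0) &
   f x = f (x.1, 0) + 'D_(0, x.2) f (x.1, 0) + (x.2 *m taylor_hess f x *m x.2^T) 0 0].
Proof.
move=> sf Dx.
have sdf y v : D y -> smooth_at y ('D_v f) by move=> Dy; exact/smooth_at_derive/sf.
have sddf y v w : D y -> smooth_at y ('D_w ('D_v f)) by move=> Dy; exact/smooth_at_derive/sdf.
have Dx0 : D (x.1, 0) by have := starD Dx (t := 0); rewrite scale0r lexx ler01; exact.
split.
- apply: smooth_at_mx => j k.
  apply: (@eq_smooth_at _ _ _ _ (par_int (fun t => 1 - t) (dz j (dz k f)))).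
    by near=> y; rewrite taylor_hessE.
  exists D; split=> // i; apply: par_int_Ck => //; first exact: cont01_onem.
    by move=> t /andP[t0 t1]; rewrite ger0_norm ?subr_ge0// gerBl.
  by move=> y Dy; exact: sddf.
- have E j k : par_int (fun t => 1 - t) (dz j (dz k f)) x =
      par_int (fun t => 1 - t) (dz k (dz j f)) x.
    apply: eq_int01 => t t01.
    exact: (congr1 (fun z : R => (1 - t) * z) (derive_symmetric _ _ (sf _ (starD Dx t01)))).
  by apply/matrixP => j k; rewrite mxE !taylor_hessE; exact: E.
- apply/matrixP => j k; rewrite taylor_hessE 2!mxE mulrC.
  rewrite -int01_onem -(int01Z _ cont01_onem).
  by apply: eq_int01 => t _; rewrite /= scaler0 mulrC.
- rewrite {1}(taylor_integral starD sf Dx); congr (_ + _).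
  pose F j k y := x.2 0 k * (x.2 0 j * dz k (dz j f) y).
  have sF j k y : D y -> smooth_at y (F j k).
    move=> Dy; apply: smooth_atM; first exact: smooth_at_cst.
    by apply: smooth_atM; [exact: smooth_at_cst|exact: sddf].
  transitivity (par_int (fun t => 1 - t) (fun y => \sum_j \sum_k F j k y) x).
    apply: (eq_par_int starD) => // y Dy.
    rewrite derive_z_sum; last exact/smooth_at_differentiable/sdf.
    rewrite exchange_big /=; apply: eq_bigr => k _.
    rewrite /F -mulr_sumr; congr (_ * _).
    rewrite {1}/dz (@near_eq_derive _ _ _ _ (fun y => \sum_j x.2 0 j * dz j f y)); last first.
      move/open_nbhs_nbhs: (conj oD Dy); apply: filterS => z Dz.
      by rewrite derive_z_sum//; exact/smooth_at_differentiable/sf.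
    have dd j : differentiable (fun y => x.2 0 j * dz j f y) y.
      apply: smooth_at_differentiable; apply: smooth_atM; first exact: smooth_at_cst.
      exact: sdf.
    rewrite (_ : (fun y => _) = \sum_j (fun y => x.2 0 j * dz j f y)); last first.
      by apply/funext => z; rewrite fct_sumE.
    rewrite derive_sum; last by move=> j; exact: diff_derivable.
    apply: eq_bigr => j _.
    rewrite (_ : (fun y => _) = x.2 0 j \*: dz j f)// deriveZ//.
    exact/diff_derivable/smooth_at_differentiable/sdf.
  rewrite par_int_sum//; [|exact: cont01_onem|]; last first.
    by move=> j y Dy; apply: smooth_at_sum => k; exact: sF.
  transitivity (\sum_j \sum_k x.2 0 k * (x.2 0 j * taylor_hess f x k j)).
    apply: eq_bigr => j _; rewrite par_int_sum//; [|exact: cont01_onem|by move=> k y; exact: sF].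
    apply: eq_bigr => k _; rewrite /F.
    rewrite (par_intZ starD)//; [|exact: cont01_onem|]; last first.
      by move=> y Dy; apply: smooth_atM; [exact: smooth_at_cst|exact: sddf].
    rewrite (par_intZ starD)//; [|exact: cont01_onem|by move=> y Dy; exact: sddf].
    by rewrite taylor_hessE.
  rewrite !mxE; apply: eq_bigr => j _; rewrite !mxE mulr_suml.
  by apply: eq_bigr => k _; rewrite mulrA mulrAC.
Unshelve. all: by end_near. Qed.

End Taylor.

(** * Square roots of symmetric matrices and the implicit function theorem *)

Section MatrixSqrt.
Context {R : realType} {n : nat}.
Implicit Types M H S : 'M[R]_n.

Lemma smooth_at_trmx (U : normedModType R) m q (p : U) (f : U -> 'M[R]_(m, q)) :
  smooth_at p f -> smooth_at p (fun x => (f x)^T).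
Proof.
move=> sf; apply: smooth_at_mx => i j.
apply: (@eq_smooth_at _ _ _ _ (fun x => f x j i)); first by near=> x; rewrite mxE.
exact: smooth_at_coord.
Unshelve. all: by end_near. Qed.

Lemma derive_mulmx (U : normedModType R) m q r (f : U -> 'M[R]_(m, q)) (g : U -> 'M[R]_(q, r)) x v :
  differentiable f x -> differentiable g x ->
  'D_v (fun y => f y *m g y) x = 'D_v f x *m g x + f x *m 'D_v g x.
Proof.
move=> df dg.
have dfi i j : derivable (fun y => f y i j) x v by exact/diff_derivable/differentiable_entry.
have dgi i j : derivable (fun y => g y i j) x v by exact/diff_derivable/differentiable_entry.
have dk i j (k : 'I_q) : derivable (fun y => f y i k * g y k j) x v.
  exact: (derivableM (dfi i k) (dgi k j)).
have E i j : (fun y => (f y *m g y) i j) = \sum_k (fun y => f y i k * g y k j).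
  by apply/funext => y; rewrite mxE fct_sumE.
rewrite derive_mx; last first.
  by apply/derivable_mxP => i j; rewrite E; exact: derivable_sum.
apply/matrixP => i j; rewrite !mxE E derive_sum// -big_split /=.
apply: eq_bigr => k _.
rewrite (@deriveM _ _ (fun y => f y i k) (fun y => g y k j))//.
by rewrite !derive_entry// addrC; congr (_ + _); rewrite mulrC.
Qed.

(* [sq H] solves [S M^-1 S = H]; this reduces the matrix square root near an arbitrary
   nondegenerate symmetric [M] to the inverse function theorem, the derivative at
   [S = M] being multiplication by 2. *)
Lemma matrix_sqrt M : M \in unitmx -> M^T = M ->
  exists sq : 'M[R]_n -> 'M[R]_n, [/\ smooth_at M sq, sq M = M &
    \forall H \near M, H^T = H -> (sq H)^T = sq H /\ sq H *m invmx M *m sq H = H].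
Proof.
move=> uM sM.
pose Phi S := S *m invmx M *m S.
have PM : Phi M = M by rewrite /Phi mulmxV// mul1mx.
have sPhi S : smooth_at S Phi.
  apply: smooth_at_mulmx; last exact: smooth_at_id.
  by apply: smooth_at_mulmx; [exact: smooth_at_id|exact: smooth_at_cst].
have DPhi v : 'D_v Phi M = v + v.
  rewrite derive_mulmx//; last first.
    apply: smooth_at_differentiable.
    by apply: smooth_at_mulmx; [exact: smooth_at_id|exact: smooth_at_cst].
  rewrite derive_mulmx// derive_id derive_cst mulmx0 addr0.
  by rewrite mulmxV// mul1mx -mulmxA mulVmx// mulmx1.
have [|g [_ _ sg gP Pg]] := @inverse_function_iso R 'M[R]_n (n * n) mxvec vec_mx Phi M _ mxvecK vec_mxK (sPhi M).
  move=> v; rewrite DPhi -mulr2n => /eqP; rewrite -scaler_nat scaler_eq0 pnatr_eq0 /= => /eqP//.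
rewrite PM in sg Pg.
have gM : g M = M by rewrite -{1}PM; exact: nbhs_singleton gP.
exists g; split=> //.
(* [Phi] commutes with transposition, so for symmetric [H] the transpose of [g H] is another
   solution; local injectivity of [Phi] identifies the two and makes [g H] symmetric. *)
have gT : \forall H \near M, g (Phi (g H)^T) = (g H)^T.
  apply: (smooth_at_near_comp (P := fun S => g (Phi S) = S) (smooth_at_trmx sg)).
  by rewrite gM sM.
move: gT Pg; apply: filterS2 => H gT Pg HT; split=> //.
rewrite -gT; congr (g _).
have -> : Phi (g H)^T = (Phi (g H))^T.
  by rewrite /Phi !trmx_mul trmx_inv sM mulmxA.
by rewrite Pg HT.
Qed.

End MatrixSqrt.

Section ImplicitFunction.
Context {R : realType} {m n : nat}.
Local Notation W := 'rV[R]_m.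
Local Notation Z := 'rV[R]_n.

Definition row_pair (x : W * Z) : 'rV[R]_(m + n) := row_mx x.1 x.2.
Definition unrow_pair (v : 'rV[R]_(m + n)) : W * Z := (lsubmx v, rsubmx v).

Lemma row_pair_linear : linear row_pair.
Proof. by move=> a u v; rewrite /row_pair /= scale_row_mx add_row_mx. Qed.
Lemma unrow_pair_linear : linear unrow_pair.
Proof. by move=> a u v; rewrite /unrow_pair !linearP. Qed.
Lemma row_pairK : cancel row_pair unrow_pair.
Proof. by move=> [x z]; rewrite /unrow_pair /row_pair row_mxKl row_mxKr. Qed.
Lemma unrow_pairK : cancel unrow_pair row_pair.
Proof. by move=> v; rewrite /row_pair hsubmxK. Qed.

Lemma inverse_function_pair (G : W * Z -> W * Z) p : smooth_at p G ->
  (forall v, 'D_v G p = 0 -> v = 0) -> exists g, local_diffeo p (G p) G g.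
Proof.
pose c : {linear (W * Z)%type -> 'rV[R]_(m + n)} := HB.pack row_pair
  (GRing.isLinear.Build _ _ _ _ _ row_pair_linear).
pose c' : {linear 'rV[R]_(m + n) -> (W * Z)%type} := HB.pack unrow_pair
  (GRing.isLinear.Build _ _ _ _ _ unrow_pair_linear).
exact: (@inverse_function_iso R _ _ c c' G p _ row_pairK unrow_pairK).
Qed.

Lemma derive_pair (U V1 V2 : normedModType R) (f : U -> V1) (g : U -> V2) x v :
  differentiable f x -> differentiable g x ->
  'D_v (fun y => (f y, g y)) x = ('D_v f x, 'D_v g x).
Proof.
move=> df dg; rewrite !deriveE//; last exact: differentiable_pair.
by have E := diff_pair df dg; rewrite E.
Qed.

Lemma derive_fst (U V1 V2 : normedModType R) (f : U -> V1 * V2) x v : differentiable f x ->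
  'D_v (fun y => (f y).1) x = ('D_v f x).1.
Proof.
move=> df; have dfst (y : V1 * V2) : differentiable (fst : V1 * V2 -> V1) y.
  by apply: linear_differentiable; exact: fst_continuous.
rewrite (@derive_comp _ _ _ _ f fst)// deriveE// diff_lin//; exact: fst_continuous.
Qed.

(** The derivative of [(q.1, F q)] is block triangular, so its injectivity only has to be tested in
    the fibre directions. *)
Lemma fibred_diffeo (F : W * Z -> Z) p : smooth_at p F ->
  (forall v, 'D_(0, v) F p = 0 -> v = 0) ->
  exists g, local_diffeo p (p.1, F p) (fun q => (q.1, F q)) g.
Proof.
move=> sF inj.
have s1 : smooth_at p (fst : W * Z -> W).
  by apply: smooth_at_fst; exact: smooth_at_id.
have sG : smooth_at p (fun q : W * Z => (q.1, F q)) by exact: smooth_at_pair.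
apply: (inverse_function_pair sG) => v.
rewrite derive_pair; [|exact: smooth_at_differentiable..].
rewrite (@derive_fst _ _ _ id) ?derive_id//.
by case: v => v1 v2 /= [-> /inj ->].
Qed.

Lemma implicit_function (F : W * Z -> Z) p : smooth_at p F ->
  (forall v, 'D_(0, v) F p = 0 -> v = 0) ->
  exists zeta : W -> Z, [/\ smooth_at p.1 zeta, zeta p.1 = p.2 &
    \forall x \near p.1, F (x, zeta x) = F p].
Proof.
move=> sF inj; have [g [_ _ sg gP Pg]] := fibred_diffeo sF inj.
have s2 : smooth_at p.1 (fun x : W => (x, F p)).
  by apply: smooth_at_pair; [exact: smooth_at_id|exact: smooth_at_cst].
exists (fun x => (g (x, F p)).2); split.
- by apply: smooth_at_snd; exact: smooth_at_comp.
- by rewrite (nbhs_singleton gP).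
- have := smooth_at_near_comp s2 Pg; apply: filterS => x E.
  have [E1 E2] := E; rewrite -[in RHS]E2; congr F.
  by rewrite -{1}E1 -surjective_pairing.
Qed.

End ImplicitFunction.

(** * Morse lemma with parameters *)

(** A directional derivative only sees the values along one line. This transports derivatives
    between functions on different spaces without a chain rule. *)
Lemma derive_line_eq (R : realType) (U1 U2 V : normedModType R) (F : U1 -> V) (G : U2 -> V)
    q q' v v' : (\forall h \near (0 : R), F (h *: v + q) = G (h *: v' + q')) ->
  'D_v F q = 'D_v' G q'.
Proof.
move=> FG; have := nbhs_singleton FG; rewrite !scale0r !add0r => FG0.
rewrite /derive; congr (lim _).
(* No derivability is assumed: the difference quotients agree near 0, so they have the same image
   filters and hence the same [lim], convergent or not. *)
have E : \forall h \near (0 : R), h^-1 *: ((F \o shift q) (h *: v) - F q) =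
    h^-1 *: ((G \o shift q') (h *: v') - G q').
  by apply: filterS FG => h /=; rewrite FG0 => ->.
rewrite eqEsubset; split; apply/near_eq_cvg/cvg_within => //.
by apply: filterS E => h ->.
Qed.

Section Morse.
Context {R : realType} {m n : nat}.
Local Notation W := 'rV[R]_m.
Local Notation Z := 'rV[R]_n.
Implicit Types f : W * Z -> R.

Definition gradz f x : Z := \row_j dz j f x.

Lemma smooth_at_dz f p j : smooth_at p f -> smooth_at p (dz j f).
Proof. exact: smooth_at_derive. Qed.

Lemma smooth_at_gradz f p : smooth_at p f -> smooth_at p (gradz f).
Proof.
move=> sf; apply: smooth_at_mx => i j; apply: eq_smooth_at (smooth_at_dz j sf).
by near=> x; rewrite mxE.
Unshelve. all: by end_near. Qed.

Lemma derive_row k (U : normedModType R) (F : 'I_k -> U -> R) x v :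
  (forall j, differentiable (F j) x) ->
  'D_v (fun y => \row_j F j y) x = \row_j 'D_v (F j) x.
Proof.
move=> dF; rewrite derive_mx; last first.
  apply/derivable_mxP => i j; rewrite (_ : (fun _ => _) = F j); first exact: diff_derivable.
  by apply/funext => y; rewrite mxE.
apply/rowP => j; rewrite !mxE; congr ('D_v _ x).
by apply/funext => y; rewrite mxE.
Qed.

Lemma derive_gradz f p v : smooth_at p f -> 'D_(0, v) (gradz f) p = v *m hessz f p.
Proof.
move=> sf; rewrite derive_row; last by move=> j; exact/smooth_at_differentiable/smooth_at_dz.
apply/rowP => k; rewrite !mxE derive_z_sum; last exact/smooth_at_differentiable/smooth_at_dz.
by apply: eq_bigr => j _; rewrite !mxE.
Qed.

Lemma hessz_sym f p : smooth_at p f -> (hessz f p)^T = hessz f p.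
Proof. by move=> sf; apply/matrixP => j k; rewrite !mxE; exact: derive_symmetric. Qed.

Lemma critical_section f p : smooth_at p f -> gradz f p = 0 -> hessz f p \in unitmx ->
  exists zc : W -> Z, [/\ smooth_at p.1 zc, zc p.1 = p.2 &
    \forall x \near p.1, gradz f (x, zc x) = 0].
Proof.
move=> sf g0 uH; have [v Hv|zc [sz z0 zP]] := implicit_function (smooth_at_gradz sf).
  move: Hv; rewrite derive_gradz// => /(congr1 (mulmx^~ (invmx (hessz f p)))).
  by rewrite mul0mx -mulmxA mulmxV// mulmx1.
by exists zc; split=> //; rewrite -g0.
Qed.

(* Near a fibrewise nondegenerate critical point: shift the critical points to 0, write
   the remainder as z H(x,z) z^T by Taylor, and absorb a square root of H in z. *)
Lemma morse_normal_form f p zc : smooth_at p f -> hessz f p \in unitmx ->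
  smooth_at p.1 zc -> zc p.1 = p.2 -> (\forall x \near p.1, gradz f (x, zc x) = 0) ->
  exists E : W * Z -> Z, [/\ smooth_at p E, E p = 0, (forall v, 'D_(0, v) E p = v) &
    \forall q \near p, f q = f (q.1, zc q.1) + 2^-1 * (E q *m hessz f p *m (E q)^T) 0 0].
Proof.
move=> sf uM sz z0 zP; set M := hessz f p in uM *.
pose sh (q : W * Z) := (q.1, zc q.1 + q.2).
pose ft q := f (sh q).
pose p0 : W * Z := (p.1, 0).
have shp0 : sh p0 = p by rewrite /sh /= addr0 z0 -surjective_pairing.
have s1 q : smooth_at q (fst : W * Z -> W) by apply: smooth_at_fst; exact: smooth_at_id.
have s2 q : smooth_at q (snd : W * Z -> Z) by apply: smooth_at_snd; exact: smooth_at_id.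
have ssh q : smooth_at q.1 zc -> smooth_at q sh.
  move=> szq; apply: smooth_at_pair => //; apply: smooth_atD => //.
  exact: (@smooth_at_comp _ _ _ _ _ fst zc).
have sft : smooth_at p0 ft.
  by apply: (@smooth_at_comp _ _ _ _ _ sh f); [exact: ssh|rewrite shp0].
have [r [r0 Hr]] : exists r : R, 0 < r /\ forall q, ball p0 r q ->
    [/\ smooth_at q ft, smooth_at (sh q) f, smooth_at q.1 zc & gradz f (q.1, zc q.1) = 0].
  have A1 : \forall q \near p0, smooth_at (sh q) f.
    apply: (smooth_at_near_comp (P := fun y => smooth_at y f)); first exact: ssh.
    by rewrite shp0; exact: smooth_at_near.
  have A2 : \forall q \near p0, smooth_at q.1 zc.
    by apply: (smooth_at_near_comp (P := fun y => smooth_at y zc) (s1 p0)); exact: smooth_at_near.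
  have A3 : \forall q \near p0, gradz f (q.1, zc q.1) = 0.
    exact: (smooth_at_near_comp (P := fun y => gradz f (y, zc y) = 0) (s1 p0)).
  have /nbhs_ballP[r /= r0 Hr] := near_and (near_and (smooth_at_near sft) A1) (near_and A2 A3).
  by exists r; split=> // q /Hr[[? ?] [? ?]].
pose D := ball p0 r.
have oD : open D by exact: ball_open.
(* The centre [p0] has second component 0, so shrinking the second component of a point does not
   leave the ball. *)
have starD (x : W * Z) (t : R) : D x -> 0 <= t <= 1 -> D (x.1, t *: x.2).
  rewrite /D -ball_normE /ball_ /= => h t01; apply: le_lt_trans h.
  rewrite -normrN -[leRHS]normrN !opprB.
  have := norm_scale2 (x - p0) t01; congr (`|_| <= _); congr (_, _) => /=.
  by rewrite !subr0.
have sD y : D y -> smooth_at y ft by move=> /Hr[].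
pose Ht := taylor_hess ft.
have shE h v q : sh (h *: (0, v) + q) = h *: (0, v) + sh q.
  rewrite /sh; congr (_, _); rewrite /= scaler0 add0r// [RHS]addrCA.
  by congr (_ + _).
have DE q v : 'D_(0, v) ft q = 'D_(0, v) f (sh q).
  by apply: derive_line_eq; near=> h; rewrite /ft shE.
have dzE j q : dz j ft q = dz j f (sh q) by exact: DE.
have hE q : hessz ft q = hessz f (sh q).
  apply/matrixP => j k; rewrite [LHS]mxE [RHS]mxE; apply: derive_line_eq; near=> h.
  by rewrite dzE shE.
have crit q : D q -> 'D_(0, q.2) ft (q.1, 0) = 0.
  move=> Dq; have [_ _ szq gq] := Hr _ Dq.
  have Dq0 : D (q.1, 0) by have := starD q 0 Dq; rewrite scale0r lexx ler01; exact.
  rewrite derive_z_sum; last exact/smooth_at_differentiable/sD.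
  apply: big1 => j _; rewrite dzE /sh /= addr0.
  by move/rowP: gq => /(_ j); rewrite !mxE => ->; rewrite mulr0.
have Dp0 : D p0 by exact: ballxx.
have Tp q (Dq : D q) := @taylor2 R W (findim_mx 1 m) n D oD starD ft q sD Dq.
(* The factor 2 compensates the 1/2 of Taylor's formula, so that [H p0] is the Hessian [M]
   itself. *)
pose H q := 2 *: Ht q.
have Hp0 : H p0 = M.
  have [_ _ + _] := Tp _ Dp0; rewrite /H /Ht (_ : (p0.1, 0) = p0)// => ->.
  by rewrite scalerA mulfV ?pnatr_eq0// scale1r hE shp0.
have sH : smooth_at p0 H.
  apply: smooth_at_scale; first exact: smooth_at_cst.
  by have [] := Tp _ Dp0.
have [sq [ssq sqM sqP]] := matrix_sqrt uM (hessz_sym sf).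
(* With S = [sq (H q)] one has S M^-1 M M^-1 S = S M^-1 S = [H q]; the factor [invmx M] makes the
   fibre derivative at [p0] the identity. *)
pose E' (q : W * Z) := q.2 *m (sq (H q) *m invmx M).
have sSM : smooth_at p0 (fun q => sq (H q) *m invmx M).
  apply: smooth_at_mulmx; last exact: smooth_at_cst.
  by apply: (@smooth_at_comp _ _ _ _ _ H sq); rewrite ?Hp0.
have sE' : smooth_at p0 E' by exact: smooth_at_mulmx.
pose us (q : W * Z) := (q.1, q.2 - zc q.1).
have usp : us p = p0 by rewrite /us z0 subrr.
have sus : smooth_at p us.
  apply: smooth_at_pair => //; apply: smooth_atB => //.
  exact: (@smooth_at_comp _ _ _ _ _ fst zc).
have shus q : sh (us q) = q by rewrite /sh /us /= addrC subrK -surjective_pairing.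
exists (fun q => E' (us q)); split.
- by apply: (@smooth_at_comp _ _ _ _ _ us E'); rewrite ?usp.
- by rewrite usp /E' mul0mx.
- move=> v; rewrite (@derive_line_eq _ _ _ _ _ E' p p0 (0, v) (0, v)); last first.
    near=> h; congr E'; rewrite -usp /us; congr (_, _).
    by rewrite /= scaler0 add0r addrA.
  have dsnd : differentiable (snd : W * Z -> Z) p0 by exact: smooth_at_differentiable.
  rewrite /E' derive_mulmx//; last exact: smooth_at_differentiable.
  rewrite mul0mx addr0 Hp0 sqM mulmxV// mulmx1.
  have ssnd : {linear (W * Z)%type -> Z} := snd.
  by rewrite (@derive_linear _ _ _ snd).
- have N1 : \forall q \near p, D (us q).
    by apply: (smooth_at_near_comp (P := D) sus); rewrite usp; exact/open_nbhs_nbhs.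
  have N2 : \forall q \near p, (H (us q))^T = H (us q) ->
       (sq (H (us q)))^T = sq (H (us q)) /\ sq (H (us q)) *m invmx M *m sq (H (us q)) = H (us q).
    pose P (S : 'M[R]_n) := S^T = S -> (sq S)^T = sq S /\ sq S *m invmx M *m sq S = S.
    apply: (smooth_at_near_comp (f := fun q => H (us q)) (P := P)).
      by apply: (@smooth_at_comp _ _ _ _ _ us H); rewrite ?usp.
    by rewrite usp Hp0.
  move: N1 N2; apply: filterS2 => q Dq HS.
  have [_ symH _ T] := Tp _ Dq; rewrite -/Ht in symH T.
  have [] := HS; first by rewrite /H linearZ /= symH.
  move=> sqT sqE.
  rewrite -{1}(shus q) -/(ft (us q)) T crit// addr0; congr (_ + _).
    by rewrite /ft /sh /= addr0.
  rewrite /E' !trmx_mul trmx_inv (hessz_sym sf) sqT -!mulmxA.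
  rewrite (mulmxA (invmx M) M) mulVmx// mul1mx (mulmxA (sq _) (invmx M)) (mulmxA _ (sq _)) sqE.
  by rewrite [H _]/H -scalemxAl -scalemxAr [X in _ * X]mxE mulrA mulVf ?pnatr_eq0// mul1r.
Unshelve. all: by end_near. Qed.

End Morse.

Section MorsePair.
Context {R : realType} {m n : nat}.
Local Notation W := 'rV[R]_m.
Local Notation Z := 'rV[R]_n.

(** Both functions have quadratic normal forms over the same base, and [G] carries one form to the
    other. Matching the Morse coordinates above each base point gives the map, with the critical
    values as the only discrepancy. *)
Lemma morse_equivalence (f1 f2 : W * Z -> R) (x0 : W) (z1 z2 : Z) (G : 'M[R]_n) :
  smooth_at (x0, z1) f1 -> smooth_at (x0, z2) f2 ->
  gradz f1 (x0, z1) = 0 -> gradz f2 (x0, z2) = 0 ->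
  hessz f1 (x0, z1) \in unitmx -> G \in unitmx ->
  hessz f1 (x0, z1) = G *m hessz f2 (x0, z2) *m G^T ->
  exists (zc1 zc2 : W -> Z) (k k' : W * Z -> W * Z),
   [/\ [/\ smooth_at x0 zc1, zc1 x0 = z1 & \forall x \near x0, gradz f1 (x, zc1 x) = 0],
       [/\ smooth_at x0 zc2, zc2 x0 = z2 & \forall x \near x0, gradz f2 (x, zc2 x) = 0],
       local_diffeo (x0, z1) (x0, z2) k k',
       (\forall q \near (x0, z1), (k q).1 = q.1) /\
       (\forall q \near (x0, z2), (k' q).1 = q.1) &
       \forall q \near (x0, z1),
         f2 (k q) - f2 (q.1, zc2 q.1) = f1 q - f1 (q.1, zc1 q.1)].
Proof.
move=> s1 s2 g1 g2 u1 uG HG.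
have u2 : hessz f2 (x0, z2) \in unitmx.
  by move: u1; rewrite HG !unitmx_mul unitmx_tr uG andbT.
have [zc1 [sz1 z10 zP1]] := critical_section s1 g1 u1.
have [zc2 [sz2 z20 zP2]] := critical_section s2 g2 u2.
have [E1 [sE1 E10 DE1 EE1]] := morse_normal_form s1 u1 sz1 z10 zP1.
have [E2 [sE2 E20 DE2 EE2]] := morse_normal_form s2 u2 sz2 z20 zP2.
(* In the coordinate [F1] the quadratic part of [f1] has the Hessian of [f2] as its matrix. *)
pose F1 q := E1 q *m G.
have sF1 : smooth_at (x0, z1) F1 by apply: smooth_at_mulmx => //; exact: smooth_at_cst.
have F10 : F1 (x0, z1) = 0 by rewrite /F1 E10 mul0mx.
have [|h1 H1] := fibred_diffeo sF1.
  move=> v; rewrite derive_mulmx//; last exact: smooth_at_differentiable.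
  rewrite derive_cst mulmx0 addr0 DE1 => /(congr1 (mulmx^~ (invmx G))).
  by rewrite mul0mx -mulmxA mulmxV// mulmx1.
have [|h2 H2] := fibred_diffeo sE2; first by move=> v; rewrite DE2.
rewrite /= F10 in H1; rewrite /= E20 in H2.
have K := local_diffeo_comp _ _ _ H1 (local_diffeo_sym H2).
have [_ _ sh1 _ H1b] := H1; have [_ _ sh2 _ H2b] := H2; have [_ sk sk' kk' k'k] := K.
have N : \forall q \near (x0, z1), ((h2 (q.1, F1 q)).1, E2 (h2 (q.1, F1 q))) = (q.1, F1 q).
  apply: (smooth_at_near_comp (f := fun q : W * Z => (q.1, F1 q)) (P := fun y => ((h2 y).1, E2 (h2 y)) = y)).
    by case: H1.
  by rewrite /= F10.
have N' : \forall q \near (x0, z2), ((h1 (q.1, E2 q)).1, F1 (h1 (q.1, E2 q))) = (q.1, E2 q).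
  apply: (smooth_at_near_comp (f := fun q : W * Z => (q.1, E2 q)) (P := fun y => ((h1 y).1, F1 (h1 y)) = y)).
    by case: H2.
  by rewrite /= E20.
exists zc1, zc2, (fun q => h2 (q.1, F1 q)), (fun q => h1 (q.1, E2 q)); split.
- by split.
- by split.
- exact: K.
- by split; [apply: filterS N => q []|apply: filterS N' => q []].
- have N2 : \forall q \near (x0, z1), f2 (h2 (q.1, F1 q)) = f2 ((h2 (q.1, F1 q)).1, zc2 (h2 (q.1, F1 q)).1)
       + 2^-1 * (E2 (h2 (q.1, F1 q)) *m hessz f2 (x0, z2) *m (E2 (h2 (q.1, F1 q)))^T) 0 0.
    apply: (smooth_at_near_comp (f := fun q => h2 (q.1, F1 q)) (P := fun y => f2 y = f2 (y.1, zc2 y.1)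
       + 2^-1 * (E2 y *m hessz f2 (x0, z2) *m (E2 y)^T) 0 0) sk).
    by case: K => /= ->.
  move: (near_and N N2) EE1; apply: filterS2 => q [[e1 e2] e3] e4.
  rewrite e3 e4 e1 e2 HG /F1 trmx_mul !mulmxA.
  by rewrite ![_ + _ - _]addrAC !subrr.
Qed.

End MorsePair.

(** * Signature and congruence of symmetric matrices *)

Section RealSpectral.
Context {R : realType}.

Lemma mulmx_tr_eq0 m n (x : 'M[R]_(m, n)) : x *m x^T = 0 -> x = 0.
Proof.
move=> /matrixP xx; apply/matrixP => i j; rewrite mxE; apply/eqP.
have := xx i i; rewrite !mxE => /eqP.
under eq_bigr do rewrite mxE -expr2.
rewrite psumr_eq0; last by move=> k _; exact: sqr_ge0.
by move=> /allP/(_ j); rewrite mem_index_enum sqrf_eq0; exact.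
Qed.

Lemma row_scalar (x : 'M[R]_1) : x = (x 0 0)%:M.
Proof. by apply/matrixP => i j; rewrite !ord1 !mxE. Qed.

(* The reflection exchanging two vectors of the same Euclidean norm. *)
Lemma orthogonal_exchange n (u v : 'rV[R]_n) : u *m u^T = v *m v^T ->
  exists Q : 'M[R]_n, [/\ Q *m Q^T = 1%:M, Q^T = Q & u *m Q = v].
Proof.
move=> uv; have [->|neq] := eqVneq u v.
  by exists 1%:M; rewrite trmx1 !mulmx1.
pose w := u - v; pose c := (w *m w^T) 0 0.
have c0 : c != 0.
  apply: contra neq => /eqP c0; rewrite -subr_eq0; apply/eqP/mulmx_tr_eq0.
  by rewrite [LHS]row_scalar -/w -/c c0 raddf0.
have wE : w *m w^T = c%:M by exact: row_scalar.
pose Q := 1%:M - (2 / c) *: (w^T *m w).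
have QT : Q^T = Q by rewrite /Q linearB /= trmx1 linearZ /= trmx_mul trmxK.
exists Q; split=> //.
- have NN : (w^T *m w) *m (w^T *m w) = c *: (w^T *m w).
    by rewrite mulmxA -(mulmxA w^T) wE mul_mx_scalar scalemxAl.
  move: NN; rewrite QT /Q; move: (w^T *m w) => N NN.
  rewrite mulmxBl mul1mx mulmxBr mulmx1 -scalemxAl -scalemxAr NN !scalerA.
  by apply/matrixP => i j; rewrite !mxE; field.
- rewrite /Q mulmxBr mulmx1 -scalemxAr mulmxA.
  (* For vectors of equal norm, <u, u - v> is half of |u - v|^2; hence the reflection subtracts
     exactly [w] from [u]. *)
  have h : u *m w^T = (c / 2)%:M.
    have e : u *m w^T = 2^-1 *: (w *m w^T).
      rewrite /w linearB /= mulmxBr mulmxBl !mulmxBr -uv.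
      have -> : v *m u^T = u *m v^T.
        by rewrite [LHS]row_scalar [RHS]row_scalar; congr (_%:M); rewrite !mxE; apply: eq_bigr => i _; rewrite !mxE mulrC.
      by apply/matrixP => i j; rewrite !mxE; field.
    by rewrite e wE scale_scalar_mx mulrC.
  rewrite h mul_scalar_mx scalerA (_ : 2 / c * (c / 2) = 1); last by field.
  by rewrite scale1r /w subKr.
Qed.

(** Over the complex numbers the matrix is Hermitian, so its spectral diagonal is real; such a real
    root of the characteristic polynomial is an eigenvalue over [R]. *)
Lemma symmetric_eigenvalue n (A : 'M[R]_n.+1) : A^T = A -> exists a, eigenvalue A a.
Proof.
move=> As; pose C := R[i].
pose Ac : 'M[C]_n.+1 := map_mx (real_complex R) A.
have Ah : Ac \is hermsymmx.
  apply: realsym_hermsym.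
    apply/is_hermitianmxP; rewrite expr0 scale1r; apply/matrixP => i j.
    by rewrite !mxE -{1}As mxE.
  by apply/mxOverP => i j; rewrite mxE; apply/Creal_ImP; rewrite -complexIm.
have sr := hermitian_spectral_diag_real Ah.
have /orthomx_spectralP AE := hermitian_normalmx Ah.
set P := spectralmx Ac in AE; set sp := spectral_diag Ac in AE sr.
have uP : P \in unitmx by exact: spectral_unit.
have spr : sp 0 0 \is Num.real by exact: (mxOverP sr).
suff rt : root (char_poly Ac) (sp 0 0).
  have /complex_realP[k kE] := spr; rewrite kE in rt.
  exists k; rewrite eigenvalue_root_char -(fmorph_root (real_complex R)) map_char_poly.
  exact: rt.
rewrite -eigenvalue_root_char; apply/eigenvalueP; exists (row 0 P).
  rewrite AE -row_mul !mulmxA mulmxV// mul1mx.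
  by rewrite row_mul row_diag_mx -scalemxAl -rowE.
apply/eqP => r0; have := uP; rewrite -row_free_unit => /row_freeP[B PB].
have := congr1 (row 0) PB; rewrite row_mul r0 mul0mx => /rowP/(_ 0).
by rewrite !mxE eqxx => /esym/eqP; rewrite oner_eq0.
Qed.

(** A reflection takes the first basis vector to a unit eigenvector. After conjugation the first row
    is a multiple of that basis vector, and symmetry makes the matrix block diagonal. *)
Lemma symmetric_diagonalization n (A : 'M[R]_n) : A^T = A ->
  exists (P : 'M[R]_n) (d : 'rV[R]_n), P *m P^T = 1%:M /\ A = P^T *m diag_mx d *m P.
Proof.
elim: n A => [|n IH] A As.
  by exists 1%:M, 0; split; apply/matrixP => -[].
have [a /eigenvalueP[v vA v0]] := symmetric_eigenvalue As.
pose c := Num.sqrt ((v *m v^T) 0 0).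
have vv0 : 0 <= (v *m v^T) 0 0.
  by rewrite mxE; apply: sumr_ge0 => j _; rewrite mxE -expr2 sqr_ge0.
have c0 : c != 0.
  rewrite sqrtr_eq0 -ltNge lt_def vv0 andbT; apply: contra v0 => /eqP h; apply/eqP.
  by apply: mulmx_tr_eq0; rewrite [LHS]row_scalar h raddf0.
pose w := c^-1 *: v.
have ww : w *m w^T = 1%:M.
  rewrite /w linearZ /= -scalemxAl -scalemxAr scalerA [v *m v^T]row_scalar scale_scalar_mx.
  rewrite -invfM -expr2 sqr_sqrtr// mulVf//.
  by apply: contra c0 => /eqP h; rewrite /c h sqrtr0.
have wA : w *m A = a *: w by rewrite -scalemxAl vA !scalerA mulrC.
pose e0 : 'rV[R]_(1 + n) := row_mx 1%:M 0.
have [|Q [QQ QT eQ]] := @orthogonal_exchange _ e0 w.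
  by rewrite ww tr_row_mx mul_row_col trmx1 mulmx1 trmx0 mulmx0 addr0.
pose B : 'M[R]_(1 + n) := Q *m A *m Q^T.
have Bs : B^T = B by rewrite /B !trmx_mul trmxK As mulmxA.
have BE : e0 *m B = a *: e0.
  by rewrite /B !mulmxA eQ wA -scalemxAl -eQ -mulmxA QQ mulmx1.
pose A' : 'M[R]_n := drsubmx B.
have B1 : usubmx B = row_mx a%:M 0.
  move: BE; rewrite -{1}[B]vsubmxK mul_row_col mul1mx mul0mx addr0 => ->.
  by rewrite scale_row_mx scaler0 scalemx1.
have BB : B = block_mx a%:M 0 0 A'.
  rewrite -[LHS]submxK; congr block_mx.
  - by rewrite /ulsubmx B1 row_mxKl.
  - by rewrite /ursubmx B1 row_mxKr.
  - by rewrite -[LHS]trmxK trmx_dlsub Bs /ursubmx B1 row_mxKr trmx0.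
have A's : A'^T = A' by rewrite /A' trmx_drsub Bs.
have [P [d [PP A'E]]] := IH A' A's.
pose X : 'M[R]_(1 + n) := block_mx 1%:M 0 0 P.
have XX : X *m X^T = 1%:M.
  rewrite /X tr_block_mx mulmx_block.
  by rewrite !(mul0mx, mulmx0, mulmx1, trmx0, trmx1, addr0, add0r) PP -scalar_mx_block.
have XB : X^T *m diag_mx (row_mx a%:M d) *m X = B.
  rewrite BB /X diag_mx_row tr_block_mx !mulmx_block.
  rewrite !(mul0mx, mulmx0, mulmx1, mul1mx, trmx0, trmx1, addr0, add0r) -A'E.
  by congr block_mx; apply/matrixP => i j; rewrite !ord1 !mxE.
have Q2 : Q^T *m Q = 1%:M by rewrite QT -{2}QT.
exists (X *m Q : 'M[R]_(1 + n)), (row_mx a%:M d); split.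
  by rewrite trmx_mul mulmxA -(mulmxA X Q) QQ mulmx1.
have -> : (X *m Q)^T *m diag_mx (row_mx a%:M d) *m (X *m Q) = Q^T *m B *m Q.
  by rewrite -XB trmx_mul !mulmxA.
by rewrite /B !mulmxA Q2 mul1mx -mulmxA Q2 mulmx1.
Qed.

Lemma rank_diag_mx n (d : 'rV[R]_n) : \rank (diag_mx d) = (\sum_(i < n) (d 0%R i != 0%R))%N.
Proof.
elim: n d => [|n IH] d; first by rewrite big_ord0 thinmx0 mxrank0.
pose x : 'rV[R]_(1 + n) := d; pose l := lsubmx x; pose r := rsubmx x.
have -> : \rank (diag_mx d) = \rank (diag_mx (row_mx l r)) by rewrite hsubmxK.
rewrite diag_mx_row rank_diag_block_mx IH big_ord_recl; congr (_ + _)%N.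
  have -> : diag_mx l = (d 0 0)%:M.
    by apply/matrixP => i j; rewrite !ord1 !mxE /= (_ : lshift n 0 = 0)//; exact: val_inj.
  rewrite -[LHS]/(\rank ((d 0 0)%:M : 'rV[R]_1)) rank_rV; congr (~~ _ : nat).
  apply/eqP/eqP => [/matrixP/(_ 0 0)|->]; first by rewrite !mxE.
  by rewrite raddf0.
by apply: eq_bigr => i _; rewrite mxE (_ : rshift 1 i = lift ord0 i)//; exact: val_inj.
Qed.

Lemma mup_prod n (d : 'I_n -> R) a :
  mup a (\prod_(i < n) ('X - (d i)%:P)) = (\sum_(i < n) (d i == a))%N.
Proof.
elim: n d => [|n IH] d.
  by rewrite !big_ord0 mupNroot// root1.
rewrite !big_ord_recl mupM; last 2 first.
- by rewrite polyXsubC_eq0.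
- by rewrite prodf_seq_neq0; apply/allP => i _; rewrite /= polyXsubC_eq0.
rewrite IH; congr (_ + _)%N.
by have := mup_XsubCX 1 a (d ord0); rewrite expr1 => ->; case: eqVneq.
Qed.

Lemma char_poly_conj n (P A : 'M[R]_n) : P^T *m P = 1%:M ->
  char_poly (P^T *m A *m P) = char_poly A.
Proof.
move=> PP; rewrite /char_poly.
have -> : char_poly_mx (P^T *m A *m P) =
    map_mx polyC P^T *m char_poly_mx A *m map_mx polyC P.
  rewrite /char_poly_mx mulmxBr mulmxBl !map_mxM; congr (_ - _).
  by rewrite mul_mx_scalar -scalemxAl -map_mxM PP map_mx1 scalemx1.
by rewrite !det_mulmx mulrAC -det_mulmx -map_mxM PP map_mx1 det1 mul1r.
Qed.

(** The roots of the characteristic polynomial are the entries of [d]; grouping the indices by their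
    value turns the multiplicities into counts. *)
Lemma signature_diag n (P : 'M[R]_n) (d : 'rV[R]_n) : P *m P^T = 1%:M ->
  signature (P^T *m diag_mx d *m P) = \sum_(i < n) sgz (d 0 i).
Proof.
move=> PP; rewrite /signature.
have cp : char_poly (P^T *m diag_mx d *m P) = \prod_(i < n) ('X - (d 0 i)%:P).
  rewrite char_poly_conj; last exact: mulmx1C.
  rewrite char_poly_trig; last exact: diag_mx_is_trig.
  by apply: eq_bigr => i _; rewrite mxE eqxx mulr1n.
rewrite cp; set p := \prod_(i < n) _.
have p0 : p != 0 by rewrite prodf_seq_neq0; apply/allP => i _; rewrite /= polyXsubC_eq0.
have ur : uniq (rootsR p) by exact: uniq_roots.
have mr a : a \in rootsR p = root p a.
  by have := roots_on_rootsR p0 a; rewrite in_itv /= => <-.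
transitivity (\sum_(a <- rootsR p) \sum_(i < n | d 0 i == a) sgz (d 0 i)).
  apply: eq_bigr => a _; rewrite mup_prod.
  rewrite (eq_bigr (fun=> sgz a)); last by move=> i /eqP ->.
  rewrite sumr_const -mulr_natr; congr (_ * _).
  rewrite natz; congr Posz; rewrite -sum1_card [RHS]big_mkcond; apply: eq_bigr => i _.
  by rewrite (_ : (i \in _) = (d 0 i == a))//; case: (d 0 i == a).
rewrite (exchange_big_dep predT)//=; apply: eq_bigr => i _.
rewrite -big_filter (eq_filter (a2 := pred1 (d 0 i))); last by move=> a; rewrite /= eq_sym.
rewrite filter_pred1_uniq ?big_seq1// mr.
by rewrite /p (bigD1 i)//= rootM root_XsubC eqxx.
Qed.

(** The two sums are the difference and the sum of the numbers of positive and negative entries, so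
    they determine how often each of the three signs occurs. *)
Lemma sgz_perm n (d1 d2 : 'rV[R]_n) :
  \sum_(i < n) sgz (d1 0 i) = \sum_(i < n) sgz (d2 0 i) ->
  (\sum_(i < n) (d1 0%R i != 0%R) = \sum_(i < n) (d2 0%R i != 0%R))%N ->
  exists pi : {perm 'I_n}, forall i, sgz (d1 0 i) = sgz (d2 0 (pi i)).
Proof.
move=> H1 H2.
pose pos (d : 'rV[R]_n) := (\sum_(i < n) (0 < d 0%R i)%R)%N.
pose neg (d : 'rV[R]_n) := (\sum_(i < n) (d 0%R i < 0)%R)%N.
pose nul (d : 'rV[R]_n) := (\sum_(i < n) (d 0%R i == 0%R))%N.
have E1 (d : 'rV[R]_n) : \sum_(i < n) sgz (d 0 i) = (pos d)%:Z - (neg d)%:Z.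
  rewrite /pos /neg -!natz !natr_sum -sumrB; apply: eq_bigr => i _.
  by case: sgzP.
have E2 (d : 'rV[R]_n) : (\sum_(i < n) (d 0%R i != 0%R) = pos d + neg d)%N.
  rewrite -big_split; apply: eq_bigr => i _.
  by case: (ltgtP (d 0 i) 0).
have E3 d : (pos d + neg d + nul d = n)%N.
  rewrite -E2 -big_split /= (eq_bigr (fun=> 1%N)); first by rewrite sum1_card card_ord.
  by move=> i _; case: eqP.
rewrite !E1 in H1; rewrite !E2 in H2.
have pp : pos d1 = pos d2 by lia.
have qq : neg d1 = neg d2 by lia.
have zz : nul d1 = nul d2 by have := E3 d1; have := E3 d2; lia.
pose t (d : 'rV[R]_n) := [tuple sgz (d 0 i) | i < n].
have cnt (a : pred int) d : count a (t d) = (a 1%R * pos d + a (-1)%R * neg d + a 0%R * nul d)%N.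
  rewrite count_map -sum1_count big_enum_cond /= big_mkcond /=.
  rewrite /pos /neg /nul !big_distrr -!big_split /=; apply: eq_bigr => i _.
  by case: (ltgtP (d 0 i) 0) => [/ltr0_sgz->|/gtr0_sgz->|->]; rewrite ?sgz0; case: (a _); rewrite ?muln0 ?muln1 ?addn0 ?add0n.
have /tuple_permP[s ts] : perm_eq (t d1) (t d2) by apply/seq.permP => a; rewrite !cnt pp qq zz.
exists s => i.
have /(congr1 (fun u => tnth u i)) : t d1 = [tuple tnth (t d2) (s j) | j < n] by exact: val_inj.
by rewrite !tnth_mktuple.
Qed.

Lemma diag_congruence n (d1 d2 : 'rV[R]_n) (s : {perm 'I_n}) :
  (forall i, sgz (d1 0 i) = sgz (d2 0 (s i))) ->
  exists2 G : 'M[R]_n, G \in unitmx & diag_mx d1 = G *m diag_mx d2 *m G^T.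
Proof.
move=> H.
(* At zero entries the value 1 keeps the matrix invertible; elsewhere the quotient is positive
   because the signs agree. *)
pose c : 'rV[R]_n := \row_i (if d2 0 (s i) == 0 then 1 else Num.sqrt (d1 0 i / d2 0 (s i))).
have q0 i : d2 0 (s i) != 0 -> 0 < d1 0 i / d2 0 (s i).
  move=> d20; have := H i.
  case: (ltgtP (d2 0 (s i)) 0) d20 => // [neg _|pos _].
    by rewrite [in RHS]ltr0_sgz// => /eqP; rewrite sgz_cp0 => d10; rewrite nmulr_rgt0// invr_lt0.
  by rewrite [in RHS]gtr0_sgz// => /eqP; rewrite sgz_cp0 => d10; rewrite divr_gt0.
have c0 i : c 0 i != 0.
  by rewrite mxE; case: (eqVneq (d2 0 (s i)) 0) => [_|h]; [exact: oner_neq0|rewrite gt_eqF// sqrtr_gt0; exact: q0].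
exists (diag_mx c *m perm_mx s).
  rewrite unitmx_mul unitmx_perm andbT unitmxE det_diag unitfE.
  by apply/prodf_neq0 => i _.
have -> : diag_mx c *m perm_mx s *m diag_mx d2 *m (diag_mx c *m perm_mx s)^T =
    diag_mx c *m (perm_mx s *m diag_mx d2 *m (perm_mx s)^T) *m diag_mx c.
  by rewrite trmx_mul tr_diag_mx !mulmxA.
have -> : perm_mx s *m diag_mx d2 *m (perm_mx s)^T = diag_mx (\row_i d2 0 (s i)).
  apply/matrixP => i j; rewrite tr_perm_mx -row_permE -col_permE !mxE.
  by rewrite (inj_eq perm_inj).
rewrite !mulmx_diag; congr diag_mx; apply/rowP => i; rewrite !mxE.
case: (eqVneq (d2 0 (s i)) 0) => [d20|d20].
  by rewrite d20 mulr0 mul0r; apply/eqP; rewrite -sgz_eq0 H d20 sgz0.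
rewrite mulrAC -expr2 sqr_sqrtr ?divfK//; exact/ltW/q0.
Qed.

(** Sylvester's law in the direction from invariants to congruence: after diagonalization a
    permutation matches the signs and a rescaling matches the absolute values. *)
Lemma signature_congruence n (A1 A2 : 'M[R]_n) : A1^T = A1 -> A2^T = A2 ->
  signature A1 = signature A2 -> \rank A1 = \rank A2 ->
  exists2 G : 'M[R]_n, G \in unitmx & A1 = G *m A2 *m G^T.
Proof.
move=> /symmetric_diagonalization[P1 [d1 [P11 ->]]].
move=> /symmetric_diagonalization[P2 [d2 [P21 ->]]].
rewrite !signature_diag// => sg.
have PT (P : 'M[R]_n) : P *m P^T = 1%:M -> P \in unitmx /\ P^T \in unitmx.
  by move=> PP; have /mulmx1_unit[] := PP.
have [u1 u1'] := PT _ P11; have [u2 u2'] := PT _ P21.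
have rkE (P D : 'M[R]_n) : P *m P^T = 1%:M -> \rank (P^T *m D *m P) = \rank D.
  by case/PT=> u u'; rewrite mxrankMfree ?row_free_unit// -mxrank_tr trmx_mul mxrankMfree ?mxrank_tr// trmxK row_free_unit.
rewrite !rkE// !rank_diag_mx => rk.
have [s /diag_congruence[G uG GE]] := sgz_perm sg rk.
exists (P1^T *m G *m P2); first by rewrite !unitmx_mul u1' uG u2.
rewrite GE !trmx_mul trmxK !mulmxA.
rewrite -[P1^T *m G *m P2 *m P2^T]mulmxA P21 mulmx1.
by rewrite -[_ *m P2 *m P2^T]mulmxA P21 mulmx1.
Qed.

End RealSpectral.

(** * Hessian blocks and tangent spaces of Legendrians *)

Section BlockAlgebra.
Context {R : realType}.

Lemma kermx_basis k s (K : 'M[R]_(k, s)) (D : 'M[R]_s) : row_free K -> K *m D = 0 ->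
  (\rank D + k)%N = s -> (kermx D <= K)%MS.
Proof.
move=> fK KD rk; rewrite -(mxrank_leqif_sup (introT (sub_kermxP) KD)) mxrank_ker (eqP fK); lia.
Qed.

Lemma unitmx_pairing_row_free k s (B K : 'M[R]_(k, s)) : B *m K^T \in unitmx -> row_free K.
Proof.
move=> u; rewrite -kermx_eq0; apply/eqP.
have h : kermx K *m (B *m K^T)^T = 0.
  by rewrite trmx_mul trmxK mulmxA mulmx_ker mul0mx.
by rewrite -[LHS](@mulmxK _ _ _ (B *m K^T)^T) ?unitmx_tr// h mul0mx.
Qed.

Section Congruence.
Variables (k s : nat) (A : 'M[R]_k) (B K : 'M[R]_(k, s)) (D : 'M[R]_s).
Hypotheses (Dsym : D^T = D) (KD : K *m D = 0) (BK : B *m K^T \in unitmx)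
  (rankD : (\rank D + k)%N = s).

Lemma kernel_pairing m (v : 'M[R]_(m, s)) : v *m B^T = 0 -> v *m D = 0 -> v = 0.
Proof.
move=> vB vD.
have /submxP[C CE] : (v <= K)%MS.
  apply: submx_trans (kermx_basis (unitmx_pairing_row_free BK) KD rankD).
  exact/sub_kermxP.
have : C *m (B *m K^T)^T = 0 by rewrite trmx_mul trmxK mulmxA -CE.
move=> /(congr1 (mulmx^~ (invmx (B *m K^T)^T))); rewrite mulmxK ?unitmx_tr// mul0mx => C0.
by rewrite CE C0 mul0mx.
Qed.

(** For (u, v) in the kernel, pairing u B + v D = 0 with the kernel [K] of [D] leaves u B K^T = 0,
    so u = 0. Then v is killed by [D] and by B^T, hence is zero. *)
Lemma hessian_block_unit : block_mx A B B^T D \in unitmx.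
Proof.
rewrite -row_free_unit -kermx_eq0; apply/eqP.
set N := kermx _; have := mulmx_ker (block_mx A B B^T D); rewrite -/N.
rewrite -[N]hsubmxK mul_row_block; set u := lsubmx N; set v := rsubmx N.
move=> /eqP; rewrite -[X in _ == X]row_mx0 => /eqP/eq_row_mx[h1 h2].
have u0 : u = 0.
  have : u *m (B *m K^T) = 0.
    have : (u *m B + v *m D) *m K^T = 0 by rewrite h2 mul0mx.
    rewrite mulmxDl -(mulmxA v) -[D *m _]trmxK trmx_mul trmxK Dsym KD trmx0 mulmx0 addr0.
    by rewrite mulmxA.
  by move=> /(congr1 (mulmx^~ (invmx (B *m K^T)))); rewrite mulmxK// mul0mx.
move: h1 h2; rewrite u0 !mul0mx !add0r => h1 h2.
by rewrite (kernel_pairing h1 h2) row_mx0.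
Qed.

(** The stacked matrix of [B] and [D] has full column rank, as no nonzero row is killed by both B^T
    and [D]. This solves for the off-diagonal block of a congruence. *)
Lemma hessian_block_full m (W : 'M[R]_(m, s)) :
  exists (X : 'M[R]_(m, k)) (Y : 'M[R]_(m, s)), X *m B + Y *m D = W.
Proof.
have full : row_full (col_mx B D).
  rewrite /row_full -mxrank_tr tr_col_mx Dsym -/(row_free _) -kermx_eq0; apply/eqP.
  have := mulmx_ker (row_mx B^T D); rewrite mul_mx_row => /eqP.
  by rewrite -[X in _ == X]row_mx0 => /eqP/eq_row_mx[]; exact: kernel_pairing.
have /submxP[Z ->] := submx_full W full.
by exists (lsubmx Z), (rsubmx Z); rewrite -mul_row_col hsubmxK.
Qed.

End Congruence.

Lemma half_sub_split (V : lmodType R) (a b : V) :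
  a = b + (2^-1 *: (a - b) + 2^-1 *: (a - b)).
Proof.
have h : 2^-1 + 2^-1 = 1 :> R by field.
by rewrite -scalerDl h scale1r addrC subrK.
Qed.

(** [H] is sought block upper triangular with lower right block [G]. The mixed block imposes one
    linear equation on the upper row, which leaves the freedom of adding multiples of [K2] because
    [K2] is killed by [D2]; this freedom is spent on the upper left block. *)
Lemma block_congruence k s (A1 A2 S : 'M[R]_k) (B1 K1 B2 K2 : 'M[R]_(k, s))
    (D1 D2 G : 'M[R]_s) :
  A1^T = A1 -> A2^T = A2 -> D1^T = D1 -> D2^T = D2 ->
  K1 *m D1 = 0 -> K2 *m D2 = 0 -> B1 *m K1^T = S -> B2 *m K2^T = S -> S \in unitmx ->
  (\rank D1 + k)%N = s -> (\rank D2 + k)%N = s ->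
  G \in unitmx -> D1 = G *m D2 *m G^T ->
  exists H, block_mx A1 B1 B1^T D1 = H *m block_mx A2 B2 B2^T D2 *m H^T.
Proof.
move=> A1s A2s D1s D2s KD1 KD2 BK1 BK2 uS r1 r2 uG DE.
have u1 : B1 *m K1^T \in unitmx by rewrite BK1.
have u2 : B2 *m K2^T \in unitmx by rewrite BK2.
have uGT : G^T \in unitmx by rewrite unitmx_tr.
have [X [Y XY]] := hessian_block_full D2s KD2 u2 r2 (B1 *m invmx G^T).
have DK2 : D2 *m K2^T = 0 by rewrite -[LHS]trmxK trmx_mul trmxK D2s KD2 trmx0.
(* [G] identifies the kernels of [D1] and [D2]; [C] is the change of basis between [K1] and the
   transported [K2]. *)
have /submxP[C CE] : (K2 *m invmx G <= K1)%MS.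
  apply: submx_trans (kermx_basis (unitmx_pairing_row_free u1) KD1 r1).
  by apply/sub_kermxP; rewrite DE !mulmxA mulmxKV// KD2 mul0mx.
have uC : C \in unitmx.
  rewrite -row_free_unit /row_free eqn_leq rank_leq_row /=.
  apply: leq_trans (mxrankM_maxl C K1); rewrite -CE mxrankMfree ?row_free_unit ?unitmx_inv//.
  by rewrite (eqP (unitmx_pairing_row_free u2)).
(* Pairing the equation for the mixed block with [K2] removes [Y] and expresses [X] through [C];
   this makes [X *m S] invertible. *)
have XS : X *m S = S *m C^T.
  have : (X *m B2 + Y *m D2) *m K2^T = B1 *m (K2 *m invmx G)^T.
    by rewrite XY trmx_mul trmx_inv mulmxA.
  rewrite mulmxDl -!mulmxA DK2 BK2 mulmx0 addr0 => ->.
  by rewrite CE trmx_mul mulmxA BK1.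
have uXS : (X *m S)^T \in unitmx by rewrite XS unitmx_tr unitmx_mul uS unitmx_tr.
pose A0 := X *m A2 *m X^T + Y *m B2^T *m X^T + (X *m B2 *m Y^T + Y *m D2 *m Y^T).
have A0s : A0^T = A0.
  rewrite /A0 !raddfD /= !trmx_mul !trmxK A2s D2s !mulmxA -!addrA; congr (_ + _).
  by rewrite addrCA.
(* [T] enters the upper left block through a term and its transpose, each of which has to supply
   half of the defect [A1 - A0]. *)
pose T := 2^-1 *: (A1 - A0) *m invmx (X *m S)^T.
have TE : T *m (X *m S)^T = 2^-1 *: (A1 - A0) by rewrite mulmxKV.
have TE' : X *m S *m T^T = 2^-1 *: (A1 - A0).
  by rewrite -[LHS]trmxK trmx_mul trmxK TE linearZ linearB /= A1s A0s.
exists (block_mx X (Y + T *m K2) 0 G).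
have W : X *m B2 + (Y + T *m K2) *m D2 = B1 *m invmx G^T.
  by rewrite mulmxDl -mulmxA KD2 mulmx0 addr0.
rewrite tr_block_mx !mulmx_block !mul0mx !add0r !trmx0 !mulmx0 !add0r; congr block_mx.
- set Z := T *m K2.
  have ZD : Z *m D2 = 0 by rewrite -mulmxA KD2 mulmx0.
  have DZ : D2 *m Z^T = 0 by rewrite trmx_mul mulmxA DK2 mul0mx.
  have e1 : Z *m B2^T *m X^T = 2^-1 *: (A1 - A0).
    by rewrite -TE trmx_mul -BK2 trmx_mul trmxK !mulmxA.
  have e2 : X *m B2 *m Z^T = 2^-1 *: (A1 - A0).
    by rewrite -TE' -BK2 trmx_mul !mulmxA.
  rewrite [(Y + Z)^T]raddfD /= ![(Y + Z) *m _]mulmxDl ZD addr0 mulmxDr !(mulmxDl _ _ X^T).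
  rewrite !(mulmxDl _ _ Y^T) !(mulmxDl _ _ Z^T) e1 e2 -(mulmxA Y D2 Z^T) DZ mulmx0 addr0.
  rewrite [LHS](half_sub_split _ A0).
  by rewrite /A0; apply/matrixP => i j; rewrite !mxE; ring.
- by rewrite W mulmxKV.
- have -> : B1^T = G *m (X *m B2 + (Y + T *m K2) *m D2)^T.
    by rewrite W trmx_mul trmx_inv trmxK mulKVmx.
  by rewrite raddfD /= !trmx_mul D2s mulmxDr !mulmxA.
- by rewrite DE.
Qed.

(* [kermx (col_mx B D) *m block_mx 1 A 0 B^T] is the tangent space
   {(u, u A + t B^T) : u B + t D = 0} of the Lagrangian generated by a function
   with Hessian [A B; B^T D]; it determines the dimension of the kernel of D and
   its image under B. *)
Definition lagr_tangent d s (A : 'M[R]_d) (B : 'M[R]_(d, s)) (D : 'M[R]_s) :=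
  kermx (col_mx B D) *m block_mx 1%:M A 0 B^T.

Lemma lagr_tangentP m d s A (B : 'M[R]_(d, s)) D (u x : 'M[R]_(m, d)) :
  reflect (exists2 t, u *m B + t *m D = 0 & x = u *m A + t *m B^T)
    (row_mx u x <= lagr_tangent A B D)%MS.
Proof.
apply: (iffP submxP) => [[Z ZE]|[t tE xE]].
  pose W := Z *m kermx (col_mx B D).
  have W0 : W *m col_mx B D = 0 by rewrite -mulmxA mulmx_ker mulmx0.
  move: ZE; rewrite /lagr_tangent mulmxA -/W -[W]hsubmxK mul_row_block mulmx1 mulmx0 addr0.
  move=> /eq_row_mx[-> ->]; exists (rsubmx W) => //.
  by rewrite -mul_row_col hsubmxK.
have /submxP[Z ZE] : (row_mx u t <= kermx (col_mx B D))%MS.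
  by apply/sub_kermxP; rewrite mul_row_col.
by exists Z; rewrite /lagr_tangent mulmxA -ZE mul_row_block mulmx1 mulmx0 addr0 xE.
Qed.

Section LagrKernel.
Variables (d s : nat) (A1 A2 : 'M[R]_d) (B1 B2 : 'M[R]_(d, s)) (D1 D2 : 'M[R]_s).
Hypothesis inj1 : forall a : 'rV[R]_s, a *m B1^T = 0 -> a *m D1 = 0 -> a = 0.
Hypothesis inj2 : forall a : 'rV[R]_s, a *m B2^T = 0 -> a *m D2 = 0 -> a = 0.
Hypothesis tangentE : (lagr_tangent A1 B1 D1 :=: lagr_tangent A2 B2 D2)%MS.

Lemma mx_ker0 m n p (B : 'M[R]_(n, p)) (D : 'M[R]_n) :
  (forall a : 'rV[R]_n, a *m B = 0 -> a *m D = 0 -> a = 0) ->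
  forall a : 'M[R]_(m, n), a *m B = 0 -> a *m D = 0 -> a = 0.
Proof.
move=> H a aB aD; apply/row_matrixP => i; rewrite row0; apply: H.
  by rewrite -row_mul aB row0.
by rewrite -row_mul aD row0.
Qed.

(** The vertical vectors (0, x) of the tangent space are the images t B^T of the kernel of [D], and
    t is determined by its image through nondegeneracy. Equal tangent spaces therefore match the two
    kernels; [K2] is [K1] transported in this way. *)
Lemma lagr_kernel : exists k (K1 K2 : 'M[R]_(k, s)),
  [/\ [/\ K1 *m D1 = 0, (\rank D1 + k)%N = s & K1 *m B1^T = K2 *m B2^T],
      [/\ K2 *m D2 = 0 & (\rank D2 + k)%N = s] & row_free (K1 *m B1^T)].
Proof.
have fwd (A A' : 'M[R]_d) (B B' : 'M[R]_(d, s)) (D D' : 'M[R]_s) :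
    (lagr_tangent A B D :=: lagr_tangent A' B' D')%MS ->
    forall m (K : 'M[R]_(m, s)), K *m D = 0 ->
      exists2 K', K' *m D' = 0 & K *m B^T = K' *m B'^T.
  move=> E m K KD.
  have : (row_mx 0 (K *m B^T) <= lagr_tangent A B D)%MS.
    by apply/lagr_tangentP; exists K; rewrite ?KD ?mul0mx ?add0r.
  by rewrite E => /lagr_tangentP[t]; rewrite !mul0mx !add0r => tD ->; exists t.
pose K1 := row_base (kermx D1).
have K1D : K1 *m D1 = 0.
  by apply/sub_kermxP; rewrite eq_row_base.
have fK1 : row_free K1 by exact: row_base_free.
have [K2 K2D KK] := fwd _ _ _ _ _ _ tangentE _ K1 K1D.
have fb : row_free (K1 *m B1^T).
  rewrite -kermx_eq0; apply/eqP; set N := kermx (K1 *m B1^T).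
  have NK : N *m K1 = 0.
    apply: (mx_ker0 inj1); first by rewrite -mulmxA mulmx_ker.
    by rewrite -mulmxA K1D mulmx0.
  by have /row_freeP[Z KZ] := fK1; rewrite -[N]mulmx1 -KZ mulmxA NK mul0mx.
have fK2 : row_free K2.
  rewrite -kermx_eq0; apply/eqP; set N := kermx K2.
  have /row_freeP[Z KZ] := fb.
  by rewrite -[LHS]mulmx1 -KZ KK !mulmxA mulmx_ker !mul0mx.
have kle : (\rank (kermx D1) <= \rank (kermx D2))%N.
  by rewrite -[X in (X <= _)%N](eqP fK2); apply: mxrankS; apply/sub_kermxP.
have kge : (\rank (kermx D2) <= \rank (kermx D1))%N.
  have E : (lagr_tangent A2 B2 D2 :=: lagr_tangent A1 B1 D1)%MS by exact: eqmx_sym.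
  have [K3 K3D KK3] := fwd _ _ _ _ _ _ E _ _ (mulmx_ker D2).
  have K4 : (\rank (kermx D2) <= \rank K3)%N.
    have sub : (kermx K3 <= kermx (kermx D2))%MS.
      apply/sub_kermxP; apply: (mx_ker0 inj2); last by rewrite -mulmxA mulmx_ker mulmx0.
      by rewrite -mulmxA KK3 mulmxA mulmx_ker mul0mx.
    have := mxrankS sub; rewrite !mxrank_ker.
    by have := rank_leq_row K3; have := rank_leq_row (kermx D2); lia.
  by apply: leq_trans K4 _; apply: mxrankS; apply/sub_kermxP.
have kk : \rank (kermx D1) = \rank (kermx D2) by apply/eqP; rewrite eqn_leq kle.
have rk (D : 'M[R]_s) : (\rank D + \rank (kermx D))%N = s.
  by rewrite mxrank_ker subnKC// rank_leq_row.
by exists (\rank (kermx D1)), K1, K2; split=> //; split=> //; rewrite ?kk rk.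
Qed.

End LagrKernel.
End BlockAlgebra.

Lemma mulmx_tr_ge0 (R : realType) n (x : 'rV[R]_n) : 0 <= (x *m x^T) 0 0.
Proof. by rewrite mxE; apply: sumr_ge0 => j _; rewrite mxE -expr2 sqr_ge0. Qed.

(** The linearized critical equation has rank [s], leaving [d] dimensions of solutions (u, t), and
    nondegeneracy makes the passage to (u, u A + t B^T) injective. *)
Lemma lagr_tangent_rank (R : realType) d s (A : 'M[R]_d) (B : 'M[R]_(d, s)) (D : 'M[R]_s) :
  D^T = D -> (forall a : 'rV[R]_s, a *m B^T = 0 -> a *m D = 0 -> a = 0) ->
  \rank (lagr_tangent A B D) = d.
Proof.
move=> Ds inj.
have rBD : \rank (col_mx B D) = s.
  apply/eqP; rewrite -mxrank_tr tr_col_mx Ds -/(row_free _) -kermx_eq0; apply/eqP.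
  have := mulmx_ker (row_mx B^T D); rewrite mul_mx_row => /eqP.
  by rewrite -[X in _ == X]row_mx0 => /eqP/eq_row_mx[]; exact: (mx_ker0 inj).
set X := block_mx 1%:M A 0 B^T.
have cap0 : (kermx (col_mx B D) :&: kermx X)%MS = 0.
  apply/eqP; rewrite -submx0; apply/rV_subP => v; rewrite sub_capmx => /andP[/sub_kermxP h1 /sub_kermxP].
  move: h1; rewrite -[v]hsubmxK mul_row_col mul_row_block mulmx1 mulmx0 addr0 => h1 /eqP.
  rewrite -[X in _ == X]row_mx0 => /eqP/eq_row_mx[u0].
  move: h1; rewrite u0 !mul0mx !add0r => tD tB.
  by rewrite (inj _ tB tD) row_mx0 sub0mx.
have := mxrank_mul_ker (kermx (col_mx B D)) X.
by rewrite cap0 mxrank0 addn0 mxrank_ker rBD addnK.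
Qed.

Section Entries.
Context {R : realType} {m n : nat}.
Implicit Types f : 'rV[R]_m * 'rV[R]_n -> R.

Lemma gradzE f x j : gradz f x 0 j = dz j f x.
Proof. by rewrite /gradz mxE. Qed.

Lemma hesszE f x j k : hessz f x j k = dz j (dz k f) x.
Proof. by rewrite /hessz mxE. Qed.

Lemma hess_thetaE f x j k : hess_theta f x j k = dtheta j (dtheta k f) x.
Proof. by rewrite /hess_theta mxE. Qed.
End Entries.

(** * Mixed Hessians and the tangent space of the critical 1-jets *)

Section MixedHessian.
Context {R : realType} {n s : nat}.
Local Notation W := 'rV[R]_n.
Local Notation Z := 'rV[R]_s.
Implicit Types f : W * Z -> R.

Definition hessx f p : 'M[R]_n :=
  \matrix_(i, j) 'D_(delta_mx 0 i, 0) ('D_(delta_mx 0 j, 0) f) p.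
Definition hessxz f p : 'M[R]_(n, s) := \matrix_(i, j) 'D_(delta_mx 0 i, 0) (dz j f) p.

Lemma derive_pair_sum f x (u : W) (z : Z) : differentiable f x ->
  'D_(u, z) f x = \sum_i u 0 i * 'D_(delta_mx 0 i, 0) f x + \sum_j z 0 j * dz j f x.
Proof.
move=> df; rewrite -derive_z_sum// !deriveE//.
have -> : (u, z) = (\sum_i u 0 i *: ((delta_mx 0 i, 0) : W * Z)) + (0, z).
  have -> : \sum_i u 0 i *: ((delta_mx 0 i, 0) : W * Z) = (u, 0).
    rewrite {2}(row_sum_delta u).
    elim/big_rec2 : _ => // j y1 y2 _ ->; congr (_, _) => /=.
    by rewrite scaler0 add0r.
  by congr (_, _); rewrite /= ?addr0 ?add0r.
rewrite linearD linear_sum; congr (_ + _); apply: eq_bigr => j _.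
by rewrite deriveE//; exact: linearZZ.
Qed.

Lemma derive_gradz_pair f p u z : smooth_at p f ->
  'D_(u, z) (gradz f) p = u *m hessxz f p + z *m hessz f p.
Proof.
move=> sf; rewrite derive_row; last by move=> j; exact/smooth_at_differentiable/smooth_at_dz.
apply/rowP => k; rewrite !mxE derive_pair_sum; last exact/smooth_at_differentiable/smooth_at_dz.
by congr (_ + _); apply: eq_bigr => j _; rewrite !mxE.
Qed.

Lemma derive_grad_x f p u z : smooth_at p f ->
  'D_(u, z) (grad_x f) p = u *m hessx f p + z *m (hessxz f p)^T.
Proof.
move=> sf.
have d j : differentiable ('D_(delta_mx 0 j, 0) f) p.
  exact/smooth_at_differentiable/smooth_at_derive.
rewrite derive_row//; apply/rowP => k; rewrite !mxE derive_pair_sum//.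
congr (_ + _); apply: eq_bigr => j _; first by rewrite [in RHS]mxE.
have -> : (hessxz f p)^T j k = 'D_(delta_mx 0 k, 0) (dz j f) p by rewrite /hessxz mxE mxE.
by rewrite /dz (derive_symmetric (delta_mx 0 k, 0) (0, delta_mx 0 j) sf).
Qed.

Lemma smooth_at_grad_x f p : smooth_at p f -> smooth_at p (grad_x f).
Proof.
move=> sf; apply: smooth_at_mx => i j; rewrite ord1.
apply: (@eq_smooth_at _ _ _ _ ('D_(delta_mx 0 j, 0) f)); last exact: smooth_at_derive.
by near=> q; rewrite mxE.
Unshelve. all: by end_near. Qed.

Lemma hessx_sym f p : smooth_at p f -> (hessx f p)^T = hessx f p.
Proof. by move=> sf; apply/matrixP => j k; rewrite !mxE; exact: derive_symmetric. Qed.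

Definition jet1 f (q : W * Z) : R * (W * W) := (f q, (q.1, grad_x f q)).

Lemma smooth_at_jet1 f p : smooth_at p f -> smooth_at p (jet1 f).
Proof.
move=> sf; apply: smooth_at_pair => //; apply: smooth_at_pair.
  by apply: smooth_at_fst; exact: smooth_at_id.
exact: smooth_at_grad_x.
Qed.

(* Every tangent vector of {gradz f = 0} is the velocity of a curve in this set, found by
   correcting a line in the normal directions with the implicit function theorem. *)
Lemma critical_curve f p (u : W) (z : Z) : smooth_at p f -> gradz f p = 0 ->
  (forall a : Z, a *m (hessxz f p)^T = 0 -> a *m hessz f p = 0 -> a = 0) ->
  u *m hessxz f p + z *m hessz f p = 0 ->
  exists q : 'rV[R]_1 -> W * Z, [/\ smooth_at 0 q, q 0 = p, 'D_1%:M q 0 = (u, z) &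
    \forall h \near (0 : 'rV[R]_1), gradz f (q h) = 0].
Proof.
move=> sf gf nd uz; set B := hessxz f p in nd uz; set D := hessz f p in nd uz.
have Ds : D^T = D by exact: hessz_sym.
(* The first variable follows the given tangent vector; the second moves along the transpose of the
   linearized equation, which is normal to its solution space. *)
pose c' (x : 'rV[R]_1 * Z) : W * Z := (x.1 *m u + x.2 *m B^T, x.1 *m z + x.2 *m D).
pose c x := p + c' x.
have cE (h : R) v q : c (h *: v + q) = h *: c' v + c q.
  rewrite /c /c' addrCA; congr (_ + _).
  by congr (_, _); rewrite /= !mulmxDl -!scalemxAl scalerDr addrACA.
have c0 : c 0 = p by rewrite /c /c' /= !mul0mx !addr0.
have sc q : smooth_at q c.
  apply: smooth_atD; first exact: smooth_at_cst.
  apply: smooth_at_pair; apply: smooth_atD;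
    apply: smooth_at_mulmx; try exact: smooth_at_cst;
    by [apply: smooth_at_fst; exact: smooth_at_id|apply: smooth_at_snd; exact: smooth_at_id].
have Dc q v : 'D_v c q = c' v.
  rewrite -[RHS](@derive_id _ _ (c q)); apply: derive_line_eq.
  by near=> h; rewrite cE.
have sg : smooth_at p (gradz f) by exact: smooth_at_gradz.
have DF v : 'D_v (fun x => gradz f (c x)) 0 = (c' v).1 *m B + (c' v).2 *m D.
  rewrite derive_comp; last 2 first.
  - exact: smooth_at_differentiable.
  - by rewrite c0; exact: smooth_at_differentiable.
  by rewrite Dc c0 (surjective_pairing (c' v)) derive_gradz_pair.
(* The composite of the transpose with the linearized equation is a Gram matrix: paired with [e] it
   is a sum of two squared norms. *)
have inj (e : Z) : (e *m B^T) *m B + (e *m D) *m D = 0 -> e = 0.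
  move=> h.
  have : (e *m B^T) *m (e *m B^T)^T + (e *m D) *m (e *m D)^T = 0.
    by rewrite !trmx_mul trmxK Ds !mulmxA -mulmxDl h mul0mx.
  move=> /matrixP/(_ 0 0); rewrite mxE [RHS]mxE => /eqP.
  rewrite paddr_eq0 ?mulmx_tr_ge0// => /andP[/eqP h1 /eqP h2].
  by apply: nd; apply: mulmx_tr_eq0; rewrite [LHS]row_scalar ?h1 ?h2 raddf0.
have sF : smooth_at (0 : 'rV[R]_1, 0 : Z) (fun x => gradz f (c x)).
  by apply: (smooth_at_comp (g := gradz f) _ (sc _)); rewrite c0.
have [v|zeta [szeta zeta0 zetaP]] := implicit_function sF.
  by rewrite DF /c' /= !mul0mx !add0r; exact: inj.
pose q h := c (h, zeta h).
have q0 : q 0 = p by rewrite /q zeta0 c0.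
have sid : smooth_at (0 : 'rV[R]_1) (fun h => (h, zeta h)).
  by apply: smooth_at_pair => //; exact: smooth_at_id.
have sq : smooth_at 0 q by exact: (smooth_at_comp (g := c) _ sid).
pose e := 'D_1%:M zeta (0 : 'rV[R]_1).
have Dq : 'D_1%:M q 0 = c' (1%:M, e).
  rewrite /q derive_comp; last 2 first.
  - exact: smooth_at_differentiable.
  - exact: smooth_at_differentiable.
  rewrite Dc derive_pair; [|apply: smooth_at_differentiable; exact: smooth_at_id|exact: smooth_at_differentiable].
  by rewrite derive_id.
have qP : \forall h \near (0 : 'rV[R]_1), gradz f (q h) = 0.
  apply: filterS zetaP => h; rewrite /q => ->.
  by rewrite (_ : (0, 0) = 0 :> 'rV[R]_1 * Z)// c0.
exists q; split=> //.
(* The line is already tangent to first order, so the correction has zero velocity. *)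
have e0 : e = 0.
  have : 'D_1%:M (fun h => gradz f (q h)) 0 = 0.
    by rewrite (near_eq_derive (g := cst 0)) ?derive_cst.
  rewrite derive_comp; last 2 first.
  - exact: smooth_at_differentiable.
  - by rewrite q0; exact: smooth_at_differentiable.
  rewrite Dq q0 [c' _]surjective_pairing derive_gradz_pair//= !mul1mx !mulmxDl addrACA uz add0r.
  exact: inj.
by rewrite Dq e0 /c' /= !mul1mx !mul0mx !addr0.
Unshelve. all: by end_near. Qed.
End MixedHessian.

HB.instance Definition _ (R : realType) m n := GRing.isLinear.Build R
  ('rV[R]_m * 'rV[R]_n)%type 'rV[R]_(m + n) *:%R (@row_pair R m n) (@row_pair_linear R m n).

Section LegendrianTangent.
Context {R : realType} {n s : nat}.
Local Notation W := 'rV[R]_n.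
Local Notation Z := 'rV[R]_s.

(** A tangent vector is realized by a curve of critical points; the 1-jets along this curve factor
    through the chart [c], so their velocity lies in the row space of its Jacobian. *)
Lemma lagr_tangent_chart (f : W * Z -> R) p (u0 : W) (c : W -> R * (W * W)) c' :
  smooth_at p f -> gradz f p = 0 ->
  (forall a : Z, a *m (hessxz f p)^T = 0 -> a *m hessz f p = 0 -> a = 0) ->
  smooth_at u0 c -> smooth_at (jet1 f p) c' -> c' (jet1 f p) = u0 ->
  (\forall q \near p, gradz f q = 0 -> c (c' (jet1 f q)) = jet1 f q) ->
  (lagr_tangent (hessx f p) (hessxz f p) (hessz f p)
     <= jacobian (fun u => row_pair (c u).2) u0)%MS.
Proof.
move=> sf gf nd sc sc' c'0 leg; apply/rV_subP => v.
rewrite -[v]hsubmxK => /lagr_tangentP[t].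
set u := lsubmx v; set x := rsubmx v => uB ->.
have [q [sq q0 Dq qP]] := critical_curve sf gf nd uB.
have sj : smooth_at 0 (fun h => jet1 f (q h)).
  by apply: (smooth_at_comp (g := jet1 f) _ sq); rewrite q0; exact: smooth_at_jet1.
have sm : smooth_at 0 (fun h => c' (jet1 f (q h))).
  by apply: (smooth_at_comp (g := c') _ sj); rewrite q0.
have E : \forall h \near (0 : 'rV[R]_1),
    row_pair (c (c' (jet1 f (q h)))).2 = row_pair ((q h).1, grad_x f (q h)).
  have lq := smooth_at_near_comp (P := fun y => gradz f y = 0 -> c (c' (jet1 f y)) = jet1 f y) sq.
  rewrite q0 in lq.
  by apply: filterS2 (lq leg) qP => h h1 h2; rewrite h1.
have sJ : smooth_at u0 (fun u => row_pair (c u).2).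
  apply: (smooth_at_comp (g := row_pair)); first exact: smooth_at_snd.
  exact/smooth_at_linear/findim_linear_continuous.
have := near_eq_derive 1%:M E.
rewrite (derive_comp (g := fun u => row_pair (c u).2)); last 2 first.
- exact: smooth_at_differentiable.
- by rewrite q0 c'0; exact: smooth_at_differentiable.
rewrite q0 c'0 deriveEjacobian; last exact: smooth_at_differentiable.
move=> h; suff <- : 'D_1%:M (fun h => row_pair ((q h).1, grad_x f (q h))) (0 : 'rV[R]_1) =
    row_mx u (u *m hessx f p + t *m (hessxz f p)^T) by rewrite -h; exact: submxMl.
have sg : smooth_at 0 (fun h => grad_x f (q h)).
  by apply: (smooth_at_comp (g := grad_x f) _ sq); rewrite q0; exact: smooth_at_grad_x.
rewrite (derive_comp (f := fun h => ((q h).1, grad_x f (q h))) (g := row_pair)); last 2 first.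
- by apply: smooth_at_differentiable; apply: smooth_at_pair => //; exact: smooth_at_fst.
- exact: findim_linear_differentiable.
rewrite derive_linear derive_pair; last 2 first.
- by apply: smooth_at_differentiable; exact: smooth_at_fst.
- exact: smooth_at_differentiable.
rewrite derive_fst ?Dq; last exact: smooth_at_differentiable.
rewrite (derive_comp (g := grad_x f)); last 2 first.
- exact: smooth_at_differentiable.
- by rewrite q0; exact/smooth_at_differentiable/smooth_at_grad_x.
by rewrite Dq q0 derive_grad_x.
Qed.

(** A right inverse [L] of the Jacobian makes [h u *m L] a local diffeomorphism; its inverse
    composed with [L] is a smooth left inverse of [h]. *)
Lemma immersion_injective m (h : W -> 'rV[R]_m) (u0 : W) : smooth_at u0 h ->
  row_free (jacobian h u0) ->
  exists h' : 'rV[R]_m -> W, smooth_at (h u0) h' /\ \forall u \near u0, h' (h u) = u.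
Proof.
move=> sh /row_freeP[L JL].
have Ld y : smooth_at y (fun x : 'rV[R]_m => x *m L).
  by apply: smooth_at_mulmx; [exact: smooth_at_id|exact: smooth_at_cst].
have sG : smooth_at u0 (fun u => h u *m L) by apply: smooth_at_mulmx => //; exact: smooth_at_cst.
have J1 : jacobian (fun u => h u *m L) u0 = 1%:M.
  apply/row_matrixP => i; rewrite !rowE -deriveEjacobian; last exact: smooth_at_differentiable.
  rewrite derive_mulmx; [|exact: smooth_at_differentiable|exact: smooth_at_differentiable (smooth_at_cst _ _)].
  rewrite derive_cst mulmx0 addr0 deriveEjacobian; last exact: smooth_at_differentiable.
  by rewrite -mulmxA JL.
have [|g [_ _ sg gG _]] := inverse_function sG; first by rewrite J1 unitmx1.
exists (fun x => g (x *m L)); split=> //.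
exact: (smooth_at_comp (g := g) _ (Ld _)).
Qed.
End LegendrianTangent.

(** * Adjoining base directions to the fibre variables *)

Section Subspace.
Context {R : realType} {k n : nat} (b : 'M[R]_(k, n)).
Hypothesis fb : row_free b.

Lemma gram_unit : b *m b^T \in unitmx.
Proof.
rewrite -row_free_unit -kermx_eq0; apply/eqP; set N := kermx (b *m b^T).
have Nb : N *m b = 0.
  by apply: mulmx_tr_eq0; rewrite trmx_mul !mulmxA -(mulmxA N) mulmx_ker mul0mx.
by have /row_freeP[Z bZ] := fb; rewrite -[N]mulmx1 -bZ mulmxA Nb mul0mx.
Qed.

(** Coordinates, with respect to the rows of [b], of the orthogonal projection to their span;
    [orthpart] is the orthogonal projector to the complement. *)
Definition coordpart : 'M[R]_(n, k) := b^T *m invmx (b *m b^T).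
Definition orthpart : 'M[R]_n := 1%:M - coordpart *m b.

Lemma mul_coordpart : b *m coordpart = 1%:M.
Proof. by rewrite mulmxA mulmxV// gram_unit. Qed.

Lemma mul_orthpart : b *m orthpart = 0.
Proof. by rewrite mulmxBr mulmx1 mulmxA mul_coordpart mul1mx subrr. Qed.

Lemma orthpart_coord : orthpart *m coordpart = 0.
Proof. by rewrite mulmxBl mul1mx -mulmxA mul_coordpart mulmx1 subrr. Qed.

Lemma orthpart_idem : orthpart *m orthpart = orthpart.
Proof. by rewrite {1}/orthpart mulmxBl mul1mx -mulmxA mul_orthpart mulmx0 subr0. Qed.

Lemma orthpart_sum (x : 'rV[R]_n) : x *m orthpart + x *m coordpart *m b = x.
Proof. by rewrite mulmxBr mulmx1 mulmxA subrK. Qed.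
End Subspace.

Section Pullback.
Context {R : realType} {n s k : nat} (b : 'M[R]_(k, n)).
Local Notation W := 'rV[R]_n.
Local Notation Z := 'rV[R]_s.
Implicit Types f : W * Z -> R.

(** The first [k] fibre variables move [x] along the rows of [b]. The base keeps all of its [n]
    coordinates, so the parametrization is redundant; [unexpand] inverts it on the slice through
    [x0] orthogonal to these rows. *)
Definition expand (q : W * 'rV[R]_(k + s)) : W * Z := (q.1 + lsubmx q.2 *m b, rsubmx q.2).

Lemma expand_linear : linear expand.
Proof.
move=> a u v; rewrite /expand /= !linearP /= mulmxDl -scalemxAl.
by congr (_, _); rewrite /= scalerDr addrACA.
Qed.

Lemma smooth_at_expand q : smooth_at q expand.
Proof.
apply: (@smooth_at_linear _ _ _ _ (HB.pack expand
  (GRing.isLinear.Build _ _ _ _ _ expand_linear) : {linear _ -> _})).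
exact: findim_linear_continuous.
Qed.

Lemma derive_expand (V : normedModType R) (F : W * Z -> V) q v :
  'D_v (fun y => F (expand y)) q = 'D_(expand v) F (expand q).
Proof. by apply: derive_line_eq; near=> h; rewrite expand_linear.
Unshelve. all: by end_near. Qed.

Lemma gradz_expand f q : differentiable f (expand q) ->
  gradz (fun y => f (expand y)) q = row_mx (grad_x f (expand q) *m b^T) (gradz f (expand q)).
Proof.
move=> df; apply/rowP => j; rewrite mxE /dz derive_expand.
rewrite (derive_pair_sum _ _ df).
have e (v : 'rV[R]_(k + s)) : v 0 j = (delta_mx (0 : 'I_1) j *m v^T) 0 0.
  by rewrite -rowE !mxE.
rewrite e tr_row_mx -[delta_mx 0 j]hsubmxK mul_row_col row_mxKl row_mxKr add0r mxE.
rewrite trmx_mul trmxK mulmxA.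
by congr (_ + _); rewrite [RHS]mxE; apply: eq_bigr => i _; rewrite !mxE.
Qed.

Lemma hessz_expand f q : smooth_at (expand q) f ->
  hessz (fun y => f (expand y)) q =
    block_mx (b *m hessx f (expand q) *m b^T) (b *m hessxz f (expand q))
             (b *m hessxz f (expand q))^T (hessz f (expand q)).
Proof.
move=> sf.
pose F y : 'rV[R]_(k + s) := row_pair (grad_x f y *m b^T, gradz f y).
have sx : smooth_at (expand q) (fun y => grad_x f y *m b^T).
  by apply: smooth_at_mulmx; [exact: smooth_at_grad_x|exact: smooth_at_cst].
have sF : smooth_at q (fun y => f (expand y)) by exact: smooth_at_comp (smooth_at_expand q) sf.
apply/row_matrixP => i; rewrite !rowE -derive_gradz//.
rewrite (near_eq_derive (g := fun y => F (expand y))); last first.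
  have := smooth_at_near_comp (smooth_at_expand q) (smooth_at_near sf).
  apply: filterS => y sy; rewrite gradz_expand//; exact: smooth_at_differentiable.
rewrite derive_expand /F derive_comp; last 2 first.
- apply: smooth_at_differentiable; apply: smooth_at_pair => //; exact: smooth_at_gradz.
- exact: findim_linear_differentiable.
rewrite derive_linear derive_pair; last 2 first.
- exact: smooth_at_differentiable.
- exact/smooth_at_differentiable/smooth_at_gradz.
rewrite derive_mulmx; last 2 first.
- exact/smooth_at_differentiable/smooth_at_grad_x.
- exact: smooth_at_differentiable (smooth_at_cst _ _).
rewrite derive_cst mulmx0 addr0 /expand derive_grad_x// derive_gradz_pair//.
rewrite -[delta_mx 0 i](@hsubmxK _ _ k s); set u := lsubmx _; set v := rsubmx _.
rewrite mul_row_block row_mxKl row_mxKr add0r /row_pair /=.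
by rewrite trmx_mul !mulmxDl !mulmxA.
Qed.

Hypothesis fb : row_free b.
Variable x0 : W.

Definition unexpand (q : W * Z) : W * 'rV[R]_(k + s) :=
  (x0 + (q.1 - x0) *m orthpart b, row_mx ((q.1 - x0) *m coordpart b) q.2).

Lemma expand_unexpand q : expand (unexpand q) = q.
Proof.
by rewrite /expand /= row_mxKl row_mxKr -addrA orthpart_sum addrC subrK; case: q.
Qed.

(** The inverse only exists for base points on the slice. The condition refers to a point [q]
    because it will be applied to fibred maps, which keep the base component of [unexpand q]. *)
Lemma unexpand_expand q v : v.1 = (unexpand q).1 -> unexpand (expand v) = v.
Proof.
case: v => v1 v2 /= ->; rewrite /unexpand /expand /=; move: (q.1 - x0) => d.
have -> : x0 + d *m orthpart b + lsubmx v2 *m b - x0 = d *m orthpart b + lsubmx v2 *m b.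
  by rewrite -!addrA addrC !addrA subrK.
rewrite !mulmxDl -!mulmxA (orthpart_coord fb) (mul_orthpart fb) (mul_coordpart fb).
rewrite (orthpart_idem fb) !mulmx0 mulmx1 addr0 add0r; by rewrite hsubmxK.
Qed.

Lemma smooth_at_unexpand q : smooth_at q unexpand.
Proof.
have s1 : smooth_at q (fun q : W * Z => q.1 - x0).
  by apply: smooth_atB; [apply: smooth_at_fst; exact: smooth_at_id|exact: smooth_at_cst].
have s2 := smooth_at_mulmx s1 (smooth_at_cst _ (coordpart b)).
apply: smooth_at_pair.
  apply: smooth_atD; first exact: smooth_at_cst.
  exact: smooth_at_mulmx s1 (smooth_at_cst _ _).
apply: (smooth_at_comp (f := fun q : W * Z => ((q.1 - x0) *m coordpart b, q.2)) (g := row_pair)).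
  by apply: smooth_at_pair => //; apply: smooth_at_snd; exact: smooth_at_id.
exact/smooth_at_linear/findim_linear_continuous.
Qed.
End Pullback.

Section LagrCongruence.
Context {R : realType}.

(** The prescribed matrices are theta-Hessians multiplied by positive values of the inverse boundary
    defining function, which may differ at the two points. *)
Lemma scaled_signature_congruence n (D1 D2 : 'M[R]_n) (a1 a2 : R) :
  D1^T = D1 -> D2^T = D2 -> 0 < a1 -> 0 < a2 -> \rank D1 = \rank D2 ->
  signature (a1 *: D1) = signature (a2 *: D2) ->
  exists2 G : 'M[R]_n, G \in unitmx & D1 = G *m D2 *m G^T.
Proof.
move=> D1s D2s a1_gt0 a2_gt0 rk sg.
have [||//||G uG GE] := @signature_congruence _ _ (a1 *: D1) (a2 *: D2).
- by rewrite linearZ /= D1s.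
- by rewrite linearZ /= D2s.
- by rewrite !mxrank_scale_nz ?gt_eqF.
(* A scalar factor enters a congruence squared, so the square root absorbs the ratio of the two
   multiples. *)
exists (Num.sqrt (a2 / a1) *: G).
  by rewrite unitmxZ// unitfE sqrtr_eq0 -ltNge divr_gt0.
rewrite linearZ /= -!scalemxAl -scalemxAr scalerA -expr2 sqr_sqrtr; last exact/ltW/divr_gt0.
move: GE; rewrite -scalemxAr -scalemxAl mulrC => /(congr1 (GRing.scale a1^-1)).
by rewrite !scalerA mulVf ?gt_eqF// scale1r.
Qed.

(** The rows of [b] are the common image of the two kernels, and b B_i K_i^T = b b^T gives both
    pairings the same invertible matrix. The last clause makes the part of [u] orthogonal to [b],
    together with the [b]-components of [x], coordinates on the tangent space. *)
Lemma lagr_block_congruence d s (A1 A2 : 'M[R]_d) (B1 B2 : 'M[R]_(d, s)) (D1 D2 : 'M[R]_s)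
    (a1 a2 : R) :
  A1^T = A1 -> A2^T = A2 -> D1^T = D1 -> D2^T = D2 ->
  (forall a : 'rV[R]_s, a *m B1^T = 0 -> a *m D1 = 0 -> a = 0) ->
  (forall a : 'rV[R]_s, a *m B2^T = 0 -> a *m D2 = 0 -> a = 0) ->
  (lagr_tangent A1 B1 D1 :=: lagr_tangent A2 B2 D2)%MS ->
  0 < a1 -> 0 < a2 -> signature (a1 *: D1) = signature (a2 *: D2) ->
  exists k (b : 'M[R]_(k, d)) (H : 'M[R]_(k + s)),
    let M A B D := block_mx (b *m A *m b^T) (b *m B) (b *m B)^T D in
    [/\ row_free b, M A1 B1 D1 \in unitmx, H \in unitmx,
        M A1 B1 D1 = H *m M A2 B2 D2 *m H^T &
        forall u x : 'rV[R]_d, (row_mx u x <= lagr_tangent A1 B1 D1)%MS ->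
          u *m orthpart b = 0 -> x *m b^T = 0 -> row_mx u x = 0].
Proof.
move=> A1s A2s D1s D2s nd1 nd2 tE a1_gt0 a2_gt0 sg.
have [k [K1 [K2 [[KD1 r1 KK] [KD2 r2] fb]]]] := lagr_kernel nd1 nd2 tE.
set b := K1 *m B1^T in KK fb.
pose S := b *m b^T; have uS : S \in unitmx by exact: gram_unit.
have BK1 : b *m B1 *m K1^T = S by rewrite /S {3}/b trmx_mul trmxK mulmxA.
have BK2 : b *m B2 *m K2^T = S by rewrite /S [in X in _ = _ *m X]KK trmx_mul trmxK mulmxA.
have rk : \rank D1 = \rank D2 by apply/eqP; rewrite -(eqn_add2r k) r1 r2.
have [G uG DE] := scaled_signature_congruence D1s D2s a1_gt0 a2_gt0 rk sg.
have sandwich (A : 'M[R]_d) : A^T = A -> (b *m A *m b^T)^T = b *m A *m b^T.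
  by move=> As; rewrite [LHS]trmx_mul trmxK [(b *m A)^T]trmx_mul As mulmxA.
have [H HE] := block_congruence (sandwich _ A1s) (sandwich _ A2s) D1s D2s KD1 KD2 BK1 BK2 uS r1 r2 uG DE.
have uM : block_mx (b *m A1 *m b^T) (b *m B1) (b *m B1)^T D1 \in unitmx.
  by apply: (hessian_block_unit _ D1s KD1 _ r1); rewrite BK1.
exists k, b, H; split=> //.
  by move: uM; rewrite HE -mulmxA unitmx_mul => /andP[].
move=> u x /lagr_tangentP[t uB xE] uP xb.
have tK m (a : 'M[R]_(m, k)) : a *m S = 0 -> a = 0.
  by move=> /(congr1 (mulmx^~ (invmx S))); rewrite mulmxK// mul0mx.
have DK1 : D1 *m K1^T = 0 by rewrite -[LHS]trmxK trmx_mul trmxK D1s KD1 trmx0.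
(* Pairing u B1 + t D1 = 0 with [K1] shows that [u] is orthogonal to the rows of [b], in whose span
   it lies. *)
have ub : u *m b^T = 0.
  rewrite /b trmx_mul trmxK mulmxA -[u *m B1](addrK (t *m D1)) uB sub0r mulNmx -mulmxA DK1.
  by rewrite mulmx0 oppr0.
have u0 : u = 0.
  have uE : u = u *m coordpart b *m b by rewrite -{1}(orthpart_sum b u) uP add0r.
  suff h : u *m coordpart b = 0 by rewrite uE h mul0mx.
  by apply: tK; rewrite /S mulmxA -uE ub.
move: uB xE; rewrite u0 !mul0mx !add0r => tD xE.
have /submxP[al tE'] : (t <= K1)%MS.
  have fK1 : row_free K1 by apply: (@unitmx_pairing_row_free _ _ _ (b *m B1)); rewrite BK1.
  apply: submx_trans (kermx_basis fK1 KD1 r1); exact/sub_kermxP.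
have al0 : al = 0.
  by apply: tK; rewrite /S mulmxA [al *m b]mulmxA -tE' -xE xb.
by rewrite xE tE' al0 !mul0mx row_mx0.
Qed.
End LagrCongruence.

Section TangentJacobian.
Context {R : realType} {n s : nat}.
Local Notation W := 'rV[R]_n.
Local Notation Z := 'rV[R]_s.

(** The tangent space has dimension [n] and is contained in the span of the [n] rows of the
    Jacobian, so the two coincide and the chart is an immersion even after the value of the jet is
    dropped. *)
Lemma lagr_tangent_jacobian (f : W * Z -> R) p (u0 : W) (c : W -> R * (W * W)) c' :
  smooth_at p f -> gradz f p = 0 ->
  (forall a : Z, a *m (hessxz f p)^T = 0 -> a *m hessz f p = 0 -> a = 0) ->
  smooth_at u0 c -> smooth_at (jet1 f p) c' -> c' (jet1 f p) = u0 ->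
  (\forall q \near p, gradz f q = 0 -> c (c' (jet1 f q)) = jet1 f q) ->
  (lagr_tangent (hessx f p) (hessxz f p) (hessz f p) :=:
     jacobian (fun u => row_pair (c u).2) u0)%MS /\
  row_free (jacobian (fun u => row_pair (c u).2) u0).
Proof.
move=> sf gf nd sc sc' c'0 leg.
have sub := lagr_tangent_chart sf gf nd sc sc' c'0 leg.
have rk := lagr_tangent_rank (hessx f p) (hessz_sym sf) nd.
move: sub rk; move: (lagr_tangent _ _ _) (jacobian _ _) => T J sub rk.
have rJ : row_free J by rewrite /row_free eqn_leq rank_leq_row -{1}rk mxrankS.
split=> //; apply/eqmxP.
by rewrite sub andTb -(mxrank_leqif_sup sub) rk (eqP rJ).
Qed.
End TangentJacobian.

Section LegendrianMorse.
Context {R : realType} {n s : nat}.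
Local Notation W := 'rV[R]_n.
Local Notation Z := 'rV[R]_s.

(* The critical points of the two pulled back functions over [w] have the same 1-jet: both are
   determined by their image under the immersion [h]. *)
Lemma critical_values_eq k (b : 'M[R]_(k, n)) (f1 f2 : W * Z -> R) (x0 : W) p1 p2
    (z1 z2 : W -> 'rV[R]_(k + s)) (c : W -> R * (W * W)) (c' : R * (W * W) -> W) u0 :
  row_free b -> smooth_at x0 z1 -> smooth_at x0 z2 ->
  expand b (x0, z1 x0) = p1 -> expand b (x0, z2 x0) = p2 ->
  smooth_at p1 f1 -> smooth_at p2 f2 -> jet1 f1 p1 = jet1 f2 p2 ->
  smooth_at u0 c -> smooth_at (jet1 f1 p1) c' -> c' (jet1 f1 p1) = u0 ->
  (\forall q \near p1, gradz f1 q = 0 -> c (c' (jet1 f1 q)) = jet1 f1 q) ->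
  (\forall q \near p2, gradz f2 q = 0 -> c (c' (jet1 f2 q)) = jet1 f2 q) ->
  (\forall w \near x0, gradz (fun q => f1 (expand b q)) (w, z1 w) = 0) ->
  (\forall w \near x0, gradz (fun q => f2 (expand b q)) (w, z2 w) = 0) ->
  (forall v : W, v *m jacobian (fun u => row_pair (c u).2) u0
                   *m block_mx (orthpart b) 0 0 b^T = 0 -> v = 0) ->
  \forall w \near x0, f1 (expand b (w, z1 w)) = f2 (expand b (w, z2 w)).
Proof.
move=> fb sz1 sz2 e1 e2; rewrite -e1 -e2 => sf1 sf2 jet12 sc sc' c'0 leg1 leg2 cr1 cr2 imm.
(* Keeps the part of the base point orthogonal to [b] and the [b]-components of the gradient. *)
pose h u := row_pair (c u).2 *m block_mx (orthpart b) 0 0 b^T.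
have sp : smooth_at u0 (fun u => row_pair (c u).2).
  apply: (smooth_at_comp (g := row_pair)); first exact: smooth_at_snd.
  exact/smooth_at_linear/findim_linear_continuous.
have sh : smooth_at u0 h by apply: smooth_at_mulmx => //; exact: smooth_at_cst.
have Jh : jacobian h u0 = jacobian (fun u => row_pair (c u).2) u0 *m block_mx (orthpart b) 0 0 b^T.
  apply/row_matrixP => i; rewrite !rowE -deriveEjacobian; last exact: smooth_at_differentiable.
  rewrite derive_mulmx; [|exact: smooth_at_differentiable|exact: smooth_at_differentiable (smooth_at_cst _ _)].
  rewrite derive_cst mulmx0 addr0 deriveEjacobian; last exact: smooth_at_differentiable.
  by rewrite mulmxA.
have [|h' [sh' h'h]] := immersion_injective sh.
  rewrite -kermx_eq0; apply/eqP/row_matrixP => i; rewrite row0; apply: imm.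
  by rewrite -mulmxA -Jh -row_mul mulmx_ker row0.
(* The critical value over [w] is computed by an expression in [w], [c] and [h'] in which [f] no
   longer occurs. *)
have key (f : W * Z -> R) (z : W -> 'rV[R]_(k + s)) : smooth_at x0 z ->
    smooth_at (expand b (x0, z x0)) f -> smooth_at (jet1 f (expand b (x0, z x0))) c' ->
    c' (jet1 f (expand b (x0, z x0))) = u0 ->
    (\forall q \near expand b (x0, z x0), gradz f q = 0 -> c (c' (jet1 f q)) = jet1 f q) ->
    (\forall w \near x0, gradz (fun q => f (expand b q)) (w, z w) = 0) ->
    \forall w \near x0, f (expand b (w, z w)) = (c (h' (row_mx (w *m orthpart b) 0))).1.
  move=> sz sf sc1 c1 leg cr.
  have sw : smooth_at x0 (fun w => (w, z w)).
    by apply: smooth_at_pair => //; exact: smooth_at_id.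
  have se : smooth_at x0 (fun w => expand b (w, z w)).
    exact: (smooth_at_comp (g := expand b) _ sw (smooth_at_expand b _)).
  have sj : smooth_at x0 (fun w => jet1 f (expand b (w, z w))).
    exact: (smooth_at_comp (g := jet1 f) _ se (smooth_at_jet1 sf)).
  have su : smooth_at x0 (fun w => c' (jet1 f (expand b (w, z w)))).
    exact: (smooth_at_comp (g := c') _ sj sc1).
  have n1 := smooth_at_near_comp se leg.
  have n2 := smooth_at_near_comp se (smooth_at_near sf).
  have n3 : \forall w \near x0, h' (h (c' (jet1 f (expand b (w, z w))))) =
      c' (jet1 f (expand b (w, z w))).
    by apply: (smooth_at_near_comp (P := fun u => h' (h u) = u) su); rewrite c1.
  apply: filterS2 (near_and n1 n2) (near_and n3 cr) => w [w1 w2] [w3].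
  rewrite gradz_expand; last exact: smooth_at_differentiable.
  move=> /eqP; rewrite -[X in _ == X]row_mx0 => /eqP/eq_row_mx[w4 w5].
  suff <- : h (c' (jet1 f (expand b (w, z w)))) = row_mx (w *m orthpart b) 0.
    by rewrite w3 w1.
  rewrite /h w1// /row_pair /= mul_row_block !mulmx0 addr0 add0r w4.
  by rewrite mulmxDl -mulmxA mul_orthpart// mulmx0 addr0.
have k1 := key _ _ sz1 sf1 sc' c'0 leg1 cr1.
have k2 : \forall w \near x0, f2 (expand b (w, z2 w)) = (c (h' (row_mx (w *m orthpart b) 0))).1.
  by apply: key; rewrite // -?jet12.
by apply: filterS2 k1 k2 => w -> ->.
Qed.
End LegendrianMorse.

(** * Equivalence of generating functions of a Legendrian *)

Section LegendrianEquivalence.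
Context {R : realType} {n s : nat}.
Local Notation W := 'rV[R]_n.
Local Notation Z := 'rV[R]_s.

(** The vanishing x-gradient makes the base point critical in the adjoined variables as well. The
    equivalence of the pulled back functions fixes the base, hence respects the slice and descends
    through [expand]. *)
Lemma legendrian_morse (f1 f2 : W * Z -> R) (x0 : W) (t1 t2 : Z)
    (u0 : W) (c : W -> R * (W * W)) (c' : R * (W * W) -> W) (a1 a2 : R) :
  smooth_at (x0, t1) f1 -> smooth_at (x0, t2) f2 ->
  gradz f1 (x0, t1) = 0 -> gradz f2 (x0, t2) = 0 ->
  (forall a : Z, a *m (hessxz f1 (x0, t1))^T = 0 -> a *m hessz f1 (x0, t1) = 0 -> a = 0) ->
  (forall a : Z, a *m (hessxz f2 (x0, t2))^T = 0 -> a *m hessz f2 (x0, t2) = 0 -> a = 0) ->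
  jet1 f1 (x0, t1) = jet1 f2 (x0, t2) -> grad_x f1 (x0, t1) = 0 ->
  smooth_at u0 c -> smooth_at (jet1 f1 (x0, t1)) c' -> c' (jet1 f1 (x0, t1)) = u0 ->
  (\forall q \near (x0, t1), gradz f1 q = 0 -> c (c' (jet1 f1 q)) = jet1 f1 q) ->
  (\forall q \near (x0, t2), gradz f2 q = 0 -> c (c' (jet1 f2 q)) = jet1 f2 q) ->
  0 < a1 -> 0 < a2 ->
  signature (a1 *: hessz f1 (x0, t1)) = signature (a2 *: hessz f2 (x0, t2)) ->
  exists k k', local_diffeo (x0, t1) (x0, t2) k k' /\
    \forall q \near (x0, t1), f2 (k q) = f1 q.
Proof.
move=> sf1 sf2 gz1 gz2 nd1 nd2 jet12 gx1 sc sc' c'0 leg1 leg2 a1_gt0 a2_gt0 sg.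
have gx2 : grad_x f2 (x0, t2) = 0 by move: jet12 => [_ <-].
have [T1 fJ] := lagr_tangent_jacobian sf1 gz1 nd1 sc sc' c'0 leg1.
have sc'2 : smooth_at (jet1 f2 (x0, t2)) c' by rewrite -jet12.
have c'02 : c' (jet1 f2 (x0, t2)) = u0 by rewrite -jet12.
have [T2 _] := lagr_tangent_jacobian sf2 gz2 nd2 sc sc'2 c'02 leg2.
have tE := eqmx_trans T1 (eqmx_sym T2).
have [k [b [H /= [fb uM uH MH imm]]]] := lagr_block_congruence (hessx_sym sf1) (hessx_sym sf2)
  (hessz_sym sf1) (hessz_sym sf2) nd1 nd2 tE a1_gt0 a2_gt0 sg.
pose ez t : 'rV[R]_(k + s) := row_mx 0 t.
have ex t : expand b (x0, ez t) = (x0, t).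
  by rewrite /expand /= row_mxKl row_mxKr mul0mx addr0.
pose F1 q := f1 (expand b q); pose F2 q := f2 (expand b q).
have sF1 : smooth_at (x0, ez t1) F1.
  by apply: (smooth_at_comp (g := f1) _ (smooth_at_expand b _)); rewrite ex.
have sF2 : smooth_at (x0, ez t2) F2.
  by apply: (smooth_at_comp (g := f2) _ (smooth_at_expand b _)); rewrite ex.
have df1 : differentiable f1 (expand b (x0, ez t1)).
  by rewrite ex; exact: smooth_at_differentiable.
have df2 : differentiable f2 (expand b (x0, ez t2)).
  by rewrite ex; exact: smooth_at_differentiable.
have gF1 : gradz F1 (x0, ez t1) = 0 by rewrite (gradz_expand df1) ex gx1 gz1 mul0mx row_mx0.
have gF2 : gradz F2 (x0, ez t2) = 0 by rewrite (gradz_expand df2) ex gx2 gz2 mul0mx row_mx0.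
have hF1 := @hessz_expand _ _ _ _ b f1 (x0, ez t1); rewrite ex in hF1.
have hF2 := @hessz_expand _ _ _ _ b f2 (x0, ez t2); rewrite ex in hF2.
have uF : hessz F1 (x0, ez t1) \in unitmx by rewrite (hF1 sf1).
have HE : hessz F1 (x0, ez t1) = H *m hessz F2 (x0, ez t2) *m H^T by rewrite (hF1 sf1) (hF2 sf2); exact: MH.
have [zc1 [zc2 [m [m' [[sz1 z1 cr1] [sz2 z2 cr2] [m0 sm sm' m'm mm'] [fm fm'] mE]]]]] :=
  morse_equivalence sF1 sF2 gF1 gF2 uF uH HE.
have val : \forall w \near x0, f1 (expand b (w, zc1 w)) = f2 (expand b (w, zc2 w)).
  have e1 : expand b (x0, zc1 x0) = (x0, t1) by rewrite z1 ex.
  have e2 : expand b (x0, zc2 x0) = (x0, t2) by rewrite z2 ex.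
  apply: (critical_values_eq fb sz1 sz2 e1 e2 sf1 sf2 jet12 sc sc' c'0 leg1 leg2 cr1 cr2).
  move=> v; set v' := v *m _ => h.
  have v'0 : v' = 0.
    move: h; rewrite -[v']hsubmxK mul_row_block !mulmx0 addr0 add0r => /eqP.
    rewrite -[X in _ == X]row_mx0 => /eqP/eq_row_mx[h1 h2].
    by apply: imm h1 h2; rewrite T1 hsubmxK submxMl.
  have /row_freeP[Z0 JZ] := fJ.
  by rewrite -[v]mulmx1 -JZ mulmxA -/v' v'0 mul0mx.
pose e (q : W * Z) := unexpand b x0 q.
have eK q : expand b (e q) = q by exact: expand_unexpand.
have eE (q : W * Z) v : v.1 = (e q).1 -> e (expand b v) = v by exact: unexpand_expand.
have se q : smooth_at q e by exact: smooth_at_unexpand.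
have e0 t : e (x0, t) = (x0, ez t) by rewrite /e /unexpand /= subrr !mul0mx addr0.
have s1 : smooth_at (x0, t1) (fun q => m (e q)).
  by apply: (smooth_at_comp (g := m) _ (se _)); rewrite e0.
have s2 : smooth_at (x0, t2) (fun q => m' (e q)).
  by apply: (smooth_at_comp (g := m') _ (se _)); rewrite e0.
have n1 (P : W * 'rV[R]_(k + s) -> Prop) : (\forall q \near (x0, ez t1), P q) ->
    \forall q \near (x0, t1), P (e q).
  by rewrite -e0; exact: smooth_at_near_comp (se _).
have n2 (P : W * 'rV[R]_(k + s) -> Prop) : (\forall q \near (x0, ez t2), P q) ->
    \forall q \near (x0, t2), P (e q).
  by rewrite -e0; exact: smooth_at_near_comp (se _).
have m'0 : m' (x0, ez t2) = (x0, ez t1) by rewrite -m0; exact: (nbhs_singleton m'm).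
exists (fun q => expand b (m (e q))), (fun q => expand b (m' (e q))); split; first split.
- by rewrite e0 m0 ex.
- exact: (smooth_at_comp (g := expand b) _ s1 (smooth_at_expand b _)).
- exact: (smooth_at_comp (g := expand b) _ s2 (smooth_at_expand b _)).
- apply: filterS2 (n1 _ m'm) (n1 _ fm) => q h1 h2.
  by rewrite (eE _ _ h2) h1; exact: eK.
- apply: filterS2 (n2 _ mm') (n2 _ fm') => q h1 h2.
  by rewrite (eE _ _ h2) h1; exact: eK.
- have n3 : \forall q \near (x0, t1), f1 (expand b ((e q).1, zc1 (e q).1)) = f2 (expand b ((e q).1, zc2 (e q).1)).
    have s3 : smooth_at (x0, t1) (fun q => (e q).1) by exact: smooth_at_fst.
    apply: (smooth_at_near_comp (P := fun w => f1 (expand b (w, zc1 w)) = f2 (expand b (w, zc2 w))) s3).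
    by rewrite e0.
  apply: filterS2 (n1 _ mE) n3 => q h1 h2.
  by move: h1; rewrite /F1 /F2 h2 eK => /addIr.
Qed.

Lemma line_shift (V : lmodType R) (q d y v : V) (a b c : R) :
  y + a *: v = (q + b *: v) + (d - c *: v) -> y = q + d + (b - c - a) *: v.
Proof.
by move=> /(canRL (addrK _)) ->; rewrite !scalerBl addrACA !addrA.
Qed.

(* [G_i q = q + (f_i q - l q) v] straightens [f_i] to the linear form [l]. *)
Lemma submersion_equivalence (f1 f2 : W * Z -> R) p1 p2 (v : W * Z) :
  smooth_at p1 f1 -> smooth_at p2 f2 -> f1 p1 = f2 p2 ->
  'D_v f1 p1 != 0 -> 'D_v f2 p2 != 0 -> v != 0 ->
  exists k k', [/\ local_diffeo p1 p2 k k', \forall q \near p1, f2 (k q) = f1 q,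
    \forall q \near p1, exists a : R, k q = q + (p2 - p1) + a *: v &
    \forall q \near p2, exists a : R, k' q = q - (p2 - p1) + a *: v].
Proof.
move=> sf1 sf2 f12 d1 d2 v0.
have vv0 : (row_pair v *m (row_pair v)^T) 0 0 != 0.
  apply: contra v0 => /eqP h; apply/eqP; rewrite -(row_pairK v).
  have -> : row_pair v = 0 by apply: mulmx_tr_eq0; rewrite [LHS]row_scalar h raddf0.
  by rewrite /unrow_pair !linear0.
(* The orthogonal projection to the line of [v], normalized to take the value 1 at [v]. *)
pose l0 (q : W * Z) : R^o := ((row_pair v *m (row_pair v)^T) 0 0)^-1 * (row_pair q *m (row_pair v)^T) 0 0.
have ll : linear l0.
  by move=> a x y; rewrite /l0 linearP /= mulmxDl -scalemxAl !mxE mulrDr mulrCA.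
have [l lv] : exists l : {linear (W * Z)%type -> R}, l v = 1.
  pose l : {linear (W * Z)%type -> R} := HB.pack l0 (GRing.isLinear.Build _ _ _ _ _ ll).
  exists l; exact: mulVf.
have sl p : smooth_at p l by exact/smooth_at_linear/findim_linear_continuous.
pose G (f : W * Z -> R) q := q + (f q - l q) *: v.
have lG f q : l (G f q) = f q.
  by rewrite /G linearD linearZ /= lv [_ *: _]mulr1 addrC subrK.
have GP (f : W * Z -> R) p : smooth_at p f -> 'D_v f p != 0 ->
    exists g, local_diffeo p (G f p) (G f) g.
  move=> sf df.
  have sfl : smooth_at p (fun q => f q - l q) by exact: smooth_atB.
  have sG : smooth_at p (G f).
    apply: smooth_atD; first exact: smooth_at_id.
    apply: smooth_at_scale => //; exact: smooth_at_cst.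
  apply: inverse_function_pair => // u.
  have [_ Ds] := is_diff_scalef (smooth_at_differentiable sfl) (smooth_at_differentiable (smooth_at_cst p v)).
  have ds : differentiable (fun q => (f q - l q) *: v) p.
    by apply: smooth_at_differentiable; apply: smooth_at_scale => //; exact: smooth_at_cst.
  have -> : 'D_u (G f) p = u + ('D_u f p - l u) *: v.
    rewrite /G deriveD; [|exact/diff_derivable/smooth_at_differentiable/smooth_at_id|exact: diff_derivable].
    rewrite derive_id Ds derive_cst scaler0 addr0 deriveB; last 2 first.
    - exact/diff_derivable/smooth_at_differentiable.
    - exact/diff_derivable/smooth_at_differentiable.
    by rewrite derive_linear.
  move=> /eqP; rewrite addr_eq0 -scaleNr opprB => /eqP uE.
  set a := l u - 'D_u f p in uE.
  have lu : l u = a by rewrite {1}uE linearZ /= lv [_ *: _]mulr1.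
  have Du : 'D_u f p = a * 'D_v f p.
    have df' := smooth_at_differentiable sf.
    by rewrite {1}uE !deriveE// linearZ.
  have : a * 'D_v f p = 0 by rewrite -Du -[LHS](subKr (l u)) -/a lu subrr.
  by move=> /eqP; rewrite mulf_eq0 (negbTE df) orbF => /eqP a0; rewrite uE a0 scale0r.
have [g1 [_ sG1 sg1 gG1 Gg1]] := GP _ _ sf1 d1.
have [g2 [_ sG2 sg2 gG2 Gg2]] := GP _ _ sf2 d2.
(* The projection of [p2 - p1] to the kernel of [l] along [v]: this translation joins the
   straightened base points without changing the common linear form. *)
pose sh := (p2 - p1) - l (p2 - p1) *: v.
have lsh : l sh = 0 by rewrite linearB linearZ /= lv [_ *: _]mulr1 subrr.
have shE : G f1 p1 + sh = G f2 p2.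
  rewrite /G /sh addrACA (addrC p1) subrK -scaleNr -scalerDl f12; congr (_ + _ *: _).
  by rewrite linearB /= opprB addrA subrK.
have tr : local_diffeo (G f1 p1) (G f2 p2) (fun x => x + sh) (fun x => x - sh).
  split=> //.
  - by apply: smooth_atD; [exact: smooth_at_id|exact: smooth_at_cst].
  - by apply: smooth_atB; [exact: smooth_at_id|exact: smooth_at_cst].
  - by near=> x; rewrite addrK.
  - by near=> x; rewrite subrK.
have D1 : local_diffeo p1 (G f1 p1) (G f1) g1 by [].
have D2 : local_diffeo p2 (G f2 p2) (G f2) g2 by [].
have LD := local_diffeo_comp _ _ _ (local_diffeo_comp _ _ _ D1 tr) (local_diffeo_sym D2).
have n1 : \forall q \near p1, G f2 (g2 (G f1 q + sh)) = G f1 q + sh.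
  have s1 : smooth_at p1 (fun q => G f1 q + sh) by apply: smooth_atD => //; exact: smooth_at_cst.
  by apply: (smooth_at_near_comp (P := fun x => G f2 (g2 x) = x) s1); rewrite shE.
have n2 : \forall q \near p2, G f1 (g1 (G f2 q - sh)) = G f2 q - sh.
  have s2 : smooth_at p2 (fun q => G f2 q - sh) by apply: smooth_atB => //; exact: smooth_at_cst.
  by apply: (smooth_at_near_comp (P := fun x => G f1 (g1 x) = x) s2); rewrite -shE addrK.
exists (fun q => g2 (G f1 q + sh)), (fun q => g1 (G f2 q - sh)); split.
- exact: LD.
- apply: filterS n1 => q h.
  by rewrite -(lG f2) h linearD /= lsh addr0 lG.
(* All maps involved add multiples of [v] and a fixed displacement, which allows the preservation of
   the faces to be checked later. *)
- apply: filterS n1 => q; set y := g2 _ => h.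
  exists ((f1 q - l q) - l (p2 - p1) - (f2 y - l y)); exact: line_shift.
- apply: filterS n2 => q; set y := g1 _ => h.
  exists ((f2 q - l q) - (- l (p2 - p1)) - (f1 y - l y)); apply: line_shift.
  by rewrite scaleNr -opprD; exact: h.
Unshelve. all: by end_near. Qed.

Lemma legendrian_equivalence (f1 f2 : W * Z -> R) (x0 : W) (t1 t2 : Z)
    (u0 : W) (c : W -> R * (W * W)) (c' : R * (W * W) -> W) (a1 a2 : R) :
  smooth_at (x0, t1) f1 -> smooth_at (x0, t2) f2 ->
  gradz f1 (x0, t1) = 0 -> gradz f2 (x0, t2) = 0 ->
  (forall a : Z, a *m (hessxz f1 (x0, t1))^T = 0 -> a *m hessz f1 (x0, t1) = 0 -> a = 0) ->
  (forall a : Z, a *m (hessxz f2 (x0, t2))^T = 0 -> a *m hessz f2 (x0, t2) = 0 -> a = 0) ->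
  jet1 f1 (x0, t1) = jet1 f2 (x0, t2) ->
  smooth_at u0 c -> smooth_at (jet1 f1 (x0, t1)) c' -> c' (jet1 f1 (x0, t1)) = u0 ->
  (\forall q \near (x0, t1), gradz f1 q = 0 -> c (c' (jet1 f1 q)) = jet1 f1 q) ->
  (\forall q \near (x0, t2), gradz f2 q = 0 -> c (c' (jet1 f2 q)) = jet1 f2 q) ->
  0 < a1 -> 0 < a2 ->
  signature (a1 *: hessz f1 (x0, t1)) = signature (a2 *: hessz f2 (x0, t2)) ->
  exists k k', local_diffeo (x0, t1) (x0, t2) k k' /\
    \forall q \near (x0, t1), f2 (k q) = f1 q.
Proof.
move=> sf1 sf2 gz1 gz2 nd1 nd2 jet12 sc sc' c'0 leg1 leg2 a1_gt0 a2_gt0 sg.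
case: (pselect (grad_x f1 (x0, t1) = 0)) => [gx0|gx0].
  exact: (legendrian_morse sf1 sf2 gz1 gz2 nd1 nd2 jet12 gx0 sc sc' c'0 leg1 leg2 a1_gt0 a2_gt0 sg).
have [i gi] : exists i, grad_x f1 (x0, t1) 0 i != 0.
  apply: contra_notP gx0 => /forallNP h; apply/rowP => i; rewrite [RHS]mxE.
  by have /negP := h i; rewrite negbK => /eqP.
have d1 : 'D_(delta_mx 0 i, 0) f1 (x0, t1) != 0 by move: gi; rewrite mxE.
have f12 : f1 (x0, t1) = f2 (x0, t2) by case: jet12.
have d2 : 'D_(delta_mx 0 i, 0) f2 (x0, t2) != 0.
  have g12 : grad_x f1 (x0, t1) = grad_x f2 (x0, t2) by case: jet12.
  by move: gi; rewrite g12 mxE.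
have v0 : ((delta_mx 0 i, 0) : W * Z) != 0.
  by apply: contra d1 => /eqP ->; rewrite derive0.
have [k [k' [lk kf _ _]]] := submersion_equivalence sf1 sf2 f12 d1 d2 v0.
exists k, k'; exact: conj lk kf.
Qed.
End LegendrianEquivalence.

(** * The compactification *)

Section Euclid.
Context {R : realType}.

Lemma dotE n (u v : 'rV[R]_n) : dot u v = (u *m v^T) 0 0.
Proof. by rewrite mxE; apply: eq_bigr => i _; rewrite mxE. Qed.

Lemma dotC n (u v : 'rV[R]_n) : dot u v = dot v u.
Proof. by apply: eq_bigr => i _; rewrite mulrC. Qed.

Lemma dotDl n (u v w : 'rV[R]_n) : dot (u + v) w = dot u w + dot v w.
Proof. by rewrite !dotE mulmxDl mxE. Qed.

Lemma dotZl n a (u w : 'rV[R]_n) : dot (a *: u) w = a * dot u w.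
Proof. by rewrite !dotE -scalemxAl mxE. Qed.

Lemma dot0l n (w : 'rV[R]_n) : dot 0 w = 0.
Proof. by rewrite dotE mul0mx mxE. Qed.

Lemma dot_ge0 n (u : 'rV[R]_n) : 0 <= dot u u.
Proof. by rewrite dotE mulmx_tr_ge0. Qed.

Lemma dot_eq0 n (u : 'rV[R]_n) : (dot u u == 0) = (u == 0).
Proof.
apply/eqP/eqP => [h|->]; last exact: dot0l.
by apply: mulmx_tr_eq0; rewrite [LHS]row_scalar -dotE h raddf0.
Qed.

Lemma dot_delta n (u : 'rV[R]_n) j : dot u (delta_mx 0 j) = u 0 j.
Proof. by rewrite dotE trmx_delta -colE mxE. Qed.

Lemma enorm_ge0 n (u : 'rV[R]_n) : 0 <= enorm u.
Proof. exact: sqrtr_ge0. Qed.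

Lemma enorm_sqr n (u : 'rV[R]_n) : enorm u ^+ 2 = dot u u.
Proof. by rewrite sqr_sqrtr// dot_ge0. Qed.

Lemma enorm_eq0 n (u : 'rV[R]_n) : (enorm u == 0) = (u == 0).
Proof. by rewrite -dot_eq0 -enorm_sqr sqrf_eq0. Qed.

Lemma enorm_gt0 n (u : 'rV[R]_n) : (0 < enorm u) = (u != 0).
Proof. by rewrite lt_def enorm_ge0 andbT enorm_eq0. Qed.

Lemma enormZ n a (u : 'rV[R]_n) : enorm (a *: u) = `|a| * enorm u.
Proof.
by rewrite /enorm dotZl dotC dotZl mulrA -expr2 sqrtrM ?sqr_ge0// sqrtr_sqr.
Qed.

Lemma enorm_mul_orthogonal n (u : 'rV[R]_n) (Q : 'M[R]_n) : Q *m Q^T = 1%:M ->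
  enorm (u *m Q) = enorm u.
Proof. by move=> QQ; rewrite /enorm !dotE trmx_mul mulmxA -(mulmxA u) QQ mulmx1. Qed.

Lemma smooth_at_dot (U : normedModType R) n (p : U) (f g : U -> 'rV[R]_n) :
  smooth_at p f -> smooth_at p g -> smooth_at p (fun x => dot (f x) (g x)).
Proof.
move=> sf sg; apply: smooth_at_sum => i.
by apply: smooth_atM; exact: smooth_at_coord.
Qed.

Lemma smooth_at_enorm (U : normedModType R) n (p : U) (f : U -> 'rV[R]_n) :
  smooth_at p f -> f p != 0 -> smooth_at p (fun x => enorm (f x)).
Proof.
move=> sf fp; apply: smooth_at_sqrt; first exact: smooth_at_dot.
by rewrite lt_def dot_ge0 dot_eq0 fp.
Qed.

Lemma smooth_at_inv_enorm (U : normedModType R) n (p : U) (f : U -> 'rV[R]_n) :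
  smooth_at p f -> f p != 0 -> smooth_at p (fun x => (enorm (f x))^-1).
Proof.
by move=> sf fp; apply: smooth_atV; [exact: smooth_at_enorm|rewrite enorm_eq0].
Qed.

Lemma enorm_continuous n : continuous (@enorm R n).
Proof.
move=> x; apply: (@continuous_comp _ _ _ (fun x => dot x x) Num.sqrt).
  by apply: smooth_at_continuous; apply: smooth_at_dot; exact: smooth_at_id.
exact: sqrt_continuous.
Qed.

Lemma near_enorm_lt n (y : 'rV[R]_n) c : enorm y < c -> \forall z \near y, enorm z < c.
Proof. by move=> h; exact: (cvgr_lt _ (@enorm_continuous n y)). Qed.

Lemma near_enorm_gt n (y : 'rV[R]_n) c : c < enorm y -> \forall z \near y, c < enorm z.
Proof. by move=> h; exact: (cvgr_gt _ (@enorm_continuous n y)). Qed.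

Lemma inv_norm_algebra (e X t : R) : e != 0 ->
  X * (e^-1 * e ^+ 2) + e^-1 * (X * e ^+ 2 + e^-1 * (t + t)) = 0 -> X = - e^-1 ^+ 3 * t.
Proof.
move=> e0 h; have h2 : e * X + e * X + e^-1 ^+ 2 * (t + t) = 0 by rewrite -[RHS]h; field.
have -> : X = (e * X + e * X + e^-1 ^+ 2 * (t + t)) / (e + e) - e^-1 ^+ 3 * t.
  have : e + e != 0 by rewrite -mulr2n mulrn_eq0.
  by move=> ee; field; rewrite e0.
by rewrite h2 mul0r sub0r mulNr.
Qed.

(** Obtained by differentiating a^2 <x, x> = 1 for a = 1 / |x|, which needs only the product
    rule. *)
Lemma derive_inv_enorm n (z v : 'rV[R]_n) : z != 0 ->
  'D_v (fun x : 'rV[R]_n => (enorm x)^-1) z = - (enorm z)^-1 ^+ 3 * dot z v.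
Proof.
move=> z0; set a := fun x : 'rV[R]_n => (enorm x)^-1.
have sa : smooth_at z a by apply: smooth_at_inv_enorm => //; exact: smooth_at_id.
have sd : smooth_at z (fun x : 'rV[R]_n => dot x x).
  by apply: smooth_at_dot; exact: smooth_at_id.
have da := smooth_at_differentiable sa; have dd := smooth_at_differentiable sd.
have Dd : 'D_v (fun x : 'rV[R]_n => dot x x) z = dot z v + dot z v.
  have -> : (fun x : 'rV[R]_n => dot x x) = (fun x : 'rV[R]_n => (x *m x^T) 0 0).
    by apply/funext => x; rewrite dotE.
  have sT : smooth_at z (fun x : 'rV[R]_n => x^T) by apply: smooth_at_trmx; exact: smooth_at_id.
  have si : smooth_at z (fun x : 'rV[R]_n => x) by exact: smooth_at_id.
  rewrite derive_entry; last exact/smooth_at_differentiable/smooth_at_mulmx.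
  rewrite derive_mulmx; [|exact: smooth_at_differentiable|exact: smooth_at_differentiable].
  by rewrite derive_id derive_linear mxE -!dotE (dotC v).
have [_ D1] := is_diff_scalef da dd.
have sad : smooth_at z (fun x => a x *: (dot x x : R^o)) by exact: smooth_at_scale.
have [_ D2] := is_diff_scalef da (smooth_at_differentiable sad).
have h : 'D_v (fun x => a x *: (a x *: (dot x x : R^o))) z = 0.
  rewrite (near_eq_derive (g := fun=> 1 : R^o)); first exact: derive_cst.
  have : \forall x \near z, 0 < enorm x by apply: near_enorm_gt; rewrite enorm_gt0.
  apply: filterS => x x0; rewrite -enorm_sqr /a /GRing.scale /= expr2 mulrA mulrACA.
  by rewrite mulVf ?mulr1 ?gt_eqF.
have e0 : enorm z != 0 by rewrite enorm_eq0.
move: h; rewrite D2 D1 Dd /a -enorm_sqr; set X := 'D_v _ z => h.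
exact: inv_norm_algebra e0 h.
Qed.
End Euclid.

Section Compactification.
Context {R : realType} {n : nat} (K : compactification R n).

Lemma smooth_on_open (U V : normedModType R) (A : set U) (f : U -> V) p :
  open A -> smooth_on A f -> A p -> smooth_at p f.
Proof.
move=> oA sf Ap; have [D [g [oD Dp Cg gf]]] := sf p Ap.
apply: (@eq_smooth_at _ _ _ _ g); last by exists D.
have DA : nbhs p (D `&` A) by apply: filterI; exact: open_nbhs_nbhs.
by apply: filterS DA => q [Dq Aq]; exact: gf.
Qed.

Lemma open_oball : open (oball n : set 'rV[R]_n).
Proof.
by rewrite openE => y yb; exact: near_enorm_lt.
Qed.

Lemma smooth_at_iota x : smooth_at x (Defs.iota K).
Proof. by have [_ + _] := iota_diffeo K => /smooth_on_open; apply; [exact: openT|]. Qed.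

Lemma smooth_at_iota_inv y : oball n y -> smooth_at y (iota_inv K).
Proof. by have [_ _ +] := iota_diffeo K => /smooth_on_open; apply; exact: open_oball. Qed.

Lemma iota_oball x : oball n (Defs.iota K x).
Proof. by have [[+ _ _ _] _ _] := iota_diffeo K; apply. Qed.

Lemma iotaK x : iota_inv K (Defs.iota K x) = x.
Proof. by have [[_ _ + _] _ _] := iota_diffeo K; apply. Qed.

Lemma iota_invK y : oball n y -> Defs.iota K (iota_inv K y) = y.
Proof. by have [[_ _ _ +] _ _] := iota_diffeo K; apply. Qed.

Lemma smooth_at_bdf y : oball n y -> smooth_at y (bdf K).
Proof.
move=> yb; apply: smooth_atB; first exact: smooth_at_cst.
apply: (@smooth_on_open _ _ (oball n)) => //; first exact: open_oball.
move=> q qb; have qc : cball n q by exact: ltW.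
have [D [g [oD Dp Cg gf]]] := hfun_smooth K qc.
by exists D, g; split=> // z zb; apply: gf; exact: ltW.
Qed.

Lemma bdf_far y : 2 / 3 < enorm y <= 1 -> bdf K y = 1 - enorm y.
Proof. by move=> h; rewrite /bdf hfun_far. Qed.

(** Radius 2/3 is covered by neither [hfun_far] nor [hfun_near]; the formula reaches it by
    continuity from larger radii. *)
Lemma bdf_ray (e : 'rV[R]_n) t : enorm e = 1 -> 2 / 3 <= t <= 1 -> bdf K (t *: e) = 1 - t.
Proof.
move=> e1 /andP[t0 t1].
have tn (r : R) : 0 <= r -> enorm (r *: e) = r by move=> r0; rewrite enormZ e1 mulr1 ger0_norm.
have [t0'|t0'] := ltP (2 / 3) t.
  by rewrite bdf_far ?tn ?t0' //; apply: le_trans t0; lra.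
have -> : t = 2 / 3 by apply/eqP; rewrite eq_le t0 t0'.
apply/eqP; rewrite -subr_eq0; apply/negPn/negP => u0.
pose u t' := bdf K (t' *: e) - (1 - t').
have su : smooth_at (2 / 3 : R) u.
  have st : smooth_at (2 / 3 : R) (fun t' : R => t' *: e).
    by apply: smooth_at_scale; [exact: smooth_at_id|exact: smooth_at_cst].
  apply: smooth_atB.
    apply: (smooth_at_comp (g := bdf K) _ st); apply: smooth_at_bdf.
    by rewrite /oball /= tn; lra.
  by apply: smooth_atB; [exact: smooth_at_cst|exact: smooth_at_id].
have /nbhs_ballP[r /= r0 ru] : \forall t' \near (2 / 3 : R), u t' != 0.
  exact: (cvgr_neq0 _ (smooth_at_continuous su) u0).
(* The bound [r / 2] keeps [t'] in the ball where [u] is nonzero, and 1/6 keeps it below 1, where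
   the explicit formula makes [u] vanish. *)
pose t' := 2 / 3 + Num.min (r / 2) (1 / 6).
have m0 : 0 < Num.min (r / 2) (1 / 6) by rewrite lt_min; apply/andP; split; lra.
have m1 : Num.min (r / 2) (1 / 6) <= r / 2 by rewrite ge_min lexx.
have m2 : Num.min (r / 2) (1 / 6) <= 1 / 6 by rewrite ge_min lexx orbT.
have : u t' != 0.
  apply: ru; rewrite -ball_normE /ball_ /= /t' opprD addNKr normrN gtr0_norm//; lra.
rewrite /u bdf_far ?tn ?subrr ?eqxx//; rewrite /t'; lra.
Qed.

Lemma bdf_neq0 y : oball n y -> bdf K y != 0.
Proof.
move=> yb; have [y1|y1|y1] := ltgtP (enorm y) (2 / 3).
- exact: hfun_near.
- by rewrite bdf_far ?y1 ?(ltW yb)// subr_eq0 gt_eqF.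
- have y0 : enorm y != 0 by rewrite y1; apply/eqP; lra.
  have -> : y = enorm y *: ((enorm y)^-1 *: y) by rewrite scalerA mulfV// scale1r.
  rewrite bdf_ray ?y1; [apply/eqP; lra| |lra].
  by rewrite enormZ ger0_norm ?invr_ge0 ?enorm_ge0// -y1 mulVf.
Qed.

(** Along a ray the function is positive from radius 2/3 to the sphere and has no zero inside, so
    the intermediate value theorem fixes its sign. A positive dimension is what provides the ray. *)
Lemma bdf_gt0 y : (0 < n)%N -> oball n y -> 0 < bdf K y.
Proof.
move=> n0 yb.
have [e [e1 ye]] : exists e : 'rV[R]_n, enorm e = 1 /\ y = enorm y *: e.
  have [->|y0] := eqVneq y 0; last first.
    exists ((enorm y)^-1 *: y); rewrite scalerA mulfV ?enorm_eq0// scale1r; split=> //.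
    by rewrite enormZ ger0_norm ?invr_ge0 ?enorm_ge0// mulVf ?enorm_eq0.
  exists (delta_mx 0 (Ordinal n0)); split.
    rewrite /enorm dotE trmx_delta mul_delta_mx mxE !eqxx sqrtr1//.
  by apply/esym/eqP; rewrite scaler_eq0 enorm_eq0 eqxx.
have en t : 0 <= t -> enorm (t *: e) = t by move=> t0; rewrite enormZ e1 mulr1 ger0_norm.
rewrite lt_def bdf_neq0//= leNgt; apply/negP => neg.
have yt : enorm y < 2 / 3.
  rewrite ltNge; apply/negP => h; move: neg; rewrite ye bdf_ray ?e1 ?h ?(ltW yb)//.
  by rewrite subr_lt0 ltNge (ltW yb).
have tb t : enorm y <= t <= 2 / 3 -> oball n (t *: e).
  move=> /andP[h1 h2]; rewrite /oball /= en; [lra|exact: le_trans (enorm_ge0 y) h1].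
have cont : {within `[enorm y, 2 / 3], continuous (fun t : R => bdf K (t *: e))}.
  apply: continuous_in_subspaceT => t; rewrite inE /= in_itv /= => /tb tbb.
  apply: (@continuous_comp _ _ _ (fun t : R => t *: e) (bdf K)).
    by apply: smooth_at_continuous; apply: smooth_at_scale; [exact: smooth_at_id|exact: smooth_at_cst].
  by apply: smooth_at_continuous; exact: smooth_at_bdf.
have [|c] := @IVT R _ _ _ 0 (ltW yt) cont.
  rewrite -ye bdf_ray; [|by []|lra].
  by apply/andP; split; [rewrite ge_min (ltW neg)|rewrite le_max; apply/orP; right; lra].
rewrite in_itv /= => /tb cb /eqP; apply/negP; exact: bdf_neq0.
Qed.

Lemma inv_sub_gt3 (t : R) : 2 / 3 < t -> t < 1 -> 3 < (1 - t)^-1.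
Proof. by move=> t0 t1; rewrite -[ltLHS]invrK ltf_pV2 ?posrE; lra. Qed.

Lemma iota_inv_far y : 2 / 3 < enorm y -> enorm y < 1 ->
  iota_inv K y = (1 - enorm y)^-1 *: ((enorm y)^-1 *: y).
Proof.
move=> y1 y2; have y0 : 0 < enorm y by apply: lt_trans y1; lra.
set x := RHS.
have xn : enorm x = (1 - enorm y)^-1.
  rewrite /x !enormZ !ger0_norm ?invr_ge0 ?subr_ge0 ?enorm_ge0 ?(ltW y2)//.
  by rewrite mulVf ?mulr1 ?gt_eqF.
rewrite -[RHS]iotaK iota_far; last by rewrite xn; exact: inv_sub_gt3.
rewrite xn invrK /x !scalerA subKr; congr (iota_inv K _).
have a0 : 1 - enorm y != 0 by rewrite subr_eq0 gt_eqF.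
by rewrite mulfV// mul1r mulfV ?scale1r// gt_eqF.
Qed.
End Compactification.

Section FarDerivative.
Context {R : realType} {n : nat}.
Local Notation V := 'rV[R]_n.

Definition unit_dir (z : V) : V := (enorm z)^-1 *: z.

Lemma enorm_unit_dir z : z != 0 -> enorm (unit_dir z) = 1.
Proof.
by move=> z0; rewrite enormZ ger0_norm ?invr_ge0 ?enorm_ge0// mulVf ?enorm_eq0.
Qed.

Lemma smooth_at_unit_dir (U : normedModType R) (p : U) (f : U -> V) :
  smooth_at p f -> f p != 0 -> smooth_at p (fun x => unit_dir (f x)).
Proof. by move=> sf fp; apply: smooth_at_scale => //; exact: smooth_at_inv_enorm. Qed.

Lemma derive_unit_dir (z v : V) : z != 0 ->
  'D_v unit_dir z = (enorm z)^-1 *: (v - dot (unit_dir z) v *: unit_dir z).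
Proof.
move=> z0; have si : smooth_at z (fun x : V => x) by exact: smooth_at_id.
have [_ ->] := is_diff_scalef (smooth_at_differentiable (smooth_at_inv_enorm si z0))
  (smooth_at_differentiable si).
rewrite derive_inv_enorm// derive_id addrC scalerBr; congr (_ + _).
rewrite /unit_dir dotZl !scalerA -scaleNr; congr (_ *: _).
by rewrite exprSr expr2; ring.
Qed.

(* In polar coordinates at infinity [x = y / (|y| (1 - |y|))], the gradient of [g / (1 - |y|)]
   in [x] is [g N + |y| grad g + (1 - 2 |y|) <N, grad g> N] with [N = y / |y|]. *)
Definition far_grad (y : V) (c : R) (g : V) : V := \row_j
  (dot (unit_dir y) (delta_mx 0 j) * c +
   dot (enorm y *: delta_mx 0 j +
     ((1 - 2 * enorm y) * dot (unit_dir y) (delta_mx 0 j)) *: unit_dir y) g).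

Lemma smooth_at_far_grad (U : normedModType R) (p : U) (f g : U -> V) (c : U -> R) :
  smooth_at p f -> smooth_at p c -> smooth_at p g -> f p != 0 ->
  smooth_at p (fun x => far_grad (f x) (c x) (g x)).
Proof.
move=> sf sc sg p0; apply: smooth_at_mx => i j; rewrite ord1.
have sN : smooth_at p (fun x => unit_dir (f x)) by exact: smooth_at_unit_dir.
have sn : smooth_at p (fun x => enorm (f x)) by exact: smooth_at_enorm.
have sd : smooth_at p (fun x => dot (unit_dir (f x)) (delta_mx 0 j)).
  by apply: smooth_at_dot => //; exact: smooth_at_cst.
apply: (@eq_smooth_at _ _ _ _ (fun x => dot (unit_dir (f x)) (delta_mx 0 j) * c x +
   dot (enorm (f x) *: delta_mx 0 j +
     ((1 - 2 * enorm (f x)) * dot (unit_dir (f x)) (delta_mx 0 j)) *: unit_dir (f x)) (g x))).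
  by near=> x; rewrite mxE.
apply: smooth_atD; first exact: smooth_atM.
apply: smooth_at_dot; last exact: sg.
apply: smooth_atD; first by apply: smooth_at_scale => //; exact: smooth_at_cst.
apply: smooth_at_scale => //; apply: smooth_atM => //.
apply: smooth_atB; first exact: smooth_at_cst.
by apply: smooth_atM => //; exact: smooth_at_cst.
Unshelve. all: by end_near. Qed.

(** Here 1 - 2 |y| = -1: the value gives the radial component, as in Euler's relation, and only the
    tangential part of the gradient remains. *)
Lemma far_grad_sphere (y g : V) c : sphere n y ->
  far_grad y c g = c *: y + (g - dot y g *: y).
Proof.
move=> y1; apply/rowP => j; rewrite mxE /unit_dir y1 invr1 scale1r dotDl !dotZl.
rewrite dot_delta (dotC _ g) dot_delta !mxE; ring.
Qed.

Variable K : compactification R n.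

Lemma iota_far_scale (x : V) : 3 < enorm x ->
  Defs.iota K x = ((enorm x)^-1 - (enorm x)^-1 ^+ 2) *: x.
Proof. by move=> h; rewrite iota_far// scalerA mulrBl mul1r expr2. Qed.

Lemma bdf_iota_far (x : V) : 3 < enorm x -> bdf K (Defs.iota K x) = (enorm x)^-1.
Proof.
move=> h; have x0 : 0 < enorm x by apply: lt_trans h; lra.
have a1 : (enorm x)^-1 < 3^-1 by rewrite ltf_pV2 ?posrE.
have a0 : 0 < (enorm x)^-1 by rewrite invr_gt0.
have e : enorm (Defs.iota K x) = 1 - (enorm x)^-1.
  rewrite iota_far// !enormZ (@ger0_norm _ (enorm x)^-1) ?(ltW a0)//.
  by rewrite mulVf ?mulr1 ?gt_eqF// ger0_norm//; lra.
by rewrite bdf_far e; [rewrite subKr|lra].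
Qed.

Lemma sub_double (a b : R) : b - (b * a + a * b) = b - 2 * a * b.
Proof. by ring. Qed.

Lemma cube_mul_inv (a t : R) : a != 0 -> - a ^+ 3 * (a^-1 * t) = - a ^+ 2 * t.
Proof. by move=> a0; field. Qed.

Lemma inversion_coef (a t : R) : a != 0 ->
  a^-1 * (- a ^+ 2 * t - 2 * a * (- a ^+ 2 * t)) * a^-1 = (1 - 2 * (1 - a)) * t.
Proof. by move=> a0; field. Qed.

Lemma inv_mul_sub_sqr (a : R) : a != 0 -> a^-1 * (a - a ^+ 2) = 1 - a.
Proof. by move=> a0; field. Qed.

Lemma inversion_derivative (a t : R) (N v : V) : a != 0 ->
  a^-1 *: ((- a ^+ 2 * t - 2 * a * (- a ^+ 2 * t)) *: (a^-1 *: N) + (a - a ^+ 2) *: v) =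
  (1 - a) *: v + ((1 - 2 * (1 - a)) * t) *: N.
Proof.
move=> a0; rewrite scalerDr !scalerA [RHS]addrC; congr (_ *: _ + _ *: _).
  exact: inversion_coef.
exact: inv_mul_sub_sqr.
Qed.

Lemma neg_inv_sqr (a t p : R) : a != 0 -> - (a^-1 * (- a ^+ 2 * t * p)) = t * (a * p).
Proof. by move=> a0; field. Qed.

(** At infinity the pulled back boundary defining function is 1 / |x|, so the claim follows by
    differentiating [a z * Phi z = g (iota z)] with a = 1 / |z| and the explicit derivative of
    [iota]. *)
Lemma far_derive (Phi g : V -> R) (y v : V) : 2 / 3 < enorm y -> enorm y < 1 ->
  smooth_at y g -> (\forall y' \near y, Phi (iota_inv K y') * bdf K y' = g y') ->
  'D_v Phi (iota_inv K y) = dot (unit_dir y) v * g y +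
    'D_(enorm y *: v + ((1 - 2 * enorm y) * dot (unit_dir y) v) *: unit_dir y) g y.
Proof.
move=> y1 y2 sg PhiE; set x := iota_inv K y.
have xE : x = (1 - enorm y)^-1 *: unit_dir y by exact: iota_inv_far.
have y0 : y != 0 by rewrite -enorm_gt0; apply: lt_trans y1; lra.
pose a (z : V) := (enorm z)^-1.
have xn : enorm x = (1 - enorm y)^-1.
  by rewrite xE enormZ enorm_unit_dir// mulr1 ger0_norm// invr_ge0; lra.
have ax : a x = 1 - enorm y by rewrite /a xn invrK.
have x3 : 3 < enorm x by rewrite xn; exact: inv_sub_gt3.
have x0 : x != 0 by rewrite -enorm_gt0; apply: lt_trans x3; lra.
have iy : Defs.iota K x = y by exact: iota_invK.
have si : smooth_at x (fun z : V => z) by exact: smooth_at_id.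
have sa : smooth_at x a by exact: smooth_at_inv_enorm.
have sgi : smooth_at x (fun z => g (Defs.iota K z)).
  by apply: (smooth_at_comp (g := g) _ (smooth_at_iota K x)); rewrite iy.
have n3 : \forall z \near x, 3 < enorm z by exact: near_enorm_gt.
have aPhi : \forall z \near x, a z * Phi z = g (Defs.iota K z).
  have h : \forall z \near x, Phi (iota_inv K (Defs.iota K z)) * bdf K (Defs.iota K z) = g (Defs.iota K z).
    apply: (smooth_at_near_comp (P := fun y' => Phi (iota_inv K y') * bdf K y' = g y') (smooth_at_iota K x)).
    by rewrite iy.
  by apply: filterS2 n3 h => z z3; rewrite iotaK bdf_iota_far// mulrC.
have sPhi : smooth_at x Phi.
  apply: (@eq_smooth_at _ _ _ _ (fun z => enorm z * g (Defs.iota K z))); last first.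
    by apply: smooth_atM => //; exact: smooth_at_enorm.
  apply: filterS2 n3 aPhi => z z3 <-; rewrite mulrA mulfV ?mul1r// gt_eqF//.
  by apply: lt_trans z3; lra.
have Dio : 'D_v (Defs.iota K) x = ('D_v a x - 2 * a x * 'D_v a x) *: x + (a x - a x ^+ 2) *: v.
  rewrite (near_eq_derive (g := fun z => (a z - a z * a z) *: z)); last first.
    by apply: filterS n3 => z /iota_far_scale ->; rewrite expr2.
  have saa : smooth_at x (fun z => a z *: (a z : R^o)) by exact: smooth_at_scale.
  have sb : smooth_at x (fun z => a z - a z * a z) by apply: smooth_atB => //; exact: smooth_atM.
  have [_ ->] := is_diff_scalef (smooth_at_differentiable sb) (smooth_at_differentiable si).
  rewrite derive_id -expr2; congr (_ *: _ + _).
  have [_ D2] := is_diff_scalef (smooth_at_differentiable sa) (smooth_at_differentiable (sa : smooth_at x (a : V -> R^o))).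
  rewrite deriveB; [|exact/diff_derivable/smooth_at_differentiable|exact/diff_derivable/smooth_at_differentiable].
  by rewrite [X in _ - X]D2; exact: sub_double.
have aD : 'D_v a x * Phi x + a x * 'D_v Phi x = 'D_('D_v (Defs.iota K) x) g y.
  have [_ <-] := is_diff_scalef (smooth_at_differentiable sa) (smooth_at_differentiable (sPhi : smooth_at x (Phi : V -> R^o))).
  rewrite -[in RHS]iy -derive_comp; last 2 first.
  - exact/smooth_at_differentiable/smooth_at_iota.
  - by rewrite iy; exact: smooth_at_differentiable.
  exact: near_eq_derive.
have a0 : a x != 0 by rewrite ax subr_eq0 gt_eqF.
have Da : 'D_v a x = - a x ^+ 2 * dot (unit_dir y) v.
  have dx : dot x v = (a x)^-1 * dot (unit_dir y) v by rewrite ax {1}xE dotZl.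
  by rewrite derive_inv_enorm// dx -[(enorm x)^-1]/(a x); exact: cube_mul_inv.
have Phix : a x * Phi x = g y by rewrite (nbhs_singleton aPhi) iy.
have dg : differentiable g y by exact: smooth_at_differentiable.
have w : (a x)^-1 *: 'D_v (Defs.iota K) x =
    enorm y *: v + ((1 - 2 * enorm y) * dot (unit_dir y) v) *: unit_dir y.
  have xE' : x = (a x)^-1 *: unit_dir y by rewrite ax.
  have ny : enorm y = 1 - a x by rewrite ax subKr.
  rewrite Dio Da ny -inversion_derivative//; congr (_ *: (_ *: _ + _)); exact: xE'.
have -> : 'D_v Phi x = (a x)^-1 * ('D_('D_v (Defs.iota K) x) g y - 'D_v a x * Phi x).
  by rewrite -aD addrAC subrr add0r mulKf.
rewrite -w mulrBr [RHS]addrC; congr (_ + _).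
  by move: ('D_v _ x) => u; rewrite !deriveE//; apply/esym; exact: linearZZ.
by rewrite -Phix Da; exact: neg_inv_sqr.
Qed.
End FarDerivative.

(** * Boundary values and derivatives of phase functions *)

Section Germs.
Context {R : realType} {d s : nat}.
Variable K : forall n, compactification R n.
Local Notation W := 'rV[R]_d.
Local Notation Z := 'rV[R]_s.
Implicit Types (phi F : W * Z -> R) (p q : W * Z).

Lemma BBo_BB p : BBo d s p -> BB d s p.
Proof. by move=> [h1 h2]; split; exact: ltW. Qed.

Lemma open_BBo : open (BBo d s : set (W * Z)).
Proof.
rewrite openE => p [h1 h2].
have n1 := smooth_at_near_comp (smooth_at_fst (smooth_at_id p)) (near_enorm_lt h1).
have n2 := smooth_at_near_comp (smooth_at_snd (smooth_at_id p)) (near_enorm_lt h2).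
by apply: filterS2 n1 n2 => q; split.
Qed.

Lemma BBo_dense p (P : W * Z -> Prop) : BB d s p -> (\forall q \near p, P q) ->
  exists2 q, P q & BBo d s q.
Proof.
move=> [h1 h2] nP.
have sm : smooth_at (1 : R) (fun t : R => t *: p).
  by apply: smooth_at_scale; [exact: smooth_at_id|exact: smooth_at_cst].
have /nbhs_ballP[r /= r0 rP] : \forall t \near (1 : R), P (t *: p).
  by apply: (smooth_at_near_comp sm); rewrite scale1r.
pose t : R := 1 - Num.min (r / 2) (1 / 2).
have m0 : 0 < Num.min (r / 2) (1 / 2) by rewrite lt_min; apply/andP; split; lra.
have m1 : Num.min (r / 2) (1 / 2) <= r / 2 by rewrite ge_min lexx.
have m2 : Num.min (r / 2) (1 / 2) <= 1 / 2 by rewrite ge_min lexx orbT.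
have t01 : 0 < t < 1 by rewrite /t; lra.
have bl n (y : 'rV[R]_n) : cball n y -> oball n (t *: y).
  rewrite /cball /oball /= enormZ gtr0_norm; last by case/andP: t01.
  move=> y1; case/andP: t01 => t0 t1; apply: le_lt_trans t1.
  by rewrite -[leRHS]mulr1 ler_wpM2l// ltW.
exists (t *: p); last by split; apply: bl.
apply: rP; rewrite -ball_normE /ball_ /= /t subKr gtr0_norm//; lra.
Qed.

Lemma ext_eq (V : normedModType R) (g G : W * Z -> V) p : BB d s p ->
  {for p, continuous G} -> (\forall q \near p, BBo d s q -> g q = G q) -> ext g p = G p.
Proof.
move=> pB cG gG; rewrite /ext.
have pf : ProperFilter (within (BBo d s) (nbhs p)).
  split; last exact: within_filter.
  move=> h; have [q] := BBo_dense pB h.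
  by move=> /[apply].
apply: cvg_lim; first exact: norm_hausdorff.
apply: (@cvg_trans _ (G q @[q --> within (BBo d s) (nbhs p)])).
  apply: near_eq_cvg; rewrite near_withinE.
  by apply: filterS gG => q h /h.
exact: cvg_within_filter.
Qed.

(** [F] is an ambient smooth extension of the rescaled phase; only its values in the interior are
    prescribed, and these determine it on the boundary by continuity. *)
Definition germ_of phi F p : Prop :=
  smooth_at p F /\ \forall q \near p, BBo d s q -> F q = ty K q * tg K q * tl K phi q.

Lemma germ_of_near phi F p : germ_of phi F p -> \forall q \near p, germ_of phi F q.
Proof.
move=> [sF FE]; have FE' := near_join FE.
by apply: filterS2 (smooth_at_near sF) FE' => q; split.
Qed.

Lemma classical_germ V phi p : classical11 K V phi -> V p -> exists F, germ_of phi F p.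
Proof.
move=> [[A oA VE] [f sf fE]] Vp; have [D [F [oD Dp CF Ff]]] := sf p Vp.
exists F; split; first by exists D.
have Ap : A p by move: Vp; rewrite VE => -[].
have : nbhs p (D `&` A) by apply: filterI; exact: open_nbhs_nbhs.
apply: filterS => q [Dq Aq] qB.
have Vq : V q by rewrite VE; split=> //; exact: BBo_BB.
by rewrite Ff// fE.
Qed.

Lemma relopen_near V p : relopen (BB d s) V -> V p -> \forall q \near p, BB d s q -> V q.
Proof.
move=> [A oA VE] Vp; have Ap : A p by move: Vp; rewrite VE => -[].
have : nbhs p A by exact: open_nbhs_nbhs.
by apply: filterS => q Aq qB; rewrite VE.
Qed.

(** The smooth extension of [ty] times the phase to the face S^(d-1) x (B^s)^o, in the coordinates
    (y, theta); [fpsi] is its counterpart in (x, gamma). *)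
Definition fe F (q : W * Z) : R := F (q.1, Defs.iota (K s) q.2) / bdf (K s) (Defs.iota (K s) q.2).
Definition fpsi F (q : W * Z) : R := F (Defs.iota (K d) q.1, q.2) / bdf (K d) (Defs.iota (K d) q.1).

Lemma smooth_at_ty p : oball d p.1 -> smooth_at p (ty K : W * Z -> R).
Proof.
move=> h; apply: (smooth_at_comp (g := bdf (K d))); last exact: smooth_at_bdf.
by apply: smooth_at_fst; exact: smooth_at_id.
Qed.

Lemma smooth_at_tg p : oball s p.2 -> smooth_at p (tg K : W * Z -> R).
Proof.
move=> h; apply: (smooth_at_comp (g := bdf (K s))); last exact: smooth_at_bdf.
by apply: smooth_at_snd; exact: smooth_at_id.
Qed.

Lemma smooth_at_iota_snd q : smooth_at q (fun x : W * Z => (x.1, Defs.iota (K s) x.2)).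
Proof.
apply: smooth_at_pair; first by apply: smooth_at_fst; exact: smooth_at_id.
apply: (smooth_at_comp (g := Defs.iota (K s))); last exact: smooth_at_iota.
by apply: smooth_at_snd; exact: smooth_at_id.
Qed.

Lemma smooth_at_iota_fst q : smooth_at q (fun x : W * Z => (Defs.iota (K d) x.1, x.2)).
Proof.
apply: smooth_at_pair; last by apply: smooth_at_snd; exact: smooth_at_id.
apply: (smooth_at_comp (g := Defs.iota (K d))); last exact: smooth_at_iota.
by apply: smooth_at_fst; exact: smooth_at_id.
Qed.

Lemma smooth_at_fe F q : smooth_at (q.1, Defs.iota (K s) q.2) F -> smooth_at q (fe F).
Proof.
move=> sF; have sm := smooth_at_iota_snd q.
apply: smooth_atM; first exact: (smooth_at_comp (g := F) _ sm).
apply: smooth_atV; last exact/bdf_neq0/iota_oball.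
apply: (smooth_at_comp (g := tg K) _ sm); apply: smooth_at_tg; exact: iota_oball.
Qed.

Lemma smooth_at_fpsi F q : smooth_at (Defs.iota (K d) q.1, q.2) F -> smooth_at q (fpsi F).
Proof.
move=> sF; have sm := smooth_at_iota_fst q.
apply: smooth_atM; first exact: (smooth_at_comp (g := F) _ sm).
apply: smooth_atV; last exact/bdf_neq0/iota_oball.
apply: (smooth_at_comp (g := ty K) _ sm); apply: smooth_at_ty; exact: iota_oball.
Qed.

Section AtPoint.
Variables (phi F : W * Z -> R) (p : W * Z).
Hypothesis gF : germ_of phi F p.
Let sF : smooth_at p F := gF.1.
Let FE : \forall q \near p, BBo d s q -> F q = ty K q * tg K q * tl K phi q := gF.2.

Lemma bvalue_e : face_set d s Fe p -> bvalue K phi p = F p / tg K p.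
Proof.
move=> pe; rewrite /bvalue asboolT//; have [p1 p2] := pe.
apply: (ext_eq (G := fun q => F q / tg K q)).
- by split; [rewrite /cball /= p1|exact: ltW].
- apply: smooth_at_continuous; apply: smooth_atM => //; apply: smooth_atV.
    exact: smooth_at_tg.
  exact: bdf_neq0.
apply: filterS FE => q h qb; rewrite h//.
have : tg K q != 0 by apply: bdf_neq0; case: qb.
by move=> t0; field.
Qed.

Lemma bvalue_psi : face_set d s Fpsi p -> bvalue K phi p = F p / ty K p.
Proof.
move=> pe; have [p1 p2] := pe.
rewrite /bvalue asboolF; last by move=> [_]; rewrite /oball /= p2 ltxx.
rewrite asboolT//; apply: (ext_eq (G := fun q => F q / ty K q)).
- by split; [exact: ltW|rewrite /cball /= p2].
- apply: smooth_at_continuous; apply: smooth_atM => //; apply: smooth_atV.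
    exact: smooth_at_ty.
  exact: bdf_neq0.
apply: filterS FE => q h qb; rewrite h//.
have : ty K q != 0 by apply: bdf_neq0; case: qb.
by move=> t0; field.
Qed.

Lemma bvalue_corner : face_set d s Fpsie p -> bvalue K phi p = F p.
Proof.
move=> pe; have [p1 p2] := pe.
rewrite /bvalue asboolF; last by move=> [_]; rewrite /oball /= p2 ltxx.
rewrite asboolF; last by move=> [+ _]; rewrite /oball /= p1 ltxx.
apply: ext_eq; [|exact: smooth_at_continuous|].
  by split; rewrite /cball /= ?p1 ?p2.
by apply: filterS FE => q h /h.
Qed.
End AtPoint.

(** A theta-derivative only sees one fibre, along which the factor [c] is constant. The conclusion
    holds near [th], so it can be differentiated again for the Hessian. *)
Lemma theta_line (Phi f : W * Z -> R) x y (c : R) (th v : Z) : smooth_at (y, th) f ->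
  (\forall t \near th, Phi (x, t) = c * f (y, t)) ->
  \forall t \near th, 'D_(0, v) Phi (x, t) = c * 'D_(0, v) f (y, t).
Proof.
move=> sf E.
have n1 := near_join E.
have n2 : \forall t \near th, smooth_at (y, t) f.
  have sp : smooth_at th (fun t => (y, t)).
    by apply: smooth_at_pair; [exact: smooth_at_cst|exact: smooth_at_id].
  exact: (smooth_at_near_comp sp (smooth_at_near sf)).
apply: filterS2 n1 n2 => t E' sf'.
have df : differentiable f (y, t) by exact: smooth_at_differentiable.
transitivity ('D_(0, v) (fun q => c *: (f q : R^o)) (y, t)); last first.
  by rewrite deriveZ//; exact: diff_derivable.
apply: derive_line_eq.
have sl : smooth_at (0 : R) (fun h : R => h *: v + t).
  apply: smooth_atD; last exact: smooth_at_cst.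
  by apply: smooth_at_scale; [exact: smooth_at_id|exact: smooth_at_cst].
have := smooth_at_near_comp (P := fun t => Phi (x, t) = c * f (y, t)) sl.
rewrite scale0r add0r => /(_ E'); apply: filterS => h.
rewrite /GRing.scale /= => e.
rewrite (_ : h *: _ + _ = (x, h *: v + t)); last by congr (_, _); rewrite /= ?scaler0 ?add0r.
rewrite (_ : h *: _ + _ = (y, h *: v + t)); last by congr (_, _); rewrite /= ?scaler0 ?add0r.
exact: e.
Qed.

Lemma x_line (Phi f : W * Z -> R) th g (c : R) (x v : W) : smooth_at (x, g) f ->
  (\forall t \near x, Phi (t, th) = c * f (t, g)) ->
  'D_(v, 0) Phi (x, th) = c * 'D_(v, 0) f (x, g).
Proof.
move=> sf E.
have df : differentiable f (x, g) by exact: smooth_at_differentiable.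
transitivity ('D_(v, 0) (fun q => c *: (f q : R^o)) (x, g)); last first.
  by rewrite deriveZ//; exact: diff_derivable.
apply: derive_line_eq.
have sl : smooth_at (0 : R) (fun h : R => h *: v + x).
  apply: smooth_atD; last exact: smooth_at_cst.
  by apply: smooth_at_scale; [exact: smooth_at_id|exact: smooth_at_cst].
have := smooth_at_near_comp (P := fun t => Phi (t, th) = c * f (t, g)) sl.
rewrite scale0r add0r => /(_ E); apply: filterS => h.
rewrite /GRing.scale /= => e.
rewrite (_ : h *: _ + _ = (h *: v + x, th)); last by congr (_, _); rewrite /= ?scaler0 ?add0r.
rewrite (_ : h *: _ + _ = (h *: v + x, g)); last by congr (_, _); rewrite /= ?scaler0 ?add0r.
exact: e.
Qed.

(** For |y| > 2/3 this is the expression of [tg] times the x-gradient of the phase that stays smooth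
    up to the sphere; [thgrad] plays the same role for theta. *)
Definition xgrad F (q : W * Z) : W := far_grad q.1 (F q) (grad_x F q).
Definition thgrad F (q : W * Z) : Z := far_grad q.2 (F q) (gradz F q).

Lemma derive_x_dot F q (v : W) : differentiable F q -> 'D_(v, 0) F q = dot v (grad_x F q).
Proof.
move=> dF; rewrite derive_pair_sum// [X in _ + X]big1 ?addr0; last first.
  by move=> j _; rewrite mxE mul0r.
by apply: eq_bigr => i _; rewrite [in RHS]mxE.
Qed.

Lemma derive_z_dot F q (v : Z) : differentiable F q -> 'D_(0, v) F q = dot v (gradz F q).
Proof.
by move=> dF; rewrite derive_z_sum//; apply: eq_bigr => i _; rewrite [in RHS]mxE.
Qed.

Section Interior.
Variables (phi F : W * Z -> R) (q : W * Z).
Hypothesis gF : germ_of phi F q.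
Hypothesis qB : BBo d s q.
Let sF : smooth_at q F := gF.1.
Let FE : \forall q \near q, BBo d s q -> F q = ty K q * tg K q * tl K phi q := gF.2.
Let qE : q = (q.1, q.2). Proof. exact: surjective_pairing. Qed.

Lemma germ_interior : \forall q' \near q, BBo d s q' /\ F q' = ty K q' * tg K q' * tl K phi q'.
Proof.
have nB : \forall q' \near q, BBo d s q' by exact: open_nbhs_nbhs (conj open_BBo qB).
by apply: filterS2 FE nB => q' h1 h2; split=> //; exact: h1.
Qed.

Lemma germ_theta : \forall t \near iota_inv (K s) q.2,
  phi (iota_inv (K d) q.1, t) = (ty K q)^-1 * fe F (q.1, t).
Proof.
have [q1 q2] := qB; set th := iota_inv (K s) q.2.
have sm : smooth_at th (fun t => (q.1, Defs.iota (K s) t)).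
  by apply: smooth_at_pair; [exact: smooth_at_cst|exact: smooth_at_iota].
have := smooth_at_near_comp (P := fun q' => BBo d s q' /\ F q' = ty K q' * tg K q' * tl K phi q') sm.
rewrite iota_invK// -qE => /(_ germ_interior); apply: filterS => t [_ E].
rewrite /fe /= E /tl /= iotaK /ty /tg /=.
have t0 : bdf (K d) q.1 != 0 by exact: bdf_neq0.
have t1 : bdf (K s) (Defs.iota (K s) t) != 0 by exact/bdf_neq0/iota_oball.
by move: (phi _) t0 t1 => x; move: (bdf _ _) (bdf _ _) => a b a0 b0; field; rewrite a0 b0.
Qed.

Lemma smooth_at_fe_interior : smooth_at (q.1, iota_inv (K s) q.2) (fe F).
Proof. by apply: smooth_at_fe; rewrite /= iota_invK -?qE//; case: qB. Qed.

Lemma smooth_at_fpsi_interior : smooth_at (iota_inv (K d) q.1, q.2) (fpsi F).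
Proof. by apply: smooth_at_fpsi; rewrite /= iota_invK -?qE//; case: qB. Qed.

Lemma grad_theta_interior :
  ty K q *: tl K (grad_theta phi) q = gradz (fe F) (q.1, iota_inv (K s) q.2).
Proof.
apply/rowP => j; rewrite !mxE.
have := nbhs_singleton (theta_line (delta_mx 0 j) smooth_at_fe_interior germ_theta).
move=> h; rewrite /dtheta [X in _ * X]h mulrA mulfV ?mul1r//.
by apply: bdf_neq0; case: qB.
Qed.

Lemma hess_theta_interior : ((tg K q)^-1 * ty K q) *: tl K (hess_theta phi) q =
  (tg K q)^-1 *: hessz (fe F) (q.1, iota_inv (K s) q.2).
Proof.
rewrite -scalerA; congr (_ *: _); apply/matrixP => j k.
rewrite [LHS]mxE /tl hess_thetaE; apply: etrans _ (esym (hesszE _ _ _ _)).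
have n1 := theta_line (delta_mx 0 k) smooth_at_fe_interior germ_theta.
have sd : smooth_at (q.1, iota_inv (K s) q.2) (dz k (fe F)).
  exact/smooth_at_dz/smooth_at_fe_interior.
have h := nbhs_singleton (theta_line (Phi := dtheta k phi) (delta_mx 0 j) sd n1).
rewrite /dtheta [X in _ * X]h mulrA mulfV ?mul1r//.
by apply: bdf_neq0; case: qB.
Qed.

Lemma grad_x_interior :
  tg K q *: tl K (grad_x phi) q = grad_x (fpsi F) (iota_inv (K d) q.1, q.2).
Proof.
have [q1 q2] := qB; set x := iota_inv (K d) q.1.
have sm : smooth_at x (fun t => (Defs.iota (K d) t, q.2)).
  by apply: smooth_at_pair; [exact: smooth_at_iota|exact: smooth_at_cst].
have E : \forall t \near x, phi (t, iota_inv (K s) q.2) = (tg K q)^-1 * fpsi F (t, q.2).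
  have := smooth_at_near_comp (P := fun q' => BBo d s q' /\ F q' = ty K q' * tg K q' * tl K phi q') sm.
  rewrite iota_invK// -qE => /(_ germ_interior); apply: filterS => t [_ E].
  rewrite /fpsi /= E /tl /= iotaK /ty /tg /=.
  have t0 : bdf (K s) q.2 != 0 by exact: bdf_neq0.
  have t1 : bdf (K d) (Defs.iota (K d) t) != 0 by exact/bdf_neq0/iota_oball.
  by move: (phi _) t0 t1 => y; move: (bdf _ _) (bdf _ _) => a b a0 b0; field; rewrite a0 b0.
apply/rowP => j; rewrite !mxE.
have h := x_line (delta_mx 0 j) smooth_at_fpsi_interior E.
rewrite [X in _ * X]h mulrA mulfV ?mul1r//; exact: bdf_neq0.
Qed.
End Interior.
End Germs.

Section FaceFormulas.
Context {R : realType} {d s : nat}.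
Variable K : forall n, compactification R n.
Local Notation W := 'rV[R]_d.
Local Notation Z := 'rV[R]_s.
Implicit Types (phi F : W * Z -> R) (p q : W * Z).

Lemma sphere_neq0 n (y : 'rV[R]_n) : sphere n y -> y != 0.
Proof. by move=> y1; rewrite -enorm_gt0 y1 ltr01. Qed.

Lemma sphere_cball n (y : 'rV[R]_n) : sphere n y -> cball n y.
Proof. by rewrite /cball /= => ->. Qed.

Lemma unit_dir_sphere n (y : 'rV[R]_n) : sphere n y -> unit_dir y = y.
Proof. by move=> y1; rewrite /unit_dir y1 invr1 scale1r. Qed.

Lemma sphere_far n (y : 'rV[R]_n) : sphere n y -> \forall z \near y, 2 / 3 < enorm z.
Proof. by move=> y1; apply: near_enorm_gt; rewrite y1; lra. Qed.

Lemma smooth_at_fst_id p : smooth_at p (fun q : W * Z => q.1).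
Proof. by apply: smooth_at_fst; exact: smooth_at_id. Qed.

Lemma smooth_at_snd_id p : smooth_at p (fun q : W * Z => q.2).
Proof. by apply: smooth_at_snd; exact: smooth_at_id. Qed.

Lemma smooth_at_xgrad F p : smooth_at p F -> p.1 != 0 -> smooth_at p (xgrad F).
Proof.
by move=> sF; apply: smooth_at_far_grad => //; [exact: smooth_at_fst_id|exact: smooth_at_grad_x].
Qed.

Lemma smooth_at_thgrad F p : smooth_at p F -> p.2 != 0 -> smooth_at p (thgrad F).
Proof.
by move=> sF; apply: smooth_at_far_grad => //; [exact: smooth_at_snd_id|exact: smooth_at_gradz].
Qed.

Lemma grad_x_far phi F q : germ_of K phi F q -> BBo d s q -> 2 / 3 < enorm q.1 ->
  tg K q *: tl K (grad_x phi) q = xgrad F q.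
Proof.
move=> gF qB q1far; have [q1 q2] := qB; have sF := gF.1.
have qE : q = (q.1, q.2) by exact: surjective_pairing.
have t0 : tg K q != 0 by exact: bdf_neq0.
have sm : smooth_at q.1 (fun y => (y, q.2)).
  by apply: smooth_at_pair; [exact: smooth_at_id|exact: smooth_at_cst].
pose g y := (tg K q)^-1 * F (y, q.2).
have sFy : smooth_at q.1 (fun y => F (y, q.2)).
  by apply: (smooth_at_comp (g := F) _ sm); rewrite -qE.
have sg : smooth_at q.1 g by apply: smooth_atM => //; exact: smooth_at_cst.
have PhiE : \forall y' \near q.1,
    phi (iota_inv (K d) y', iota_inv (K s) q.2) * bdf (K d) y' = g y'.
  have := smooth_at_near_comp (P := fun q' => BBo d s q' /\ F q' = ty K q' * tg K q' * tl K phi q') sm.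
  rewrite -qE => /(_ (germ_interior gF qB)); apply: filterS => y [_ E].
  rewrite /g E /tl /ty /tg /=; move: t0; rewrite /tg.
  by move: (phi _) (bdf _ q.2) (bdf _ y) => x a b a0; field.
apply/rowP => j; rewrite mxE /tl [grad_x _ _ _ _]mxE [RHS]mxE.
have -> : 'D_(delta_mx 0 j, 0) phi (iota_inv (K d) q.1, iota_inv (K s) q.2) =
    'D_(delta_mx 0 j) (fun x => phi (x, iota_inv (K s) q.2)) (iota_inv (K d) q.1).
  apply: derive_line_eq; near=> h; congr (phi (_, _)); rewrite /= ?scaler0 ?add0r//.
rewrite (far_derive (delta_mx 0 j) q1far q1 sg PhiE) mulrDr; congr (_ + _).
  by rewrite mulrCA /g -qE mulVKf.
set w := _ + _ *: unit_dir q.1.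
rewrite -derive_x_dot; last exact: smooth_at_differentiable.
have -> : 'D_w g q.1 = (tg K q)^-1 * 'D_w (fun y => F (y, q.2)) q.1.
  by apply: deriveZ; exact/diff_derivable/smooth_at_differentiable.
rewrite mulVKf// [in RHS]qE; apply: derive_line_eq.
by near=> h; congr (F (_, _)); rewrite /= ?scaler0 ?add0r.
Unshelve. all: by end_near. Qed.

Lemma grad_theta_far phi F q : germ_of K phi F q -> BBo d s q -> 2 / 3 < enorm q.2 ->
  ty K q *: tl K (grad_theta phi) q = thgrad F q.
Proof.
move=> gF qB q2far; have [q1 q2] := qB; have sF := gF.1.
have qE : q = (q.1, q.2) by exact: surjective_pairing.
have t0 : ty K q != 0 by exact: bdf_neq0.
have sm : smooth_at q.2 (fun y => (q.1, y)).
  by apply: smooth_at_pair; [exact: smooth_at_cst|exact: smooth_at_id].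
pose g y := (ty K q)^-1 * F (q.1, y).
have sFy : smooth_at q.2 (fun y => F (q.1, y)).
  by apply: (smooth_at_comp (g := F) _ sm); rewrite -qE.
have sg : smooth_at q.2 g by apply: smooth_atM => //; exact: smooth_at_cst.
have PhiE : \forall y' \near q.2,
    phi (iota_inv (K d) q.1, iota_inv (K s) y') * bdf (K s) y' = g y'.
  have := smooth_at_near_comp (P := fun q' => BBo d s q' /\ F q' = ty K q' * tg K q' * tl K phi q') sm.
  rewrite -qE => /(_ (germ_interior gF qB)); apply: filterS => y [_ E].
  rewrite /g E /tl /ty /tg /=; move: t0; rewrite /ty.
  by move: (phi _) (bdf _ q.1) (bdf _ y) => x a b a0; field.
apply/rowP => j; rewrite mxE /tl [grad_theta _ _ _ _]mxE [RHS]mxE /dtheta.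
have -> : 'D_(0, delta_mx 0 j) phi (iota_inv (K d) q.1, iota_inv (K s) q.2) =
    'D_(delta_mx 0 j) (fun x => phi (iota_inv (K d) q.1, x)) (iota_inv (K s) q.2).
  apply: derive_line_eq; near=> h; congr (phi (_, _)); rewrite /= ?scaler0 ?add0r//.
rewrite (far_derive (delta_mx 0 j) q2far q2 sg PhiE) mulrDr; congr (_ + _).
  by rewrite mulrCA /g -qE mulVKf.
set w := _ + _ *: unit_dir q.2.
rewrite -derive_z_dot; last exact: smooth_at_differentiable.
have -> : 'D_w g q.2 = (ty K q)^-1 * 'D_w (fun y => F (q.1, y)) q.2.
  by apply: deriveZ; exact/diff_derivable/smooth_at_differentiable.
rewrite mulVKf// [in RHS]qE; apply: derive_line_eq.
by near=> h; congr (F (_, _)); rewrite /= ?scaler0 ?add0r.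
Unshelve. all: by end_near. Qed.

Lemma near_fst_far p : sphere d p.1 -> \forall q \near p, 2 / 3 < enorm q.1.
Proof.
move=> p1; exact: (smooth_at_near_comp (P := fun y => 2 / 3 < enorm y) (smooth_at_fst_id p) (sphere_far p1)).
Qed.

Lemma near_snd_far p : sphere s p.2 -> \forall q \near p, 2 / 3 < enorm q.2.
Proof.
move=> p1; exact: (smooth_at_near_comp (P := fun y => 2 / 3 < enorm y) (smooth_at_snd_id p) (sphere_far p1)).
Qed.

Section AtPoint.
Variables (phi F : W * Z -> R) (p : W * Z).
Hypothesis gF : germ_of K phi F p.
Let sF : smooth_at p F := gF.1.

Lemma smooth_at_iota_inv_snd (V : normedModType R) (g : W * Z -> V) :
  oball s p.2 -> smooth_at (p.1, iota_inv (K s) p.2) g ->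
  smooth_at p (fun q : W * Z => g (q.1, iota_inv (K s) q.2)).
Proof.
move=> p2 sg; apply: (smooth_at_comp (g := g) (f := fun q : W * Z => (q.1, iota_inv (K s) q.2))) => //.
apply: smooth_at_pair; first exact: smooth_at_fst_id.
apply: (smooth_at_comp (g := iota_inv (K s)) _ (smooth_at_snd_id p)).
exact: smooth_at_iota_inv.
Qed.

Lemma smooth_at_iota_inv_fst (V : normedModType R) (g : W * Z -> V) :
  oball d p.1 -> smooth_at (iota_inv (K d) p.1, p.2) g ->
  smooth_at p (fun q : W * Z => g (iota_inv (K d) q.1, q.2)).
Proof.
move=> p1 sg; apply: (smooth_at_comp (g := g) (f := fun q : W * Z => (iota_inv (K d) q.1, q.2))) => //.
apply: smooth_at_pair; last exact: smooth_at_snd_id.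
apply: (smooth_at_comp (g := iota_inv (K d)) _ (smooth_at_fst_id p)).
exact: smooth_at_iota_inv.
Qed.

Lemma smooth_at_fe_face : oball s p.2 -> smooth_at (p.1, iota_inv (K s) p.2) (fe K F).
Proof. by move=> p2; apply: smooth_at_fe; rewrite /= iota_invK// -surjective_pairing. Qed.

Lemma smooth_at_fpsi_face : oball d p.1 -> smooth_at (iota_inv (K d) p.1, p.2) (fpsi K F).
Proof. by move=> p1; apply: smooth_at_fpsi; rewrite /= iota_invK// -surjective_pairing. Qed.

Lemma gth_e : face_set d s Fe p -> gth K phi p = gradz (fe K F) (p.1, iota_inv (K s) p.2).
Proof.
move=> [p1 p2].
apply: (ext_eq (G := fun q => gradz (fe K F) (q.1, iota_inv (K s) q.2))).
- by split; [exact: sphere_cball|exact: ltW].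
- apply/smooth_at_continuous/smooth_at_iota_inv_snd => //.
  exact/smooth_at_gradz/smooth_at_fe_face.
- by apply: filterS (germ_of_near gF) => q gq qB; exact: grad_theta_interior.
Qed.

Lemma hth_e : face_set d s Fe p ->
  hth K phi p = (tg K p)^-1 *: hessz (fe K F) (p.1, iota_inv (K s) p.2).
Proof.
move=> [p1 p2].
apply: (ext_eq (G := fun q => (tg K q)^-1 *: hessz (fe K F) (q.1, iota_inv (K s) q.2))).
- by split; [exact: sphere_cball|exact: ltW].
- apply: smooth_at_continuous; apply: smooth_at_scale.
    by apply: smooth_atV; [exact: smooth_at_tg|exact: bdf_neq0].
  apply: smooth_at_iota_inv_snd => //; apply: smooth_at_mx => j k.
  apply: (@eq_smooth_at _ _ _ _ (dz j (dz k (fe K F)))); first by near=> q; rewrite mxE.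
  exact/smooth_at_dz/smooth_at_dz/smooth_at_fe_face.
- by apply: filterS (germ_of_near gF) => q gq qB; exact: hess_theta_interior.
Unshelve. all: by end_near. Qed.

Lemma gx_psi : face_set d s Fpsi p -> gx K phi p = grad_x (fpsi K F) (iota_inv (K d) p.1, p.2).
Proof.
move=> [p1 p2].
apply: (ext_eq (G := fun q => grad_x (fpsi K F) (iota_inv (K d) q.1, q.2))).
- by split; [exact: ltW|exact: sphere_cball].
- apply/smooth_at_continuous/smooth_at_iota_inv_fst => //.
  exact/smooth_at_grad_x/smooth_at_fpsi_face.
- by apply: filterS (germ_of_near gF) => q gq qB; exact: grad_x_interior.
Qed.

Lemma gx_sphere : sphere d p.1 -> cball s p.2 -> gx K phi p = xgrad F p.
Proof.
move=> p1 p2; apply: ext_eq; first by split=> //; exact: sphere_cball.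
  by apply/smooth_at_continuous/smooth_at_xgrad => //; exact: sphere_neq0.
by apply: filterS2 (germ_of_near gF) (near_fst_far p1) => q gq q1 qB; exact: grad_x_far.
Qed.

Lemma gth_sphere : cball d p.1 -> sphere s p.2 -> gth K phi p = thgrad F p.
Proof.
move=> p1 p2; apply: ext_eq; first by split=> //; exact: sphere_cball.
  by apply/smooth_at_continuous/smooth_at_thgrad => //; exact: sphere_neq0.
by apply: filterS2 (germ_of_near gF) (near_snd_far p2) => q gq q2 qB; exact: grad_theta_far.
Qed.

Lemma lambda_e : face_set d s Fe p ->
  lambda K phi p = (p.1, Defs.iota (K d) ((tg K p)^-1 *: xgrad F p)).
Proof.
move=> [p1 p2]; congr (_, _).
apply: (ext_eq (G := fun q => Defs.iota (K d) ((tg K q)^-1 *: xgrad F q))).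
- by split; [exact: sphere_cball|exact: ltW].
- apply: smooth_at_continuous; apply: (smooth_at_comp (g := Defs.iota (K d))); last exact: smooth_at_iota.
  apply: smooth_at_scale; last by apply: smooth_at_xgrad => //; exact: sphere_neq0.
  by apply: smooth_atV; [exact: smooth_at_tg|exact: bdf_neq0].
- apply: filterS2 (germ_of_near gF) (near_fst_far p1) => q gq q1 qB.
  rewrite -(grad_x_far gq qB q1) scalerA mulVf ?scale1r//.
  by apply: bdf_neq0; case: qB.
Qed.

(** As [tg] tends to 0 the covector [xgrad F / tg] leaves every ball, so the explicit form of [iota]
    applies and has a limit. *)
Lemma lambda_corner : face_set d s Fpsie p -> xgrad F p != 0 ->
  lambda K phi p = (p.1, unit_dir (xgrad F p)).
Proof.
move=> [p1 p2] x0; congr (_, _).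
(* The factor 1 - 1 / |xi| of [iota] at xi = [xgrad F q / tg], rewritten so that it is smooth up to
   the corner, where it equals 1. *)
pose c (q : W * Z) := 1 - (1 - enorm q.2) / enorm (xgrad F q).
have sx : smooth_at p (xgrad F) by apply: smooth_at_xgrad => //; exact: sphere_neq0.
have s2 : smooth_at p (fun q : W * Z => 1 - enorm q.2).
  apply: smooth_atB; first exact: smooth_at_cst.
  by apply: smooth_at_enorm; [exact: smooth_at_snd_id|exact: sphere_neq0].
have -> : unit_dir (xgrad F p) = c p *: unit_dir (xgrad F p).
  by rewrite /c p2 subrr mul0r subr0 scale1r.
apply: (ext_eq (G := fun q => c q *: unit_dir (xgrad F q))).
- by split; exact: sphere_cball.
- apply: smooth_at_continuous; apply: smooth_at_scale; last exact: smooth_at_unit_dir.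
  apply: smooth_atB; first exact: smooth_at_cst.
  by apply: smooth_atM => //; exact: smooth_at_inv_enorm.
(* Positivity of this function says |xi| > 3, the range of the explicit formula for [iota]. *)
have sr : smooth_at p (fun q : W * Z => enorm (xgrad F q) - 3 * (1 - enorm q.2)).
  apply: smooth_atB; first exact: smooth_at_enorm.
  by apply: smooth_atM => //; exact: smooth_at_cst.
have n3 : \forall q \near p, 0 < enorm (xgrad F q) - 3 * (1 - enorm q.2).
  apply: (cvgr_gt _ (smooth_at_continuous sr)).
  by rewrite p2 subrr mulr0 subr0 enorm_gt0.
have n4 := near_and (near_fst_far p1) (near_snd_far p2).
apply: filterS2 (near_and (germ_of_near gF) n3) n4 => q [gq q3] [q1 q2] qB.
have q2o : enorm q.2 < 1 by case: qB.
have tq : tg K q = 1 - enorm q.2 by rewrite /tg bdf_far// q2 ltW.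
have t0 : 0 < tg K q by rewrite tq subr_gt0.
have X : tl K (grad_x phi) q = (tg K q)^-1 *: xgrad F q.
  by rewrite -(grad_x_far gq qB q1) scalerA mulVf ?scale1r// gt_eqF.
have nX : enorm ((tg K q)^-1 *: xgrad F q) = enorm (xgrad F q) / tg K q.
  by rewrite enormZ ger0_norm ?invr_ge0 ?(ltW t0)// mulrC.
have x3 : 3 < enorm ((tg K q)^-1 *: xgrad F q).
  by rewrite nX ltr_pdivlMr// tq -subr_gt0.
have xq0 : enorm (xgrad F q) != 0.
  by rewrite gt_eqF//; move: q3; rewrite -tq; lra.
rewrite X iota_far// nX invf_div /c -tq; congr (_ *: _).
rewrite /unit_dir scalerA; congr (_ *: _); rewrite mulrAC mulfV ?mul1r// gt_eqF//.
Qed.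
End AtPoint.
End FaceFormulas.

(** * Gluing, and the face psi *)

Section Gluing.
Context {R : realType} {d s : nat}.
Local Notation E := ('rV[R]_d * 'rV[R]_s)%type.

Lemma near_open (U V : normedModType R) (p : U) (f : U -> V) (P : U -> Prop) : smooth_at p f ->
  (\forall q \near p, P q) ->
  exists D : set U, [/\ open D, D p, (forall k, Ck k D f) & forall q, D q -> P q].
Proof.
move=> [D [oD Dp Cf]] nP; exists (D `&` interior P); split.
- by apply: openI => //; exact: open_interior.
- by split.
- by move=> k; apply: Ck_sub (Cf k) => q [].
- by move=> q [_ /interior_subset].
Qed.

Lemma Ck_open_preimage (U V : normedModType R) (D : set U) (f : U -> V) (D' : set V) :
  open D -> open D' -> Ck 0 D f -> open (D `&` f @^-1` D').
Proof.
move=> oD oD' cf; rewrite openE => q [Dq D'q].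
have h1 : nbhs q D by exact: open_nbhs_nbhs.
have h2 : nbhs q (f @^-1` D') by apply: (cf q Dq); exact: open_nbhs_nbhs.
exact: filterI h1 h2.
Qed.

Lemma boundary_BB (p : E) : BBboundary d s p -> BB d s p.
Proof.
move=> [[] [h1 h2]]; split; rewrite /cball /=; rewrite ?h1 ?h2//; exact: ltW.
Qed.

(** The conclusion of the theorem for two given boundary functions, isolated so that each face can
    be treated by its own statement. *)
Definition boundary_equivalent (V1 V2 : set E) (b1 b2 : E -> R) (p1 p2 : E) : Prop :=
  exists (N1 N2 : set E) (kappa kappa' : E -> E),
    [/\ [/\ relopen (BBboundary d s) N1, N1 p1 & N1 `<=` V1],
        [/\ relopen (BBboundary d s) N2, N2 p2 & N2 `<=` V2],
        homeo_on N1 N2 kappa kappa' /\ kappa p1 = p2,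
        [/\ (forall X p, N1 p -> face_set d s X p -> face_set d s X (kappa p)),
            smooth_on (N1 `&` closed_face_e d s) kappa &
            smooth_on (N1 `&` closed_face_psi d s) kappa] &
        forall p, N1 p -> b2 (kappa p) = b1 p].

(** It suffices to have ambient smooth germs in both directions that respect all faces and are
    mutually inverse along the boundary: restriction then yields the homeomorphism and its
    smoothness on both closed faces. *)
Lemma face_homeomorphism (V1 V2 : set E) (b1 b2 : E -> R) p1 p2 (kappa kappa' : E -> E) :
  relopen (BB d s) V1 -> relopen (BB d s) V2 -> V1 p1 -> V2 p2 ->
  BBboundary d s p1 -> BBboundary d s p2 ->
  smooth_at p1 kappa -> smooth_at p2 kappa' -> kappa p1 = p2 ->
  (\forall q \near p1, forall X, face_set d s X q ->
     [/\ face_set d s X (kappa q), kappa' (kappa q) = q & b2 (kappa q) = b1 q]) ->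
  (\forall q \near p2, forall X, face_set d s X q ->
     face_set d s X (kappa' q) /\ kappa (kappa' q) = q) ->
  boundary_equivalent V1 V2 b1 b2 p1 p2.
Proof.
move=> rV1 rV2 V1p V2p bd1 bd2 sk sk' kp n1 n2.
have [D1 [oD1 D1p C1 P1]] := near_open sk (near_and n1 (relopen_near rV1 V1p)).
have [D2 [oD2 D2p C2 P2]] := near_open sk' (near_and n2 (relopen_near rV2 V2p)).
have k'p : kappa' p2 = p1.
  have [X Xp] := bd1; have [h _] := P1 _ D1p.
  by have [_ + _] := h X Xp; rewrite kp.
(* Each neighbourhood is intersected with the preimage of the other domain, so that the two maps
   send the resulting sets exactly onto each other. *)
pose N1 := (D1 `&` kappa @^-1` D2) `&` BBboundary d s.
pose N2 := (D2 `&` kappa' @^-1` D1) `&` BBboundary d s.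
have bk q : N1 q -> [/\ BBboundary d s (kappa q), kappa' (kappa q) = q & b2 (kappa q) = b1 q].
  move=> [[D1q _] [X Xq]]; have [h _] := P1 _ D1q.
  by have [h1 h2 h3] := h X Xq; split=> //; exists X.
have bk' q : N2 q -> BBboundary d s (kappa' q) /\ kappa (kappa' q) = q.
  move=> [[D2q _] [X Xq]]; have [h _] := P2 _ D2q.
  by have [h1 h2] := h X Xq; split=> //; exists X.
exists N1, N2, kappa, kappa'; split.
- split.
  + exists (D1 `&` kappa @^-1` D2) => //.
    exact: (Ck_open_preimage oD1 oD2 (C1 0%N)).
  + by split=> //; split=> //; rewrite /preimage /= kp.
  + by move=> q [[D1q _] bq]; have [_ +] := P1 _ D1q; apply; exact: boundary_BB.
- split.
  + exists (D2 `&` kappa' @^-1` D1) => //.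
    exact: (Ck_open_preimage oD2 oD1 (C2 0%N)).
  + by split=> //; split=> //; rewrite /preimage /= k'p.
  + by move=> q [[D2q _] bq]; have [_ +] := P2 _ D2q; apply; exact: boundary_BB.
- split=> //; split; first split.
  + move=> q N1q; have [h1 h2 _] := bk _ N1q; have [[D1q D2q] _] := N1q.
    by split=> //; split=> //; rewrite /preimage /= h2.
  + move=> q N2q; have [h1 h2] := bk' _ N2q; have [[D2q D1q] _] := N2q.
    by split=> //; split=> //; rewrite /preimage /= h2.
  + by move=> q /bk[].
  + by move=> q /bk'[].
  + apply: continuous_in_subspaceT => q; rewrite inE => -[[D1q _] _]; exact: (C1 0%N).
  + apply: continuous_in_subspaceT => q; rewrite inE => -[[D2q _] _]; exact: (C2 0%N).
- split.
  + move=> X q [[D1q _] _] Xq; have [h _] := P1 _ D1q.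
    by have [] := h X Xq.
  + by move=> q [[[D1q _] _] _]; exists D1, kappa.
  + by move=> q [[[D1q _] _] _]; exists D1, kappa.
- by move=> q /bk[].
Qed.
Lemma sphere_not_oball n (y : 'rV[R]_n) : sphere n y -> ~ oball n y.
Proof. by rewrite /sphere /oball /= => ->; rewrite ltxx. Qed.

Lemma face_oball_fst X (q : E) : oball d q.1 -> face_set d s X q -> X = Fpsi /\ sphere s q.2.
Proof. by move=> q1; case: X => [[+ _]|[_ +]|[+ _]] => // /sphere_not_oball. Qed.

Lemma face_oball_snd X (q : E) : oball s q.2 -> face_set d s X q -> X = Fe /\ sphere d q.1.
Proof. by move=> q1; case: X => [[+ _]|[_ +]|[_ +]] => // /sphere_not_oball. Qed.
End Gluing.

Section PsiFace.
Context {R : realType} {d s : nat}.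
Variable K : forall n, compactification R n.
Local Notation W := 'rV[R]_d.
Local Notation Z := 'rV[R]_s.

(** If [a1] and [a2] are orthogonal their sum works, otherwise [a1] does. A single direction is
    needed to straighten both functions at once. *)
Lemma common_direction n (a1 a2 : 'rV[R]_n) : a1 != 0 -> a2 != 0 ->
  exists v : 'rV[R]_n, dot v a1 != 0 /\ dot v a2 != 0.
Proof.
move=> a10 a20; have [a12|a12] := eqVneq (dot a1 a2) 0.
  exists (a1 + a2); rewrite !dotDl a12 (dotC a2) a12 addr0 add0r.
  by rewrite !dot_eq0.
by exists a1; rewrite dot_eq0.
Qed.

(** A reflection brings the two base points to the same [gamma] while preserving norms, hence
    faces. *)
Lemma sphere_rotation n (g1 g2 : 'rV[R]_n) : sphere n g1 -> sphere n g2 ->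
  exists Q : 'M[R]_n, [/\ Q *m Q^T = 1%:M, Q *m Q = 1%:M & g1 *m Q = g2].
Proof.
move=> h1 h2; have [|Q [QQ QT gQ]] := @orthogonal_exchange _ _ g1 g2.
  by rewrite [LHS]row_scalar [RHS]row_scalar -!dotE -!enorm_sqr h1 h2.
by exists Q; split=> //; rewrite -{2}QT.
Qed.

(** After the reflection the base points coincide, so the submersion argument moves [x] only and the
    sphere factor is kept. Working in [x] instead of [y] ensures that the result stays in the open
    ball. *)
Lemma equivalent_psi_face (phi1 phi2 : W * Z -> R) (F1 F2 : W * Z -> R) (V1 V2 : set (W * Z)) y0 g1 g2 :
  relopen (BB d s) V1 -> relopen (BB d s) V2 -> V1 (y0, g1) -> V2 (y0, g2) ->
  face_set d s Fpsi (y0, g1) -> face_set d s Fpsi (y0, g2) ->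
  germ_of K phi1 F1 (y0, g1) -> germ_of K phi2 F2 (y0, g2) ->
  gx K phi1 (y0, g1) != 0 -> gx K phi2 (y0, g2) != 0 ->
  bvalue K phi1 (y0, g1) = bvalue K phi2 (y0, g2) ->
  boundary_equivalent V1 V2 (bvalue K phi1) (bvalue K phi2) (y0, g1) (y0, g2).
Proof.
move=> rV1 rV2 V1p V2p f1 f2 G1 G2; rewrite (gx_psi G1 f1) (gx_psi G2 f2) /= => gx1 gx2.
have [/= yo /= sg1] := f1; have [_ /= sg2] := f2.
rewrite (bvalue_psi G1 f1) (bvalue_psi G2 f2) => val.
set x0 := iota_inv (K d) y0 in gx1 gx2.
have iy : Defs.iota (K d) x0 = y0 by exact: iota_invK.
have [Q [QQ Q2 gQ]] := sphere_rotation sg1 sg2.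
have gQ' : g2 *m Q = g1 by rewrite -gQ -mulmxA Q2 mulmx1.
pose rot (q : W * Z) : W * Z := (q.1, q.2 *m Q).
have srot q : smooth_at q rot.
  apply: smooth_at_pair; first exact: smooth_at_fst_id.
  by apply: smooth_at_mulmx; [exact: smooth_at_snd_id|exact: smooth_at_cst].
have rotK q : rot (rot q) = q by rewrite /rot /= -mulmxA Q2 mulmx1; case: q.
pose h1 := fpsi K F1; pose h2 q := fpsi K F2 (rot q).
have sh1 : smooth_at (x0, g1) h1 by exact: (smooth_at_fpsi_face G1 yo).
have rot0 : rot (x0, g1) = (x0, g2) by rewrite /rot /= gQ.
have sf2 : smooth_at (x0, g2) (fpsi K F2) by exact: (smooth_at_fpsi_face G2 yo).
have sh2 : smooth_at (x0, g1) h2.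
  by apply: (smooth_at_comp (g := fpsi K F2) _ (srot _)); rewrite rot0.
have h12 : h1 (x0, g1) = h2 (x0, g1).
  by move: val; rewrite /h1 /h2 rot0 /fpsi /= iy.
have [v [v1 v2]] := common_direction gx1 gx2.
have d1 : 'D_(v, 0) h1 (x0, g1) != 0.
  by rewrite derive_x_dot//; exact: smooth_at_differentiable.
have d2 : 'D_(v, 0) h2 (x0, g1) != 0.
  have -> : 'D_(v, 0) h2 (x0, g1) = 'D_(v, 0) (fpsi K F2) (x0, g2).
    apply: derive_line_eq; near=> h; congr (fpsi K F2 (_, _)).
    by rewrite /= scaler0 !add0r.
  by rewrite derive_x_dot//; exact: smooth_at_differentiable.
have v0 : ((v, 0) : W * Z) != 0.
  by apply: contra v1 => /eqP[->]; rewrite dot0l.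
have [k [k' [[k0 sk sk' k'k kk'] hk fk fk']]] := submersion_equivalence sh1 sh2 h12 d1 d2 v0.
pose inn (q : W * Z) := (iota_inv (K d) q.1, q.2).
pose out (q : W * Z) := (Defs.iota (K d) q.1, q.2).
have sinn q : oball d q.1 -> smooth_at q inn.
  move=> q1; exact: (smooth_at_iota_inv_fst (g := id) q1 (smooth_at_id _)).
have sout q : smooth_at q out by exact: smooth_at_iota_fst.
have inn0 g : inn (y0, g) = (x0, g) by [].
have out0 g : out (x0, g) = (y0, g) by rewrite /out /= iy.
pose ka q := out (rot (k (inn q))).
pose ka' q := out (k' (rot (inn q))).
have ska : smooth_at (y0, g1) ka.
  have s1 : smooth_at (y0, g1) (fun q => k (inn q)).
    by apply: (smooth_at_comp (g := k) _ (sinn (y0, g1) yo)); rewrite inn0.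
  have s2 : smooth_at (y0, g1) (fun q => rot (k (inn q))).
    exact: (smooth_at_comp (g := rot) _ s1 (srot _)).
  exact: (smooth_at_comp (g := out) _ s2 (sout _)).
have s1 : smooth_at (y0, g2) (fun q => rot (inn q)).
  exact: (smooth_at_comp (g := rot) _ (sinn (y0, g2) yo) (srot _)).
have ska' : smooth_at (y0, g2) ka'.
  have s2 : smooth_at (y0, g2) (fun q => k' (rot (inn q))).
    by apply: (smooth_at_comp (g := k') _ s1); rewrite inn0 /rot /= gQ'.
  exact: (smooth_at_comp (g := out) _ s2 (sout _)).
have ka0 : ka (y0, g1) = (y0, g2) by rewrite /ka inn0 k0 rot0 out0.
have nb (g : Z) : \forall q \near (y0, g), oball d q.1.
  exact: (smooth_at_near_comp (P := oball d) (smooth_at_fst_id (y0, g)) (near_enorm_lt yo)).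
have ka2 : \forall q \near (y0, g1), (k (inn q)).2 = q.2.
  have := smooth_at_near_comp (P := fun q => exists a : R, k q = q + ((x0, g1) - (x0, g1)) + a *: (v, 0)) (sinn (y0, g1) yo).
  rewrite inn0 => /(_ fk); apply: filterS => q [a ->].
  by rewrite subrr addr0 /= scaler0 addr0.
have ka2' : \forall q \near (y0, g2), (k' (rot (inn q))).2 = q.2 *m Q.
  have := smooth_at_near_comp (P := fun q => exists a : R, k' q = q - ((x0, g1) - (x0, g1)) + a *: (v, 0)) s1.
  rewrite inn0 {1}/rot /= gQ' => /(_ fk'); apply: filterS => q [a ->].
  by rewrite subrr subr0 /= scaler0 addr0.
have outinn q : oball d q.1 -> out (inn q) = q.
  by move=> q1; rewrite /out /inn /= iota_invK//; case: q q1.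
have innout q : inn (out q) = q by rewrite /inn /out /= iotaK; case: q.
have n1 : \forall q \near (y0, g1), k' (k (inn q)) = inn q.
  by apply: (smooth_at_near_comp (P := fun q => k' (k q) = q) (sinn (y0, g1) yo)); rewrite inn0.
have n2 : \forall q \near (y0, g2), k (k' (rot (inn q))) = rot (inn q).
  by apply: (smooth_at_near_comp (P := fun q => k (k' q) = q) s1); rewrite inn0 /rot /= gQ'.
have n3 : \forall q \near (y0, g1), h2 (k (inn q)) = h1 (inn q).
  by apply: (smooth_at_near_comp (P := fun q => h2 (k q) = h1 q) (sinn (y0, g1) yo)); rewrite inn0.
have n4 : \forall q \near (y0, g1), germ_of K phi2 F2 (ka q).
  by apply: (smooth_at_near_comp (P := germ_of K phi2 F2) ska); rewrite ka0; exact: germ_of_near.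
apply: (@face_homeomorphism _ _ _ V1 V2 _ _ _ _ ka ka') => //.
- by exists Fpsi.
- by exists Fpsi.
- apply: filterS2 (near_and (near_and n1 (nb g1)) (near_and n3 n4)) (near_and (germ_of_near G1) ka2).
  move=> q [[q1 q2] [q3 q4]] [q5 q6] X Xq.
  have [XE sq] := face_oball_fst q2 Xq; rewrite XE in Xq *.
  have fka : face_set d s Fpsi (ka q).
    split; first exact: iota_oball.
    by rewrite /sphere /ka /= q6 enorm_mul_orthogonal.
  split=> //.
    by rewrite /ka' /ka innout rotK q1 outinn.
  rewrite (bvalue_psi q4 fka) (bvalue_psi q5 Xq).
  transitivity (h1 (inn q)); first by rewrite -q3.
  by rewrite /h1 /fpsi /ty /inn /= iota_invK//; case: (q).
- apply: filterS2 (near_and n2 (nb g2)) ka2' => q [q1 q2] q6 X Xq.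
  have [XE sq] := face_oball_fst q2 Xq; rewrite XE in Xq *.
  split; last by rewrite /ka /ka' innout q1 rotK outinn.
  split; first exact: iota_oball.
  by rewrite /sphere /ka' /= q6 enorm_mul_orthogonal.
Unshelve. all: by end_near. Qed.
End PsiFace.

(** * The corner *)

Section SphereChart.
Context {R : realType} {n : nat}.
Local Notation V := 'rV[R]_n.+1.

(** The rows other than the first of a symmetric orthogonal matrix with first row [y0] form an
    orthonormal basis of the tangent space at [y0]. *)
Lemma sphere_frame (y0 : V) : sphere n.+1 y0 -> exists E : 'M[R]_(n, n.+1),
  [/\ E *m E^T = 1%:M, y0 *m E^T = 0 & E^T *m E = 1%:M - y0^T *m y0].
Proof.
move=> y1; have [|Q [QQ QT eQ]] := @orthogonal_exchange _ (1 + n) (row_mx 1%:M 0) y0.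
  rewrite tr_row_mx mul_row_col trmx1 mulmx1 trmx0 mulmx0 addr0.
  by rewrite [RHS]row_scalar -dotE -enorm_sqr y1 expr1n.
pose E : 'M[R]_(n, 1 + n) := dsubmx Q.
have QE : Q = col_mx (y0 : 'M[R]_(1, 1 + n)) E.
  rewrite -[LHS]vsubmxK; congr col_mx.
  by rewrite -eQ -{2}[Q]vsubmxK mul_row_col mul1mx mul0mx addr0.
have Q2 : Q^T *m Q = 1%:M by rewrite QT -{2}QT.
have h1 : block_mx (y0 *m y0^T) (y0 *m E^T) (E *m y0^T) (E *m E^T) = block_mx 1%:M 0 0 1%:M.
  by rewrite -mul_col_row -tr_col_mx -QE QQ -scalar_mx_block.
have h2 : y0^T *m y0 + E^T *m E = 1%:M by rewrite -mul_row_col -tr_col_mx -QE.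
have [_ yE _ EE] := eq_block_mx h1.
by exists E; split=> //; rewrite -h2 addrC addKr.
Qed.

Variables (y0 : V) (E : 'M[R]_(n, n.+1)).
Hypotheses (y01 : sphere n.+1 y0) (EE : E *m E^T = 1%:M) (yE : y0 *m E^T = 0)
  (EtE : E^T *m E = 1%:M - y0^T *m y0).

(** Central projection of the affine tangent hyperplane at [y0] to the sphere. Its inverse [cx] is
    homogeneous of degree 0, so it is also defined off the sphere. *)
Definition sph (x : 'rV[R]_n) : V := unit_dir (y0 + x *m E).
Definition cx (y : V) : 'rV[R]_n := (dot y y0)^-1 *: (y *m E^T).

Lemma dot_base (x : 'rV[R]_n) : dot (y0 + x *m E) y0 = 1.
Proof.
rewrite dotDl -enorm_sqr y01 expr1n !dotE -mulmxA -[E *m _]trmxK trmx_mul trmxK yE.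
by rewrite trmx0 mulmx0 mxE addr0.
Qed.

Lemma base_neq0 (x : 'rV[R]_n) : y0 + x *m E != 0.
Proof.
apply/eqP => h; have := dot_base x; rewrite h dot0l => /esym/eqP.
by rewrite oner_eq0.
Qed.

Lemma enorm_sph x : enorm (sph x) = 1.
Proof. exact/enorm_unit_dir/base_neq0. Qed.

Lemma cx_sph r x : r != 0 -> cx (r *: sph x) = x.
Proof.
move=> r0; rewrite /cx /sph /unit_dir scalerA; set c := r * _.
have c0 : c != 0 by rewrite mulf_neq0// invr_neq0// enorm_eq0 base_neq0.
rewrite dotZl dot_base mulr1 -scalemxAl scalerA mulVf// scale1r.
by rewrite mulmxDl yE add0r -mulmxA EE mulmx1.
Qed.

Lemma base_cx y : dot y y0 != 0 -> y0 + cx y *m E = (dot y y0)^-1 *: y.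
Proof.
move=> d0; rewrite /cx -scalemxAl -mulmxA EtE mulmxBr mulmx1 mulmxA.
rewrite [y *m y0^T]row_scalar -dotE mul_scalar_mx scalerBr scalerA mulVf// scale1r.
by rewrite addrC subrK.
Qed.

Lemma sph_cx y : 0 < dot y y0 -> sph (cx y) = unit_dir y.
Proof.
move=> d0; rewrite /sph base_cx ?gt_eqF// /unit_dir enormZ gtr0_norm ?invr_gt0//.
by rewrite invfM invrK mulrC scalerA -mulrA mulfV ?mulr1// gt_eqF.
Qed.

Lemma enorm_unit (y : V) : y != 0 -> enorm y *: unit_dir y = y.
Proof. by move=> y00; rewrite scalerA mulfV ?scale1r// enorm_eq0. Qed.

Lemma dot_neq0l (y : V) : 0 < dot y y0 -> y != 0.
Proof. by apply: contraTneq => ->; rewrite dot0l ltxx. Qed.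

Lemma sph0 : sph 0 = y0.
Proof. by rewrite /sph mul0mx addr0 unit_dir_sphere. Qed.

Lemma cx0 : cx y0 = 0.
Proof. by rewrite /cx yE scaler0. Qed.

Lemma dot_y0 : dot y0 y0 = 1.
Proof. by rewrite -enorm_sqr y01 expr1n. Qed.

Lemma near_dot_gt0 : \forall y \near y0, 0 < dot y y0.
Proof.
have s1 : smooth_at y0 (fun y : V => dot y y0).
  by apply: smooth_at_dot; [exact: smooth_at_id|exact: smooth_at_cst].
by apply: (cvgr_gt _ (smooth_at_continuous s1)); rewrite dot_y0.
Qed.

Lemma smooth_at_sph x : smooth_at x sph.
Proof.
apply: smooth_at_unit_dir; last exact: base_neq0.
apply: smooth_atD; first exact: smooth_at_cst.
by apply: smooth_at_mulmx; [exact: smooth_at_id|exact: smooth_at_cst].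
Qed.

Lemma smooth_at_cx y : dot y y0 != 0 -> smooth_at y cx.
Proof.
move=> d0; apply: smooth_at_scale.
  by apply: smooth_atV => //; apply: smooth_at_dot; [exact: smooth_at_id|exact: smooth_at_cst].
by apply: smooth_at_mulmx; [exact: smooth_at_id|exact: smooth_at_cst].
Qed.

Lemma derive_sph x (v : 'rV[R]_n) : 'D_v sph x =
  (enorm (y0 + x *m E))^-1 *: (v *m E - dot (sph x) (v *m E) *: sph x).
Proof.
rewrite -(derive_unit_dir _ (base_neq0 x)); apply: derive_line_eq.
by near=> h; rewrite /sph mulmxDl -scalemxAl addrCA.
Unshelve. all: by end_near. Qed.

Lemma derive_sph0 (v : 'rV[R]_n) : 'D_v sph 0 = v *m E.
Proof.
rewrite derive_sph sph0 mul0mx addr0 y01 invr1 scale1r dotE trmx_mul mulmxA yE mul0mx mxE.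
by rewrite scale0r subr0.
Qed.
End SphereChart.

Section SphereGradients.
Context {R : realType} {d s : nat}.
Implicit Types (F : 'rV[R]_d * 'rV[R]_s -> R).

Lemma xgrad_sphere F p : sphere d p.1 ->
  xgrad F p = F p *: p.1 + (grad_x F p - dot p.1 (grad_x F p) *: p.1).
Proof. exact: far_grad_sphere. Qed.

Lemma thgrad_sphere F p : sphere s p.2 ->
  thgrad F p = F p *: p.2 + (gradz F p - dot p.2 (gradz F p) *: p.2).
Proof. exact: far_grad_sphere. Qed.

(** On the sphere the radial component of [thgrad F] is [F] itself. *)
Lemma thgrad_eq0 F p : sphere s p.2 -> thgrad F p = 0 -> F p = 0.
Proof.
move=> p2; rewrite thgrad_sphere// => h.
have : dot (F p *: p.2 + (gradz F p - dot p.2 (gradz F p) *: p.2)) p.2 = 0 by rewrite h dot0l.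
rewrite !(dotDl, dotZl) -scaleNr dotZl -enorm_sqr p2 expr1n !mulr1 (dotC (gradz F p)).
by rewrite subrr addr0.
Qed.
End SphereGradients.

Section Corner.
Context {R : realType} {n s : nat}.
Variable K : forall n, compactification R n.
Local Notation W := 'rV[R]_n.+1.
Local Notation Z := 'rV[R]_s.
Local Notation P := ('rV[R]_n * 'rV[R]_(1 + s))%type.

(** Polar coordinates in [y], with |y| and [gamma] together as second component: a map that changes
    only the first component preserves |y| and |gamma|. *)
Definition polar_out (y0 : W) E (q : P) : W * Z :=
  ((lsubmx q.2) 0 0 *: sph y0 E q.1, rsubmx q.2).
Definition polar_in (y0 : W) E (q : W * Z) : P :=
  (cx y0 E q.1, row_mx (enorm q.1)%:M q.2).

Section Polar.
Variables (y0 : W) (E : 'M[R]_(n, n.+1)).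
Hypotheses (y01 : sphere n.+1 y0) (EE : E *m E^T = 1%:M) (yE : y0 *m E^T = 0)
  (EtE : E^T *m E = 1%:M - y0^T *m y0).
Local Notation inn := (polar_in y0 E).
Local Notation out := (polar_out y0 E).

Lemma smooth_at_polar_out q : smooth_at q out.
Proof.
have s2 : smooth_at q (fun q : P => q.2) by exact: smooth_at_snd_id.
apply: smooth_at_pair.
  apply: smooth_at_scale.
    apply: smooth_at_coord; apply: (smooth_at_comp (g := lsubmx) _ s2).
    exact/smooth_at_linear/findim_linear_continuous.
  apply: (smooth_at_comp (g := sph y0 E) _ (smooth_at_fst_id q)).
  exact: smooth_at_sph.
apply: (smooth_at_comp (g := rsubmx) _ s2).
exact/smooth_at_linear/findim_linear_continuous.
Qed.

Lemma smooth_at_polar_in q : dot q.1 y0 != 0 -> smooth_at q inn.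
Proof.
move=> d0; have q0 : q.1 != 0 by apply: contra_neq d0 => ->; rewrite dot0l.
apply: smooth_at_pair.
  apply: (smooth_at_comp (g := cx y0 E) _ (smooth_at_fst_id q)); exact: smooth_at_cx.
apply: (smooth_at_comp (f := fun q : W * Z => ((enorm q.1)%:M, q.2)) (g := row_pair)).
  apply: smooth_at_pair; last exact: smooth_at_snd_id.
  apply: smooth_at_mx => i j; rewrite !ord1.
  apply: (@eq_smooth_at _ _ _ _ (fun q : W * Z => enorm q.1)); first by near=> x; rewrite mxE eqxx.
  by apply: smooth_at_enorm => //; exact: smooth_at_fst_id.
exact/smooth_at_linear/findim_linear_continuous.
Unshelve. all: by end_near. Qed.

Lemma polar_out_in q : 0 < dot q.1 y0 -> out (inn q) = q.
Proof.
move=> d0; rewrite /polar_out /polar_in /= row_mxKl row_mxKr mxE eqxx mulr1n.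
by rewrite (sph_cx EtE d0) enorm_unit ?(dot_neq0l d0)//; case: (q).
Qed.

Lemma polar_in_out q : 0 < (lsubmx q.2) 0 0 -> inn (out q) = q.
Proof.
move=> r0; rewrite /polar_out /polar_in /= (cx_sph y01 EE yE) ?gt_eqF//.
rewrite enormZ (enorm_sph y01 yE) mulr1 gtr0_norm// -row_scalar hsubmxK.
by case: (q).
Qed.
End Polar.

(** Where the value vanishes, [xgrad] is the tangential part of the gradient, and E^T E is the
    projector to the tangent space. *)
Lemma tangential_gradient_neq0 (y0 : W) (E : 'M[R]_(n, n.+1)) (F : W * Z -> R) g :
  sphere n.+1 y0 -> E^T *m E = 1%:M - y0^T *m y0 -> F (y0, g) = 0 ->
  xgrad F (y0, g) != 0 -> grad_x F (y0, g) *m E^T != 0.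
Proof.
move=> y01 EtE F0; apply: contra_neq => h; rewrite xgrad_sphere// F0 scale0r add0r /=.
have := congr1 (mulmx^~ E) h; rewrite mul0mx -mulmxA EtE mulmxBr mulmx1 mulmxA.
by rewrite [grad_x F _ *m y0^T]row_scalar -dotE mul_scalar_mx dotC.
Qed.

(** Near the corner the three symbols are F, F / [tg] and F / [ty]. The map preserves both radii, on
    which [tg] and [ty] depend there, so [F2 (ka q) = F1 q] settles all of them. *)
Lemma equivalent_corner (phi1 phi2 : W * Z -> R) (F1 F2 : W * Z -> R) (V1 V2 : set (W * Z)) y0 g1 g2 :
  relopen (BB n.+1 s) V1 -> relopen (BB n.+1 s) V2 -> V1 (y0, g1) -> V2 (y0, g2) ->
  face_set n.+1 s Fpsie (y0, g1) -> face_set n.+1 s Fpsie (y0, g2) ->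
  germ_of K phi1 F1 (y0, g1) -> germ_of K phi2 F2 (y0, g2) ->
  gx K phi1 (y0, g1) != 0 -> gx K phi2 (y0, g2) != 0 ->
  gth K phi1 (y0, g1) = 0 -> gth K phi2 (y0, g2) = 0 ->
  boundary_equivalent V1 V2 (bvalue K phi1) (bvalue K phi2) (y0, g1) (y0, g2).
Proof.
move=> rV1 rV2 V1p V2p f1 f2 G1 G2.
have [/= y01 /= sg1] := f1; have [_ /= sg2] := f2.
have y0c := sphere_cball y01.
rewrite (gx_sphere G1 y01 (sphere_cball sg1)) (gx_sphere G2 y01 (sphere_cball sg2)).
rewrite (gth_sphere G1 y0c sg1) (gth_sphere G2 y0c sg2) => gx1 gx2.
move=> th1 th2; have F10 := @thgrad_eq0 _ _ _ F1 (y0, g1) sg1 th1.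
have F20 := @thgrad_eq0 _ _ _ F2 (y0, g2) sg2 th2.
have [E [EE yE EtE]] := sphere_frame y01.
have [Q [QQ Q2 gQ]] := sphere_rotation sg1 sg2.
have gQ' : g2 *m Q = g1 by rewrite -gQ -mulmxA Q2 mulmx1.
pose rot (q : W * Z) : W * Z := (q.1, q.2 *m Q).
have srot q : smooth_at q rot.
  apply: smooth_at_pair; first exact: smooth_at_fst_id.
  by apply: smooth_at_mulmx; [exact: smooth_at_snd_id|exact: smooth_at_cst].
have rotK q : rot (rot q) = q by rewrite /rot /= -mulmxA Q2 mulmx1; case: q.
pose inn (q : W * Z) : P := polar_in y0 E q; pose out (q : P) : W * Z := polar_out y0 E q.
pose w0 : P := (0, row_mx 1%:M g1).
have inn0 : inn (y0, g1) = w0 by rewrite /inn /polar_in /= y01 /cx yE scaler0.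
have sout q : smooth_at q out by exact: smooth_at_polar_out.
have sinn q : dot q.1 y0 != 0 -> smooth_at q inn by exact: smooth_at_polar_in.
have d0 : dot y0 y0 != 0 by rewrite (dot_y0 y01) oner_neq0.
have out0 : out w0 = (y0, g1).
  by rewrite /out /polar_out /= row_mxKl row_mxKr mxE eqxx scale1r (sph0 _ y01).
have rot0 : rot (y0, g1) = (y0, g2) by rewrite /rot /= gQ.
have rot0' : rot (y0, g2) = (y0, g1) by rewrite /rot /= gQ'.
pose h1 q := F1 (out q); pose h2 q := F2 (rot (out q)).
have sro q : smooth_at q (fun q => rot (out q)).
  exact: (smooth_at_comp (g := rot) _ (sout _) (srot _)).
have sh1 : smooth_at w0 h1.
  by apply: (smooth_at_comp (g := F1) _ (sout _)); rewrite out0; exact: G1.1.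
have sh2 : smooth_at w0 h2.
  by apply: (smooth_at_comp (g := F2) _ (sro _)); rewrite out0 rot0; exact: G2.1.
have h12 : h1 w0 = h2 w0 by rewrite /h1 /h2 out0 rot0 F10 F20.
have a1 := tangential_gradient_neq0 y01 EtE F10 gx1.
have a2 := tangential_gradient_neq0 y01 EtE F20 gx2.
have [v [v1 v2]] := common_direction a1 a2.
have der (F : W * Z -> R) (o : P -> W * Z) g : smooth_at (y0, g) F ->
    (forall h : R, o (h *: (v, 0) + w0) = (sph y0 E (h *: v + 0), g)) ->
    'D_(v, 0) (fun q => F (o q)) w0 = dot v (grad_x F (y0, g) *m E^T).
  move=> sF oE.
  have -> : 'D_(v, 0) (fun q => F (o q)) w0 = 'D_v (fun x => F (sph y0 E x, g)) 0.
    by apply: derive_line_eq; near=> h; rewrite oE.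
  have ss : smooth_at (0 : 'rV[R]_n) (fun x => (sph y0 E x, g)).
    by apply: smooth_at_pair; [exact: smooth_at_sph|exact: smooth_at_cst].
  rewrite (derive_comp (g := F)); last 2 first.
  - exact: smooth_at_differentiable.
  - by rewrite (sph0 _ y01); exact: smooth_at_differentiable.
  rewrite derive_pair; last 2 first.
  - by apply: smooth_at_differentiable; exact: smooth_at_sph.
  - exact: smooth_at_differentiable (smooth_at_cst _ _).
  rewrite derive_cst (derive_sph0 y01 yE) (sph0 _ y01) derive_x_dot; last exact: smooth_at_differentiable.
  by rewrite !dotE trmx_mul trmxK mulmxA.
have oE (h : R) : out (h *: (v, 0) + w0) = (sph y0 E (h *: v + 0), g1).
  by rewrite /out /polar_out /= scaler0 add0r row_mxKl row_mxKr mxE eqxx scale1r.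
have d1 : 'D_(v, 0) h1 w0 != 0 by rewrite (der F1 out g1)//; exact: G1.1.
have d2 : 'D_(v, 0) h2 w0 != 0.
  rewrite (der F2 (fun q => rot (out q)) g2)//; first exact: G2.1.
  by move=> h; rewrite oE /rot /= gQ.
have v0 : ((v, 0) : P) != 0.
  by apply: contra v1 => /eqP[->]; rewrite dot0l.
have [k [k' [[k0 sk sk' k'k kk'] hk fk fk']]] := submersion_equivalence sh1 sh2 h12 d1 d2 v0.
pose ka q := rot (out (k (inn q))).
pose ka' q := out (k' (inn (rot q))).
have s0 : smooth_at (y0, g1) inn by exact: sinn.
have s1 : smooth_at (y0, g1) (fun q => k (inn q)).
  by apply: (smooth_at_comp (g := k) _ s0); rewrite inn0.
have ska : smooth_at (y0, g1) ka by exact: (smooth_at_comp (g := fun q => rot (out q)) _ s1 (sro _)).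
have s2 : smooth_at (y0, g2) (fun q => inn (rot q)).
  by apply: (smooth_at_comp (g := inn) _ (srot _)); rewrite rot0'.
have ska' : smooth_at (y0, g2) ka'.
  have s3 : smooth_at (y0, g2) (fun q => k' (inn (rot q))).
    by apply: (smooth_at_comp (g := k') _ s2); rewrite rot0' inn0.
  exact: (smooth_at_comp (g := out) _ s3 (sout _)).
have ka0 : ka (y0, g1) = (y0, g2) by rewrite /ka inn0 k0 out0 rot0.
have ka2 : \forall q \near (y0, g1), (k (inn q)).2 = (inn q).2.
  have := smooth_at_near_comp (P := fun q => exists a : R, k q = q + (w0 - w0) + a *: (v, 0)) s0.
  rewrite inn0 => /(_ fk); apply: filterS => q [a ->].
  by rewrite subrr addr0 /= scaler0 addr0.
have ka2' : \forall q \near (y0, g2), (k' (inn (rot q))).2 = (inn (rot q)).2.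
  have := smooth_at_near_comp (P := fun q => exists a : R, k' q = q - (w0 - w0) + a *: (v, 0)) s2.
  rewrite rot0' inn0 => /(_ fk'); apply: filterS => q [a ->].
  by rewrite subrr subr0 /= scaler0 addr0.
have n1 : \forall q \near (y0, g1), k' (k (inn q)) = inn q.
  by apply: (smooth_at_near_comp (P := fun q => k' (k q) = q) s0); rewrite inn0.
have n2 : \forall q \near (y0, g2), k (k' (inn (rot q))) = inn (rot q).
  by apply: (smooth_at_near_comp (P := fun q => k (k' q) = q) s2); rewrite rot0' inn0.
have n3 : \forall q \near (y0, g1), h2 (k (inn q)) = h1 (inn q).
  by apply: (smooth_at_near_comp (P := fun q => h2 (k q) = h1 q) s0); rewrite inn0.
have n4 : \forall q \near (y0, g1), germ_of K phi2 F2 (ka q).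
  by apply: (smooth_at_near_comp (P := germ_of K phi2 F2) ska); rewrite ka0; exact: germ_of_near.
have nd (g : Z) : \forall q \near (y0, g), 0 < dot q.1 y0.
  exact: (smooth_at_near_comp (P := fun y => 0 < dot y y0) (smooth_at_fst_id (y0, g)) (near_dot_gt0 y01)).
have far1 : \forall q \near (y0, g1), 2 / 3 < enorm q.1 by exact: near_fst_far.
have far2 : \forall q \near (y0, g1), 2 / 3 < enorm q.2 by exact: near_snd_far.
have nrot q : enorm (rot q).2 = enorm q.2 by rewrite enorm_mul_orthogonal.
have kaE q : (k (inn q)).2 = (inn q).2 -> enorm (ka q).1 = enorm q.1 /\ enorm (ka q).2 = enorm q.2.
  move=> h; split.
    rewrite /ka /rot /= h /= row_mxKl mxE eqxx mulr1n enormZ (enorm_sph y01 yE).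
    by rewrite mulr1 ger0_norm ?enorm_ge0.
  by rewrite /ka nrot /= h /= row_mxKr.
have kaE' q : (k' (inn (rot q))).2 = (inn (rot q)).2 ->
    enorm (ka' q).1 = enorm q.1 /\ enorm (ka' q).2 = enorm q.2.
  move=> h; split.
    rewrite /ka' /= h /= row_mxKl mxE eqxx mulr1n enormZ (enorm_sph y01 yE).
    by rewrite mulr1 ger0_norm ?enorm_ge0.
  by rewrite /ka' /= h /= row_mxKr enorm_mul_orthogonal.
have faceE X (q q' : W * Z) : enorm q'.1 = enorm q.1 -> enorm q'.2 = enorm q.2 ->
    face_set n.+1 s X q -> face_set n.+1 s X q'.
  by case: X => e1 e2 [] h3 h4; split; rewrite /sphere /oball /= ?e1 ?e2.
have inner0 q w : 0 < dot q.1 y0 -> w = (inn q).2 -> 0 < (lsubmx w) 0 0.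
  by move=> qd ->; rewrite /= row_mxKl mxE eqxx mulr1n enorm_gt0 (dot_neq0l qd).
have bvalueE X phi F q : germ_of K phi F q -> face_set n.+1 s X q ->
    bvalue K phi q = match X with Fe => F q / tg K q | Fpsi => F q / ty K q | Fpsie => F q end.
  by case: X => G qX; [exact: bvalue_e|exact: bvalue_psi|exact: bvalue_corner].
have bdfE m (y y' : 'rV[R]_m) : enorm y' = enorm y -> 2 / 3 < enorm y -> cball m y -> bdf (K m) y' = bdf (K m) y.
  by move=> e1 e2 e3; rewrite !bdf_far ?e1// e2.
apply: (@face_homeomorphism _ _ _ V1 V2 _ _ _ _ ka ka') => //.
- by exists Fpsie.
- by exists Fpsie.
- apply: filterS2 (near_and (near_and n1 (nd g1)) (near_and n3 n4)) (near_and (near_and (germ_of_near G1) ka2) (near_and far1 far2)).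
  move=> q [[q1 q2] [q3 q4]] [[q5 q6] [q7 q8]] X Xq.
  have [e1 e2] := kaE _ q6.
  have fka : face_set n.+1 s X (ka q) by exact: faceE e1 e2 Xq.
  have [c1 c2] : BB n.+1 s q by apply: boundary_BB; exists X.
  split=> //.
    rewrite /ka' /ka rotK /inn (polar_in_out y01 EE yE) ?(inner0 q)// -/inn q1.
    by apply: (polar_out_in EtE).
  rewrite (bvalueE _ _ _ _ q4 fka) (bvalueE _ _ _ _ q5 Xq).
  have FF : F2 (ka q) = F1 q.
    by move: q3; rewrite /h1 /h2 /ka /out (polar_out_in EtE).
  by rewrite FF /tg /ty (bdfE _ _ _ e1)// (bdfE _ _ _ e2).
- apply: filterS2 (near_and n2 (nd g2)) ka2' => q [q1 q2] q6 X Xq.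
  have [e1 e2] := kaE' _ q6.
  split; first exact: faceE e1 e2 Xq.
  rewrite /ka' /ka /inn (polar_in_out y01 EE yE) -/inn; last exact: (inner0 (rot q)).
  by rewrite q1 /out (polar_out_in EtE).
Unshelve. all: by end_near. Qed.
End Corner.

(** * The face e *)

Section LegendreChart.
Context {R : realType} {n : nat}.
Local Notation W := 'rV[R]_n.+1.
Local Notation V := 'rV[R]_n.
Variables (y0 : W) (E : 'M[R]_(n, n.+1)).
Hypotheses (y01 : sphere n.+1 y0) (EE : E *m E^T = 1%:M) (yE : y0 *m E^T = 0)
  (EtE : E^T *m E = 1%:M - y0^T *m y0).

(* If [xi] is the x-gradient of a function homogeneous of degree 1 with value [f] on the sphere,
   this is the 1-jet of [f] in the affine chart [cx]: [f = <xi, y>] by Euler's identity. *)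
Definition jet_of (z : W * W) : R * (V * V) :=
  (dot z.2 z.1, (cx y0 E z.1, dot z.1 y0 *: ((z.2 - dot z.2 z.1 *: z.1) *m E^T))).

(** The value gives the component of the covector along [y], the gradient gives the [E]-components
    of the tangential part, and orthogonality to [y] determines the remaining component along
    [y0]. *)
Definition of_jet (j : R * (V * V)) : W * W :=
  let y := sph y0 E j.2.1 in let b := (dot y y0)^-1 *: j.2.2 in
  (y, j.1 *: y + (b *m E - (dot b (y *m E^T) / dot y y0) *: y0)).

Lemma dot_mulmxl m (u : 'rV[R]_m) l (M : 'M[R]_(m, l)) (v : 'rV[R]_l) :
  dot (u *m M) v = dot u (v *m M^T).
Proof. by rewrite !dotE trmx_mul trmxK mulmxA. Qed.

Lemma dot_sph x : dot (sph y0 E x) y0 = (enorm (y0 + x *m E))^-1.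
Proof. by rewrite /sph dotZl (dot_base y01 yE) mulr1. Qed.

Lemma dot_sph_gt0 x : 0 < dot (sph y0 E x) y0.
Proof. by rewrite dot_sph invr_gt0 enorm_gt0 (base_neq0 y01 yE). Qed.

Lemma jet_ofK y xi : sphere n.+1 y -> 0 < dot y y0 -> of_jet (jet_of (y, xi)) = (y, xi).
Proof.
move=> y1 d0; rewrite /of_jet /jet_of /= (sph_cx EtE d0) unit_dir_sphere//.
have d0' : dot y y0 != 0 by rewrite gt_eqF.
rewrite scalerA mulVf// scale1r.
set t := dot xi y; set tau := xi - t *: y.
have ty0 : dot tau y = 0.
  by rewrite /tau dotDl -scaleNr dotZl -enorm_sqr y1 expr1n mulr1 subrr.
have tE : tau *m E^T *m E = tau - dot tau y0 *: y0.
  by rewrite -mulmxA EtE mulmxBr mulmx1 mulmxA [tau *m y0^T]row_scalar -dotE mul_scalar_mx.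
have bE : dot (tau *m E^T) (y *m E^T) = - dot tau y0 * dot y y0.
  rewrite -dot_mulmxl tE dotDl -scaleNr dotZl ty0 add0r (dotC y0); ring.
rewrite tE bE mulfK// scaleNr opprK subrK; congr (_, _).
by rewrite /tau addrC subrK.
Qed.

Lemma smooth_at_jet_of z : dot z.1 y0 != 0 -> smooth_at z jet_of.
Proof.
move=> d0; have s1 : smooth_at z (fun z : W * W => z.1) by exact: smooth_at_fst_id.
have s2 : smooth_at z (fun z : W * W => z.2) by exact: smooth_at_snd_id.
have sd := smooth_at_dot s2 s1.
apply: smooth_at_pair => //; apply: smooth_at_pair.
  apply: (smooth_at_comp (g := cx y0 E) _ s1); exact: smooth_at_cx.
apply: smooth_at_scale; first by apply: smooth_at_dot => //; exact: smooth_at_cst.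
apply: smooth_at_mulmx; last exact: smooth_at_cst.
by apply: smooth_atB => //; exact: smooth_at_scale.
Qed.

Lemma smooth_at_of_jet j : smooth_at j of_jet.
Proof.
have s1 : smooth_at j (fun j : R * (V * V) => j.1) by apply: smooth_at_fst; exact: smooth_at_id.
have s2 : smooth_at j (fun j : R * (V * V) => j.2) by apply: smooth_at_snd; exact: smooth_at_id.
have s21 := smooth_at_fst s2; have s22 := smooth_at_snd s2.
have sy : smooth_at j (fun j : R * (V * V) => sph y0 E j.2.1).
  by apply: (smooth_at_comp (g := sph y0 E) _ s21); exact: smooth_at_sph.
have sd : smooth_at j (fun j : R * (V * V) => (dot (sph y0 E j.2.1) y0)^-1).
  apply: smooth_atV; first by apply: smooth_at_dot => //; exact: smooth_at_cst.
  by rewrite gt_eqF// dot_sph_gt0.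
have sb := smooth_at_scale sd s22.
apply: smooth_at_pair => //; apply: smooth_atD; first exact: smooth_at_scale.
apply: smooth_atB; first by apply: smooth_at_mulmx => //; exact: smooth_at_cst.
apply: smooth_at_scale; last exact: smooth_at_cst.
apply: smooth_atM => //; apply: smooth_at_dot => //.
by apply: smooth_at_mulmx => //; exact: smooth_at_cst.
Qed.
End LegendreChart.

Section EFace.
Context {R : realType} {n s : nat}.
Variable K : forall n, compactification R n.
Local Notation W := 'rV[R]_n.+1.
Local Notation V := 'rV[R]_n.
Local Notation Z := 'rV[R]_s.
Variables (y0 : W) (E : 'M[R]_(n, n.+1)).
Hypotheses (y01 : sphere n.+1 y0) (EE : E *m E^T = 1%:M) (yE : y0 *m E^T = 0)
  (EtE : E^T *m E = 1%:M - y0^T *m y0).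

Definition face_out (z : V * Z) : W * Z := (sph y0 E z.1, Defs.iota (K s) z.2).
Definition face_in (q : W * Z) : V * Z := (cx y0 E q.1, iota_inv (K s) q.2).

Lemma face_inK z : face_in (face_out z) = z.
Proof.
rewrite /face_in /face_out /= iotaK -[sph _ _ _]scale1r (cx_sph y01 EE yE) ?oner_neq0//.
by case: z.
Qed.

Lemma face_outK q : face_set n.+1 s Fe q -> 0 < dot q.1 y0 -> face_out (face_in q) = q.
Proof.
move=> [q1 q2] d0; rewrite /face_in /face_out /= iota_invK// (sph_cx EtE d0) unit_dir_sphere//.
by case: q q1 q2 d0.
Qed.

Lemma face_out_e z : face_set n.+1 s Fe (face_out z).
Proof. by split; [exact: enorm_sph|exact: iota_oball]. Qed.

Lemma smooth_at_face_out z : smooth_at z face_out.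
Proof.
apply: smooth_at_pair.
  apply: (smooth_at_comp (g := sph y0 E) _ (smooth_at_fst_id z)); exact: smooth_at_sph.
apply: (smooth_at_comp (g := Defs.iota (K s)) _ (smooth_at_snd_id z)); exact: smooth_at_iota.
Qed.

Lemma smooth_at_face_in q : dot q.1 y0 != 0 -> oball s q.2 -> smooth_at q face_in.
Proof.
move=> d0 q2; apply: smooth_at_pair.
  apply: (smooth_at_comp (g := cx y0 E) _ (smooth_at_fst_id q)); exact: smooth_at_cx.
apply: (smooth_at_comp (g := iota_inv (K s)) _ (smooth_at_snd_id q)); exact: smooth_at_iota_inv.
Qed.

Lemma dot_tangential m (N G : 'rV[R]_m) c : sphere m N ->
  dot (c *: N + (G - dot N G *: N)) N = c.
Proof.
move=> N1; have NN : dot N N = 1 by rewrite -enorm_sqr N1 expr1n.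
by rewrite dotDl dotZl dotDl -scaleNr dotZl NN !mulr1 (dotC G) addrN addr0.
Qed.

Lemma dot_proj m (N w G : 'rV[R]_m) :
  dot (w - dot N w *: N) G = dot w (G - dot N G *: N).
Proof.
rewrite dotDl -scaleNr dotZl [RHS]dotC dotDl -scaleNr dotZl (dotC G w).
by rewrite !mulNr mulrC.
Qed.

Section OnePhase.
Variables (phi F : W * Z -> R) (g : Z).
Hypothesis G : germ_of K phi F (y0, g).
Hypothesis gb : oball s g.
Let th := iota_inv (K s) g.
Let p := (y0, g).

(** The boundary value on S^(d-1) x (B^s)^o, read in the affine chart of the sphere and in theta. *)
Definition slice (z : V * Z) : R := fe K F (sph y0 E z.1, z.2).

Lemma slice_bvalue q : germ_of K phi F q -> face_set n.+1 s Fe q -> 0 < dot q.1 y0 ->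
  bvalue K phi q = slice (face_in q).
Proof.
move=> Gq qe d0; rewrite (bvalue_e Gq qe) /slice /fe /face_in /= -[in LHS](face_outK qe d0).
by rewrite /face_out /face_in.
Qed.

Lemma dz_slice (f : W * Z -> R) z j :
  dz j (fun z : V * Z => f (sph y0 E z.1, z.2)) z = dz j f (sph y0 E z.1, z.2).
Proof.
apply: derive_line_eq; near=> h; rewrite /= scaler0 add0r.
by congr (f (_, _)); rewrite /= scaler0 add0r.
Unshelve. all: by end_near. Qed.

Lemma gradz_slice z : gradz slice z = gradz (fe K F) (sph y0 E z.1, z.2).
Proof. by apply/rowP => j; rewrite !gradzE; exact: (dz_slice (fe K F) z j). Qed.

Lemma hessz_slice z : hessz slice z = hessz (fe K F) (sph y0 E z.1, z.2).
Proof.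
apply/matrixP => j k; apply: etrans (hesszE slice z j k) _.
apply: etrans _ (esym (hesszE (fe K F) (sph y0 E z.1, z.2) j k)).
have -> : dz k slice = (fun w => dz k (fe K F) (sph y0 E w.1, w.2)).
  by apply/funext => w; exact: (dz_slice (fe K F) w k).
exact: (dz_slice (dz k (fe K F)) z j).
Qed.

Lemma smooth_at_slice : smooth_at (0, th) slice.
Proof.
apply: (smooth_at_comp (g := fe K F) (f := fun z : V * Z => (sph y0 E z.1, z.2))).
  apply: smooth_at_pair; last exact: smooth_at_snd_id.
  apply: (smooth_at_comp (g := sph y0 E) _ (smooth_at_fst_id _)); exact: smooth_at_sph.
rewrite (sph0 _ y01); exact: (smooth_at_fe_face G gb).
Qed.

Lemma face_out0 : face_out (0, th) = p.
Proof. by rewrite /face_out /= (sph0 _ y01) iota_invK. Qed.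

Lemma face_in0 : face_in p = (0, th).
Proof. by rewrite /face_in /= (cx0 yE). Qed.

Lemma near_germ_out : \forall z \near (0, th), germ_of K phi F (face_out z).
Proof.
apply: (smooth_at_near_comp (P := germ_of K phi F) (smooth_at_face_out _)).
rewrite face_out0; exact: germ_of_near.
Qed.

Lemma gth_slice q : germ_of K phi F q -> face_set n.+1 s Fe q -> 0 < dot q.1 y0 ->
  gth K phi q = gradz slice (face_in q).
Proof.
move=> Gq qe d0; have [q1 _] := qe.
have qE : sph y0 E (cx y0 E q.1) = q.1 by rewrite (sph_cx EtE d0) unit_dir_sphere.
by rewrite (gth_e Gq qe) gradz_slice /face_in /= qE.
Qed.

(** The covector is the value times the normal plus the tangential gradient, and the chain rule
    through the chart expresses the gradient of [slice] by the latter. *)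
Lemma jet_slice z : germ_of K phi F (face_out z) ->
  exists2 xi, lambda K phi (face_out z) = (sph y0 E z.1, Defs.iota (K n.+1) xi) &
    jet1 slice z = jet_of y0 E (sph y0 E z.1, xi).
Proof.
move=> Gz; have fe_out := face_out_e z.
exists ((tg K (face_out z))^-1 *: xgrad F (face_out z)); first exact: lambda_e.
have [q1 _] := fe_out.
set N := sph y0 E z.1 in q1 *; set t := tg K (face_out z).
have N1 : sphere n.+1 N by exact: q1.
have fE : slice z = t^-1 * F (face_out z) by rewrite mulrC.
have [Gr GrE] : exists Gr, Gr = t^-1 *: grad_x F (face_out z) by eexists.
have xiE : t^-1 *: xgrad F (face_out z) = slice z *: N + (Gr - dot N Gr *: N).
  rewrite xgrad_sphere// scalerDr scalerA -fE; congr (_ + _).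
  by rewrite scalerBr scalerA GrE (dotC N (_ *: _)) dotZl (dotC _ N).
have dxi : dot (t^-1 *: xgrad F (face_out z)) N = slice z.
  by rewrite xiE; exact: dot_tangential.
rewrite /jet1 /jet_of dxi /=; congr (_, (_, _)).
  by rewrite -[RHS]/(cx y0 E N) -[N]scale1r (cx_sph y01 EE yE)// oner_neq0.
rewrite xiE addrAC subrr add0r.
have sF : smooth_at (face_out z) F by exact: Gz.1.
apply/rowP => j; rewrite mxE.
have -> : 'D_(delta_mx 0 j, 0) slice z =
    'D_(delta_mx 0 j) (fun x => t^-1 * F (sph y0 E x, Defs.iota (K s) z.2)) z.1.
  by apply: derive_line_eq; near=> h; rewrite /slice /fe /= scaler0 add0r mulrC.
have ss : smooth_at z.1 (fun x => (sph y0 E x, Defs.iota (K s) z.2)).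
  by apply: smooth_at_pair; [exact: smooth_at_sph|exact: smooth_at_cst].
have sFs : smooth_at z.1 (fun x => F (sph y0 E x, Defs.iota (K s) z.2)).
  exact: (smooth_at_comp (g := F) _ ss).
have -> : 'D_(delta_mx 0 j) (fun x => t^-1 * F (sph y0 E x, Defs.iota (K s) z.2)) z.1 =
    t^-1 * 'D_(delta_mx 0 j) (fun x => F (sph y0 E x, Defs.iota (K s) z.2)) z.1.
  by apply: deriveZ; exact/diff_derivable/smooth_at_differentiable.
rewrite (derive_comp (g := F)); last 2 first.
- exact: smooth_at_differentiable.
- exact: smooth_at_differentiable.
rewrite derive_pair; last 2 first.
- by apply: smooth_at_differentiable; exact: smooth_at_sph.
- exact: smooth_at_differentiable (smooth_at_cst _ _).
rewrite derive_cst derive_x_dot; last exact: smooth_at_differentiable.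
rewrite -[X in dot _ X]/(grad_x F (face_out z)) (derive_sph y01 yE) -/N.
(* The scaling factor in the derivative of the chart equals <N, y0>, the factor built into
   [jet_of]. *)
rewrite -(dot_sph y01 yE) -/N dotZl mulrCA.
have -> : t^-1 * dot (delta_mx 0 j *m E - dot N (delta_mx 0 j *m E) *: N) (grad_x F (face_out z)) =
    dot (delta_mx 0 j *m E - dot N (delta_mx 0 j *m E) *: N) Gr.
  by rewrite GrE (dotC _ (_ *: _)) dotZl (dotC (grad_x _ _)).
rewrite mxE; congr (_ * _).
by rewrite -dot_delta [RHS]dotC -dot_mulmxl; exact: dot_proj.
Unshelve. all: by end_near. Qed.

(** For a curve in the face, the chart turns the derivative of [gth] into u B + z D, with B and D
    the mixed and the theta-Hessian of [slice]; a combination [a] killed by B^T and D annihilates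
    all of these. *)
Lemma nondegenerate_slice :
  indep_differentials (face_set n.+1 s Fe) (gth K phi) p ->
  forall a : Z, a *m (hessxz slice (0, th))^T = 0 -> a *m hessz slice (0, th) = 0 -> a = 0.
Proof.
move=> ind a aB aD; apply: ind => e c e0 sc c0 cf.
have sc0 : smooth_at 0 c.
  apply: (smooth_on_open _ sc); last by rewrite /= oppr_lt0 e0.
  rewrite (_ : [set t | _] = `]- e, e[%classic); first exact: itv_open.
  by apply/seteqP; split=> t /=; rewrite in_itv.
have ss := smooth_at_slice.
have d0 : dot y0 y0 != 0 by rewrite (dot_y0 y01) oner_neq0.
have sm : smooth_at (0 : R) (fun t => face_in (c t)).
  by apply: (smooth_at_comp (g := face_in) _ sc0); rewrite c0; exact: smooth_at_face_in.
have sg : smooth_at (0, th) (gradz slice) by exact: smooth_at_gradz.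
have n1 : \forall t \near (0 : R), germ_of K phi F (c t).
  by apply: (smooth_at_near_comp (P := germ_of K phi F) sc0); rewrite c0; exact: germ_of_near.
have n2 : \forall t \near (0 : R), 0 < dot (c t).1 y0.
  apply: (smooth_at_near_comp (P := fun y => 0 < dot y y0) (smooth_at_fst sc0)).
  by rewrite c0; exact: near_dot_gt0.
have n3 : \forall t \near (0 : R), - e < t < e.
  have : nbhs (0 : R) `]- e, e[%classic.
    by apply: open_nbhs_nbhs; split; [exact: itv_open|rewrite /= in_itv /= oppr_lt0 e0].
  by apply: filterS => t /=; rewrite in_itv.
have n4 : \forall t \near (0 : R), gth K phi (c t) = gradz slice (face_in (c t)).
  by apply: filterS2 (near_and n1 n2) n3 => t [t1 t2] t3; apply: gth_slice => //; exact: cf.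
have sgm : smooth_at (0 : R) (fun t => gradz slice (face_in (c t))).
  by apply: (smooth_at_comp (g := gradz slice) _ sm); rewrite c0 face_in0.
have Dm : 'D_1 (fun t => gradz slice (face_in (c t))) (0 : R) =
    ('D_1 (fun t => face_in (c t)) 0).1 *m hessxz slice (0, th) +
    ('D_1 (fun t => face_in (c t)) 0).2 *m hessz slice (0, th).
  rewrite derive_comp; last 2 first.
  - exact: smooth_at_differentiable.
  - by rewrite c0 face_in0; exact: smooth_at_differentiable.
  rewrite c0 face_in0; move: ('D_1 (fun y => face_in (c y)) (0 : R)) => [u1 u2].
  exact: derive_gradz_pair.
transitivity (dot a ('D_1 (fun t => gradz slice (face_in (c t))) (0 : R))).
  apply: eq_bigr => j _; congr (_ * _).
  rewrite -derive_entry; last exact: smooth_at_differentiable.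
  by apply: near_eq_derive; apply: filterS n4 => t ->.
rewrite Dm dotC dotDl !dot_mulmxl aB -[hessz slice _]trmxK.
by rewrite (hessz_sym ss) trmxK aD !(dotC _ 0) !dot0l addr0.
Qed.
End OnePhase.
End EFace.

Section EFaceTheorem.
Context {R : realType} {n s : nat}.
Variable K : forall n, compactification R n.
Local Notation W := 'rV[R]_n.+1.
Local Notation V := 'rV[R]_n.
Local Notation Z := 'rV[R]_s.

Lemma signature_dim0 m (A B : 'M[R]_m) : m = 0%N -> signature A = signature B.
Proof. by move=> m0; subst m; congr signature; apply/matrixP => -[]. Qed.

(** The local coordinates of the Lagrangian, transferred by [jet_of], become coordinates on the
    Legendrian of critical 1-jets shared by the two slices. *)
Lemma equivalent_e_face (phi1 phi2 : W * Z -> R) (F1 F2 : W * Z -> R) (V1 V2 : set (W * Z)) y0 g1 g2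
    eta0 (u0 : V) (fch : V -> W * W) (gch : W * W -> V) :
  relopen (BB n.+1 s) V1 -> relopen (BB n.+1 s) V2 -> V1 (y0, g1) -> V2 (y0, g2) ->
  face_set n.+1 s Fe (y0, g1) -> face_set n.+1 s Fe (y0, g2) ->
  germ_of K phi1 F1 (y0, g1) -> germ_of K phi2 F2 (y0, g2) ->
  gth K phi1 (y0, g1) = 0 -> gth K phi2 (y0, g2) = 0 ->
  indep_differentials (face_set n.+1 s Fe) (gth K phi1) (y0, g1) ->
  indep_differentials (face_set n.+1 s Fe) (gth K phi2) (y0, g2) ->
  signature (hth K phi1 (y0, g1)) = signature (hth K phi2 (y0, g2)) ->
  lambda K phi1 (y0, g1) = (y0, eta0) -> lambda K phi2 (y0, g2) = (y0, eta0) ->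
  smooth_at u0 fch -> smooth_at (y0, eta0) gch -> gch (y0, eta0) = u0 -> fch u0 = (y0, eta0) ->
  (\forall q \near (y0, g1), face_set n.+1 s Fe q -> gth K phi1 q = 0 ->
     fch (gch (lambda K phi1 q)) = lambda K phi1 q) ->
  (\forall q \near (y0, g2), face_set n.+1 s Fe q -> gth K phi2 q = 0 ->
     fch (gch (lambda K phi2 q)) = lambda K phi2 q) ->
  boundary_equivalent V1 V2 (bvalue K phi1) (bvalue K phi2) (y0, g1) (y0, g2).
Proof.
move=> rV1 rV2 V1p V2p f1 f2 G1 G2 th1 th2 nd1 nd2 sg l1 l2 sf sgc g0 f0 leg1 leg2.
have [/= y01 /= gb1] := f1; have [_ /= gb2] := f2.
have [E [EE yE EtE]] := sphere_frame y01.
pose h1 := slice K y0 E F1; pose h2 := slice K y0 E F2.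
pose t1 := iota_inv (K s) g1; pose t2 := iota_inv (K s) g2.
pose fo (z : V * Z) : W * Z := face_out K y0 E z.
pose fi (q : W * Z) : V * Z := face_in K y0 E q.
have sh1 : smooth_at (0, t1) h1 by exact: (smooth_at_slice y01 yE G1 gb1).
have sh2 : smooth_at (0, t2) h2 by exact: (smooth_at_slice y01 yE G2 gb2).
have d0 : 0 < dot y0 y0 by rewrite (dot_y0 y01).
have fi0 g : fi (y0, g) = (0, iota_inv (K s) g) by exact: face_in0.
have fo0 g : oball s g -> fo (0, iota_inv (K s) g) = (y0, g) by move=> gb; exact: face_out0.
have gz1 : gradz h1 (0, t1) = 0 by rewrite -fi0 -(gth_slice EtE G1 f1).
have gz2 : gradz h2 (0, t2) = 0 by rewrite -fi0 -(gth_slice EtE G2 f2).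
have n1 := nondegenerate_slice y01 yE EtE G1 gb1 nd1.
have n2 := nondegenerate_slice y01 yE EtE G2 gb2 nd2.
have ieta : exists xi0, eta0 = Defs.iota (K n.+1) xi0.
  by move: l1; rewrite (lambda_e G1 f1) => -[<-]; eexists.
have [xi0 eta0E] := ieta.
have jet0 phi F g : germ_of K phi F (y0, g) -> oball s g -> lambda K phi (y0, g) = (y0, eta0) ->
    jet1 (slice K y0 E F) (0, iota_inv (K s) g) = jet_of y0 E (y0, xi0).
  move=> G gb; have Gz : germ_of K phi F (fo (0, iota_inv (K s) g)) by rewrite fo0.
  have [xi] := jet_slice y01 EE yE Gz.
  rewrite (face_out0 K E y01 gb) /= (sph0 E y01) => -> -> [] e.
  by rewrite -[xi](iotaK (K n.+1)) e eta0E iotaK.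
have j1 := jet0 _ _ _ G1 gb1 l1; have j2 := jet0 _ _ _ G2 gb2 l2.
(* From chart coordinates to (y, eta), then to the covector by [iota_inv], then to the 1-jet; [c']
   retraces these steps. *)
pose c (u : V) := jet_of y0 E ((fch u).1, iota_inv (K n.+1) (fch u).2).
pose c' (j : R * (V * V)) := gch ((of_jet y0 E j).1, Defs.iota (K n.+1) (of_jet y0 E j).2).
have dn0 : dot y0 y0 != 0 by rewrite gt_eqF.
have sc : smooth_at u0 c.
  apply: (smooth_at_comp (g := jet_of y0 E)); last by apply: smooth_at_jet_of; rewrite f0.
  apply: smooth_at_pair; first exact: smooth_at_fst.
  apply: (smooth_at_comp (g := iota_inv (K n.+1)) _ (smooth_at_snd sf)).
  by apply: smooth_at_iota_inv; rewrite f0 /= eta0E; exact: iota_oball.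
have ojK : of_jet y0 E (jet_of y0 E (y0, xi0)) = (y0, xi0) by exact: (jet_ofK EtE).
have sc' : smooth_at (jet1 h1 (0, t1)) c'.
  rewrite j1; have so := smooth_at_of_jet y01 yE (jet_of y0 E (y0, xi0)).
  apply: (smooth_at_comp (g := gch)); last by rewrite ojK /= -eta0E.
  apply: smooth_at_pair; first exact: smooth_at_fst.
  by apply: (smooth_at_comp (g := Defs.iota (K n.+1)) _ (smooth_at_snd so)); exact: smooth_at_iota.
have c'0 : c' (jet1 h1 (0, t1)) = u0 by rewrite j1 /c' ojK /= -eta0E.
have leg phi F g : germ_of K phi F (y0, g) -> oball s g ->
    (\forall q \near (y0, g), face_set n.+1 s Fe q -> gth K phi q = 0 ->
       fch (gch (lambda K phi q)) = lambda K phi q) ->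
    \forall z \near (0, iota_inv (K s) g), gradz (slice K y0 E F) z = 0 ->
      c (c' (jet1 (slice K y0 E F) z)) = jet1 (slice K y0 E F) z.
  move=> G gb lg.
  have m1 := near_germ_out y01 yE G gb.
  have m2 : \forall z \near (0, iota_inv (K s) g), face_set n.+1 s Fe (fo z) -> gth K phi (fo z) = 0 ->
       fch (gch (lambda K phi (fo z))) = lambda K phi (fo z).
    apply: (smooth_at_near_comp (P := fun q => face_set n.+1 s Fe q -> gth K phi q = 0 ->
      fch (gch (lambda K phi q)) = lambda K phi q) (smooth_at_face_out K y01 yE _)).
    by rewrite (face_out0 K E y01 gb).
  apply: filterS2 m1 m2 => z Gz lz gz.
  have ez := face_out_e K y01 yE z; have dz := dot_sph_gt0 y01 yE z.1.
  have gthz : gth K phi (fo z) = 0.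
    by rewrite (gth_slice EtE Gz ez dz) (face_inK K y01 EE yE).
  have := lz ez gthz; have [xi lE jE] := jet_slice y01 EE yE Gz.
  rewrite (lE : lambda K phi (fo z) = _) jE => h.
  have [N1 _] := ez.
  rewrite /c /c' (jet_ofK EtE _ (N1 : sphere n.+1 (sph y0 E z.1)) dz) h /= iotaK; exact: erefl.
have L1 := leg _ _ _ G1 gb1 leg1; have L2 := leg _ _ _ G2 gb2 leg2.
have [a1 [a2 [a10 a20 asg]]] : exists a1 a2 : R, [/\ 0 < a1, 0 < a2 &
    signature (a1 *: hessz h1 (0, t1)) = signature (a2 *: hessz h2 (0, t2))].
  (* In dimension 0 the sign of the boundary defining function is not determined, but all Hessians
     are empty, so any positive factors serve. *)
  case: (posnP s) => [s0|s0].
    exists 1, 1; split; [exact: ltr01|exact: ltr01|exact: signature_dim0].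
  exists (tg K (y0, g1))^-1, (tg K (y0, g2))^-1.
  split; [by rewrite invr_gt0 bdf_gt0|by rewrite invr_gt0 bdf_gt0|].
  move: sg; rewrite (hth_e G1 f1) (hth_e G2 f2) /h1 /h2 !hessz_slice /= (sph0 _ y01).
  exact: id.
have jet12 : jet1 h1 (0, t1) = jet1 h2 (0, t2) by rewrite j1 j2.
have [k [k' [[k0 sk sk' k'k kk'] hk]]] := legendrian_equivalence sh1 sh2 gz1 gz2 n1 n2 jet12 sc sc'
  c'0 L1 L2 a10 a20 asg.
pose ka q := fo (k (fi q)); pose ka' q := fo (k' (fi q)).
have sfi g : oball s g -> smooth_at (y0, g) fi by move=> gb; exact: smooth_at_face_in.
have sfo z : smooth_at z fo by exact: smooth_at_face_out.
have ska : smooth_at (y0, g1) ka.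
  apply: (smooth_at_comp (g := fo)); last exact: sfo.
  by apply: (smooth_at_comp (g := k) _ (sfi _ gb1)); rewrite fi0.
have ska' : smooth_at (y0, g2) ka'.
  apply: (smooth_at_comp (g := fo)); last exact: sfo.
  by apply: (smooth_at_comp (g := k') _ (sfi _ gb2)); rewrite fi0.
have ka0 : ka (y0, g1) = (y0, g2) by rewrite /ka fi0 k0 fo0.
have m1 : \forall q \near (y0, g1), k' (k (fi q)) = fi q.
  by apply: (smooth_at_near_comp (P := fun z => k' (k z) = z) (sfi _ gb1)); rewrite fi0.
have m2 : \forall q \near (y0, g2), k (k' (fi q)) = fi q.
  by apply: (smooth_at_near_comp (P := fun z => k (k' z) = z) (sfi _ gb2)); rewrite fi0.
have m3 : \forall q \near (y0, g1), h2 (k (fi q)) = h1 (fi q).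
  by apply: (smooth_at_near_comp (P := fun z => h2 (k z) = h1 z) (sfi _ gb1)); rewrite fi0.
have m4 : \forall q \near (y0, g1), germ_of K phi2 F2 (ka q).
  by apply: (smooth_at_near_comp (P := germ_of K phi2 F2) ska); rewrite ka0; exact: germ_of_near.
have md (g : Z) : \forall q \near (y0, g), 0 < dot q.1 y0.
  exact: (smooth_at_near_comp (P := fun y => 0 < dot y y0) (smooth_at_fst_id (y0, g)) (near_dot_gt0 y01)).
have mb (g : Z) : oball s g -> \forall q \near (y0, g), oball s q.2.
  move=> gb; exact: (smooth_at_near_comp (P := oball s) (smooth_at_snd_id (y0, g)) (near_enorm_lt gb)).
have fiK z : fi (fo z) = z by exact: face_inK.
have foK q : face_set n.+1 s Fe q -> 0 < dot q.1 y0 -> fo (fi q) = q by exact: face_outK.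
have foe z : face_set n.+1 s Fe (fo z) by exact: face_out_e.
have bd1 : BBboundary n.+1 s (y0, g1) by exists Fe.
have bd2 : BBboundary n.+1 s (y0, g2) by exists Fe.
apply: (face_homeomorphism rV1 rV2 V1p V2p bd1 bd2 ska ska' ka0).
- apply: filterS2 (near_and (near_and m1 (md g1)) (near_and m3 m4)) (near_and (germ_of_near G1) (mb _ gb1)).
  move=> q [[q1 q2] [q3 q4]] [q5 q6] X Xq.
  have [XE sq] := face_oball_snd q6 Xq; rewrite XE in Xq *.
  have dk : 0 < dot (ka q).1 y0 by exact: dot_sph_gt0.
  split; first exact: foe.
    by rewrite /ka' /ka fiK q1 foK.
  rewrite (slice_bvalue EtE q4 (foe _) dk) (slice_bvalue EtE q5 Xq q2).
  by rewrite (fiK (k (fi q)) : face_in K y0 E (ka q) = _); exact: q3.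
- apply: filterS2 (near_and m2 (md g2)) (mb _ gb2) => q [q1 q2] q6 X Xq.
  have [XE sq] := face_oball_snd q6 Xq; rewrite XE in Xq *.
  split; first exact: foe.
  by rewrite /ka' /ka fiK q1 foK.
Qed.
End EFaceTheorem.

(** * The parametrized Lagrangian near the base point *)

Section InteriorChart.
Context {R : realType}.

Lemma sphere_dim0 (y : 'rV[R]_0) : ~ sphere 0 y.
Proof. by move=> /sphere_neq0/eqP; apply; apply/rowP => -[]. Qed.

Lemma halfspace_interior m (u0 : 'rV[R]_m) : halfspace u0 -> ~ hyperplane u0 ->
  \forall u \near u0, halfspace u.
Proof.
case: m u0 => [|m] u0 h0 nh; first by near=> u => -[].
have u00 : 0 < u0 0 0.
  rewrite lt_def h0// andbT; apply/eqP => e; apply: nh; by exists 0.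
have sc : smooth_at u0 (fun u : 'rV[R]_m.+1 => u 0 0) by apply: smooth_at_coord; exact: smooth_at_id.
have pos : \forall u \near u0, 0 < (u : 'rV[R]_m.+1) 0 0 by exact: (cvgr_gt _ (smooth_at_continuous sc)).
apply: filterS pos => u u1 i i0; rewrite (_ : i = 0) ?ltW//; exact: val_inj.
Unshelve. all: by end_near. Qed.

(** Away from the boundary hyperplane the chart domain is a full neighbourhood in R^k, so the
    parametrization is a smooth germ; the coordinate map is replaced by an ambient smooth
    extension. *)
Lemma interior_chart (U : normedModType R) k (M : set U) (q : U) :
  submanifold k M -> M q -> ~ mboundary k M q ->
  exists (u0 : 'rV[R]_k) (f : 'rV[R]_k -> U) (g : U -> 'rV[R]_k),
    [/\ smooth_at u0 f, smooth_at q g, f u0 = q, g q = u0 &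
        \forall z \near q, M z -> f (g z) = z].
Proof.
move=> sM Mq nb; have [u0 ch] := sM q Mq.
have nh : ~ hyperplane u0 by move=> h; apply: nb; split=> //; exists u0.
have [D [W [f [g [[oD Dq] [[A oA WE] Wu0] fu0 [[inv1 inv2 inv3 inv4] sf sg]]]]]] := ch.
have [A0 h0] : (A `&` @halfspace R k) u0 by rewrite -WE.
have Wn : \forall u \near u0, W u.
  have nA : nbhs u0 A by exact: open_nbhs_nbhs.
  by apply: filterS2 nA (halfspace_interior h0 nh) => u Au hu; rewrite WE.
have [D1 [f1 [oD1 D1u Cf1 f1E]]] := sf u0 Wu0.
have [D2 [g1 [oD2 D2q Cg1 g1E]]] := sg q (conj Mq Dq).
exists u0, f, g1; split=> //.
- apply: (@eq_smooth_at _ _ _ _ f1); last by exists D1.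
  have nD : nbhs u0 D1 by exact: open_nbhs_nbhs.
  by apply: filterS2 Wn nD => u Wu Du; exact: f1E.
- by exists D2.
- by rewrite g1E// -{1}fu0 inv3.
- have n1 : nbhs q D by exact: open_nbhs_nbhs.
  have n2 : nbhs q D2 by exact: open_nbhs_nbhs.
  by apply: filterS2 n1 n2 => z Dz D2z Mz; rewrite g1E//; exact: inv4.
Qed.
End InteriorChart.

Section LagrangianPoint.
Context {R : realType} {d : nat}.
Variable K : forall n, compactification R n.

(** The corner of the Lagrangian lies over a product of two spheres, which excludes [eta0] in the
    open ball, and the interior of [Lpsi] lies over the open ball, which excludes [y0] on the
    sphere. *)
Lemma lagrangian_e_point (Le Lpsi : set ('rV[R]_d * 'rV[R]_d)) y0 eta0 :
  SG_Lagrangian K Le Lpsi -> (Le `|` Lpsi) (y0, eta0) -> sphere d y0 -> oball d eta0 ->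
  [/\ Le (y0, eta0), ~ mboundary d.-1 Le (y0, eta0) & ~ Lpsi (y0, eta0)].
Proof.
move=> HL HL0 ys eb.
have nc : ~ (Le `&` Lpsi) (y0, eta0).
  by move=> /(corner_sub HL)[_] /sphere_not_oball.
have nL : ~ Lpsi (y0, eta0).
  move=> Lp; have nb : ~ mboundary d.-1 Lpsi (y0, eta0) by rewrite -(corner_psi HL).
  by have [+ _] := Lpsi_interior HL (conj Lp nb); exact: sphere_not_oball.
split=> //; first by case: HL0.
by rewrite -(corner_e HL).
Qed.
End LagrangianPoint.

Section Parametrized.
Context {R : realType} {d s : nat}.
Variable K : forall n, compactification R n.

(** [Lpsi] is closed and misses the base point, so the images of nearby critical points lie in [Le],
    where the chart applies. *)
Lemma parametrized_chart (V : set ('rV[R]_d * 'rV[R]_s)) phi F (Le Lpsi : set ('rV[R]_d * 'rV[R]_d))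
    y0 eta0 g k (fch : 'rV[R]_k -> 'rV[R]_d * 'rV[R]_d) gch :
  relopen (BB d s) V -> V (y0, g) -> face_set d s Fe (y0, g) -> germ_of K phi F (y0, g) ->
  parametrizes K V phi (Le `|` Lpsi) (y0, eta0) (y0, g) ->
  closed Lpsi -> ~ Lpsi (y0, eta0) ->
  (\forall z \near (y0, eta0), Le z -> fch (gch z) = z) ->
  \forall q \near (y0, g), face_set d s Fe q -> gth K phi q = 0 ->
    fch (gch (lambda K phi q)) = lambda K phi q.
Proof.
move=> rV Vp pe G [lp [U [W [[rU Up] [rW Wp] LU]]]] cL nL ch.
have [y1 g1] := pe.
(* A smooth ambient extension of [lambda], which allows properties near [(y0, eta0)] to be pulled
   back to a neighbourhood of [(y0, g)]. *)
pose La q : 'rV[R]_d * 'rV[R]_d := (q.1, Defs.iota (K d) ((tg K q)^-1 *: xgrad F q)).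
have sLa : smooth_at (y0, g) La.
  apply: smooth_at_pair; first exact: smooth_at_fst_id.
  apply: (smooth_at_comp (g := Defs.iota (K d))); last exact: smooth_at_iota.
  apply: smooth_at_scale; last by apply: smooth_at_xgrad; [exact: G.1|exact: sphere_neq0].
  by apply: smooth_atV; [exact: smooth_at_tg|exact: bdf_neq0].
have La0 : La (y0, g) = (y0, eta0) by rewrite lp (lambda_e G pe).
have nLp : \forall z \near (y0, eta0), ~ Lpsi z.
  by apply: open_nbhs_nbhs; split=> //; exact: closed_openC.
have n1 : \forall q \near (y0, g), ~ Lpsi (La q) /\ (Le (La q) -> fch (gch (La q)) = La q).
  apply: (smooth_at_near_comp (P := fun z => ~ Lpsi z /\ (Le z -> fch (gch z) = z)) sLa).
  by rewrite La0; exact: near_and.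
have n2 := near_and (relopen_near rV Vp) (relopen_near rW Wp).
apply: filterS2 (near_and n1 n2) (germ_of_near G) => q [[q1 q2] [q3 q4]] Gq qe gq.
have qb : BB d s q by apply: boundary_BB; exists Fe.
have lq : lambda K phi q = La q by exact: lambda_e.
have : ((Le `|` Lpsi) `&` U) (lambda K phi q).
  rewrite LU; exists q => //; split; last exact: q4.
  by split=> //; [exists Fe|exact: q3].
by rewrite lq => -[[Lq _|Lq _]] //; exact: q2.
Qed.
End Parametrized.

(** * The case distinction on the face containing the base points *)

Theorem theorem4p2 (R : realType) (K : forall n, compactification R n)
  (d s : nat)
  (V1 V2 : set ('rV[R]_d * 'rV[R]_s))
  (phi1 phi2 : 'rV[R]_d * 'rV[R]_s -> R)
  (phase1 : phase_function K V1 phi1) (phase2 : phase_function K V2 phi2)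
  (nondeg1 : nondegenerate_phase K V1 phi1) (nondeg2 : nondegenerate_phase K V2 phi2)
  (Le Lpsi : set ('rV[R]_d * 'rV[R]_d)) (HL : SG_Lagrangian K Le Lpsi)
  (y0 eta0 : 'rV[R]_d) (HL0 : (Le `|` Lpsi) (y0, eta0))
  (g1 g2 : 'rV[R]_s)
  (crit1 : critical K V1 phi1 (y0, g1)) (crit2 : critical K V2 phi2 (y0, g2))
  (par1 : parametrizes K V1 phi1 (Le `|` Lpsi) (y0, eta0) (y0, g1))
  (par2 : parametrizes K V2 phi2 (Le `|` Lpsi) (y0, eta0) (y0, g2))
  (val12 : bvalue K phi1 (y0, g1) = bvalue K phi2 (y0, g2))
  (sig12 : forall X : face, face_set d s X (y0, g1) -> face_set d s X (y0, g2) ->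
     signature (hth K phi1 (y0, g1)) = signature (hth K phi2 (y0, g2))) :
  exists (N1 N2 : set ('rV[R]_d * 'rV[R]_s))
         (kappa kappa' : 'rV[R]_d * 'rV[R]_s -> 'rV[R]_d * 'rV[R]_s),
    [/\ [/\ relopen (BBboundary d s) N1, N1 (y0, g1) & N1 `<=` V1],
        [/\ relopen (BBboundary d s) N2, N2 (y0, g2) & N2 `<=` V2],
        homeo_on N1 N2 kappa kappa' /\ kappa (y0, g1) = (y0, g2),
        [/\ (forall X p, N1 p -> face_set d s X p -> face_set d s X (kappa p)),
            smooth_on (N1 `&` closed_face_e d s) kappa &
            smooth_on (N1 `&` closed_face_psi d s) kappa] &
        forall p, N1 p -> bvalue K phi2 (kappa p) = bvalue K phi1 p].

Proof.
have [V1p V2p] : V1 (y0, g1) /\ V2 (y0, g2) by case: crit1 => _ + _; case: crit2.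
have [rV1 rV2] : relopen (BB d s) V1 /\ relopen (BB d s) V2.
  by case: phase1 => -[+ _] _; case: phase2 => -[+ _] _.
have [F1 G1] := classical_germ phase1.1 V1p.
have [F2 G2] := classical_germ phase2.1 V2p.
have [bd1 _ th1] := crit1; have [bd2 _ th2] := crit2.
(* At a critical point the theta-component vanishes, so the phase condition forces the x-component
   to be nonzero. *)
have gx1 : gx K phi1 (y0, g1) != 0.
  by apply/eqP => h; have := phase1.2 _ V1p bd1; rewrite h th1.
have gx2 : gx K phi2 (y0, g2) != 0.
  by apply/eqP => h; have := phase2.2 _ V2p bd2; rewrite h th2.
have lam1 := par1.1; have lam2 := par2.1.
suff : boundary_equivalent V1 V2 (bvalue K phi1) (bvalue K phi2) (y0, g1) (y0, g2) by [].
(* [eta0] tells the faces over the sphere apart: it is a unit vector at the corner and interior on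
   S^(d-1) x (B^s)^o. Hence both critical points lie in the same face. *)
have corner_eta phi F g : germ_of K phi F (y0, g) -> face_set d s Fpsie (y0, g) ->
    gx K phi (y0, g) != 0 -> (y0, eta0) = lambda K phi (y0, g) -> sphere d eta0.
  move=> G f; have [/= ys /= gs] := f.
  rewrite (gx_sphere G ys (sphere_cball gs)) => x0; rewrite (lambda_corner G f x0) => -[->].
  exact: enorm_unit_dir.
have e_eta phi F g : germ_of K phi F (y0, g) -> face_set d s Fe (y0, g) ->
    (y0, eta0) = lambda K phi (y0, g) -> oball d eta0.
  by move=> G f; rewrite (lambda_e G f) => -[->]; exact: iota_oball.
have [X1 f1] := bd1; have [X2 f2] := bd2.
case: X1 f1 => f1.
- case: X2 f2 => f2.
  + have [ys _] := f1; have eb := e_eta _ _ _ G1 f1 lam1.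
    have [Le0 nb nL] := lagrangian_e_point HL HL0 ys eb.
    have [u0 [fch [gch [sfch sgch f0 g0 chart]]]] := interior_chart (Le_submanifold HL) Le0 nb.
    have leg1 := parametrized_chart rV1 V1p f1 G1 par1 (Lpsi_closed HL) nL chart.
    have leg2 := parametrized_chart rV2 V2p f2 G2 par2 (Lpsi_closed HL) nL chart.
    have nd1 := nondeg1 _ _ crit1 f1; have nd2 := nondeg2 _ _ crit2 f2.
    have sg := sig12 _ f1 f2.
    clear -rV1 rV2 V1p V2p f1 f2 G1 G2 th1 th2 nd1 nd2 sg lam1 lam2 sfch sgch f0 g0 leg1 leg2 ys.
    (* The sphere charts are written in dimension [n.+1]; in dimension 0 the sphere containing [y0]
       would be empty. *)
    case: d => [|n] in K V1 V2 phi1 phi2 F1 F2 y0 eta0 fch gch u0 rV1 rV2 V1p V2p f1 f2 G1 G2 th1 th2 nd1 nd2 sg lam1 lam2 sfch sgch f0 g0 leg1 leg2 ys *.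
      by case: (sphere_dim0 ys).
    exact: (equivalent_e_face rV1 rV2 V1p V2p f1 f2 G1 G2 th1 th2 nd1 nd2 sg (esym lam1) (esym lam2) sfch sgch g0 f0 leg1 leg2).
  + by have [ys _] := f1; have [yb _] := f2; case: (sphere_not_oball ys yb).
  + by case: (sphere_not_oball (corner_eta _ _ _ G2 f2 gx2 lam2) (e_eta _ _ _ G1 f1 lam1)).
- have [yb _] := f1; have [E2 _] := face_oball_fst (yb : oball d (y0, g2).1) f2.
  rewrite E2 in f2.
  exact: (equivalent_psi_face rV1 rV2 V1p V2p f1 f2 G1 G2 gx1 gx2 val12).
- have [ys gs] := f1; case: X2 f2 => f2.
  + by case: (sphere_not_oball (corner_eta _ _ _ G1 f1 gx1 lam1) (e_eta _ _ _ G2 f2 lam2)).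
  + by have [yb _] := f2; case: (sphere_not_oball ys yb).
  + clear -rV1 rV2 V1p V2p f1 f2 G1 G2 gx1 gx2 th1 th2 ys.
    case: d => [|n] in K V1 V2 phi1 phi2 F1 F2 y0 rV1 rV2 V1p V2p f1 f2 G1 G2 gx1 gx2 th1 th2 ys *.
      by case: (sphere_dim0 ys).
    exact: (equivalent_corner rV1 rV2 V1p V2p f1 f2 G1 G2 gx1 gx2 th1 th2).
Qed.
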